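(* Every admissible compactly supported separable shearlet system $\mathcal{SH}(\phi,\psi,\widetilde\psi,c)=\Phi(\phi,c_1)\cup\Psi(\psi,c)\cup\widetilde\Psi(\widetilde\psi,c)$ is linearly independent.
   Context: Conventions: $\mathbb{N}=\{1,2,\dots\}$. A countable family $\{f_i\}_{i\in I}$ in a Banach space is called linearly independent (finitely linearly independent) if for every finite $J\subset I$, $\sum_{i\in J}c_if_i=0$ holds if and only if $c_i=0$ for all $i\in J$. The systems below are regarded as families indexed by their parameters. Multiresolution analysis (MRA): a sequence $(V_j)_{j\in\mathbb{Z}}$ of closed subspaces of $L^2(\mathbb{R})$ such that (i) $V_j\subset V_{j+1}$ for all $j$; (ii) $\overline{\bigcup_{j}V_j}=L^2(\mathbb{R})$ and $\bigcap_jV_j=\{0\}$; (iii) $f\in V_j$ if and only if $f(2\,\cdot)\in V_{j+1}$; (iv) there is $\phi^1\in L^2(\mathbb{R})$ (called the scaling function) such that $\{\phi^1(\cdot-m):m\in\mathbb{Z}\}$ is an orthonormal basis of $V_0$. A corresponding wavelet to $\phi^1$ is a function $\psi^1\in L^2(\mathbb{R})$ such that, with $\psi^1_{j,m}=2^{j/2}\psi^1(2^j\cdot-m)$, the family $\{\psi^1_{j,m}:j,m\in\mathbb{Z}\}$ is an orthonormal basis of $L^2(\mathbb{R})$ and $P_{j+1}=P_j+\sum_{m\in\mathbb{Z}}\langle\cdot,\psi^1_{j,m}\rangle\psi^1_{j,m}$ for all $j\in\mathbb{Z}$, where $P_j$ is the orthogonal projection onto $V_j$. Shearlet system: for $j\in\mathbb{N}\cup\{0\}$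 and $k\in\mathbb{Z}$ put $A_{2^j}=\begin{pmatrix}2^j&0\\0&2^{\lfloor j/2\rfloor}\end{pmatrix}$, $S_k=\begin{pmatrix}1&k\\0&1\end{pmatrix}$, $P=\begin{pmatrix}0&1\\1&0\end{pmatrix}$, $\widetilde A_{2^j}=PA_{2^j}P$. For $c=(c_1,c_2)\in\mathbb{R}^+\times\mathbb{R}^+$ put $\widetilde c=Pc=(c_2,c_1)$, and for $m=(m_1,m_2)\in\mathbb{Z}^2$ write $cm=(c_1m_1,c_2m_2)$, $\widetilde cm=(c_2m_1,c_1m_2)$. For $\phi,\psi,\widetilde\psi\in L^2(\mathbb{R}^2)$ the (cone-adapted discrete) shearlet system is $\mathcal{SH}(\phi,\psi,\widetilde\psi,c)=\Phi(\phi,c_1)\cup\Psi(\psi,c)\cup\widetilde\Psi(\widetilde\psi,c)$ with $\Phi(\phi,c_1)=\{\phi(\cdot-c_1m):m\in\mathbb{Z}^2\}$, $\Psi(\psi,c)=\{\psi_{j,k,m}=2^{3j/4}\psi(S_kA_{2^j}\cdot-cm):j\ge0,\ |k|\le2^{\lfloor j/2\rfloor},\ m\in\mathbb{Z}^2\}$, $\widetilde\Psi(\widetilde\psi,c)=\{\widetilde\psi_{j,k,m}=2^{3j/4}\widetilde\psi(S_k^T\widetilde A_{2^j}\cdot-\widetilde cm):j\ge0,\ |k|\le2^{\lfloor j/2\rfloor}-1,\ m\in\mathbb{Z}^2\}$. Admissibility: let $\phi^1\in L^2(\mathbb{R})$ be a continuous compactly supported scaling function of an MRA and $\psi^1\in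 L^2(\mathbb{R})$ a corresponding compactly supported wavelet; put $\phi(x_1,x_2)=\phi^1(x_1)\phi^1(x_2)$, $\psi(x_1,x_2)=\psi^1(x_1)\phi^1(x_2)$, $\widetilde\psi(x_1,x_2)=\psi(x_2,x_1)$. Let $c=(c_1,c_2)\in\mathbb{Q}^+\times\mathbb{Q}^+$ with $c_i=a_i/b_i$, $a_i,b_i\in\mathbb{N}$, $b_i$ odd, and suppose that for $i=1,2$ the one-dimensional system $\{\phi^1(\cdot-c_im),\ \psi^1(2^j\cdot-c_im):j\ge0,\ m\in\mathbb{Z}\}$ is linearly independent. Then $\mathcal{SH}(\phi,\psi,\widetilde\psi,c)$ is called an admissible compactly supported separable shearlet system. *)

(* Defs.v *)
From HB Require Import structures.
From mathcomp Require Import all_boot all_order all_algebra.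
From mathcomp Require Import finmap.
From mathcomp Require Import complex.
From mathcomp Require Import all_classical all_reals all_analysis.

Set Implicit Arguments.
Unset Strict Implicit.
Unset Printing Implicit Defensive.

Import Order.TTheory GRing.Theory Num.Theory.
Import numFieldNormedType.Exports.

Local Open Scope classical_set_scope.
Local Open Scope ring_scope.
Local Open Scope complex_scope.

(* Complex-valued L^2(mu).  Elements are represented by measurable functions
   (Borel measurable ones for Lebesgue measure on R); equality in L^2 is
   equality mu-almost everywhere. *)
Section L2.
Context d (T : measurableType d) (R : realType)
  (mu : {measure set T -> \bar R}).

Definition L2norm (f : T -> R[i]) : \bar R :=
  Lnorm mu 2%:E (fun x => (ComplexField.Normc.normc (f x))%:E).

Definition L2 : set (T -> R[i]) := [set f |
  measurable_fun setT (fun x => complex.Re (f x)) /\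
  measurable_fun setT (fun x => complex.Im (f x)) /\
  (L2norm f < +oo)%E].

Definition L2inner (f g : T -> R[i]) : R[i] :=
  (\int[mu]_x complex.Re (f x * (g x)^*)) +i*
  (\int[mu]_x complex.Im (f x * (g x)^*)).

Definition eq0_L2 (f : T -> R[i]) : Prop := {ae mu, forall x, f x = 0}.

Definition lincomb (I : choiceType) (e : I -> T -> R[i]) (c : I -> R[i])
    (J : {fset I}) : T -> R[i] :=
  fun x => \sum_(i <- J) c i * e i x.

Definition linear_span (I : choiceType) (e : I -> T -> R[i]) : set (T -> R[i]) :=
  [set f | exists (J : {fset I}) (c : I -> R[i]), f = lincomb e c J].

Definition L2closure (A : set (T -> R[i])) : set (T -> R[i]) :=
  [set f | L2 f /\
    forall eps : R, 0 < eps ->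
      exists2 g, A g & (L2norm (fun x => f x - g x)%R < eps%:E)%E].

(* Closedness includes invariance under almost everywhere equality. *)
Definition closed_subspace (V : set (T -> R[i])) : Prop :=
  [/\ V `<=` L2,
      V (fun=> 0),
      forall (a : R[i]) f g, V f -> V g -> V (fun x => a * f x + g x) &
      L2closure V `<=` V].

Definition orthonormal_basis (V : set (T -> R[i])) (I : choiceType)
    (e : I -> T -> R[i]) : Prop :=
  [/\ forall i, V (e i),
      forall i j, L2inner (e i) (e j) = (i == j)%:R &
      L2closure (linear_span e) = V].

Definition orthogonal_projection (V : set (T -> R[i]))
    (P : (T -> R[i]) -> (T -> R[i])) : Prop :=
  forall f, L2 f ->
    V (P f) /\ forall g, V g -> L2inner (fun x => f x - P f x) g = 0.

(* g = \sum_i F i, unconditionally in L^2. *)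
Definition has_L2sum (I : choiceType) (F : I -> T -> R[i]) (g : T -> R[i]) :
    Prop :=
  forall eps : R, 0 < eps ->
    exists J0 : {fset I}, forall J : {fset I}, (J0 `<=` J)%fset ->
      (L2norm (fun x => g x - \sum_(i <- J) F i x)%R < eps%:E)%E.

(* The family (f i), i in D, is linearly independent in L^2; members of the
   family with different indices count separately even if they coincide. *)
Definition linearly_independent (I : choiceType) (D : set I)
    (f : I -> T -> R[i]) : Prop :=
  forall J : {fset I}, [set` J] `<=` D ->
  forall c : I -> R[i],
    eq0_L2 (lincomb f c J) <-> (forall i, i \in J -> c i = 0).

End L2.

Section Wavelets.
Context (R : realType).

Let leb := @lebesgue_measure R.

Definition translates (phi : R -> R[i]) (m : int) : R -> R[i] :=
  fun x => phi (x - m%:~R).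

Definition scaling_function (V : int -> set (R -> R[i])) (phi : R -> R[i]) :
    Prop :=
  L2 leb phi /\ orthonormal_basis leb (V 0) (translates phi).

Definition MRA (V : int -> set (R -> R[i])) : Prop :=
  [/\ forall j, closed_subspace leb (V j),
      forall j, V j `<=` V (j + 1),
      L2closure leb (\bigcup_j V j) = L2 leb /\
      \bigcap_j V j = [set f | L2 leb f /\ eq0_L2 leb f],
      forall j f, V j f <-> V (j + 1) (fun x => f (2 * x)) &
      exists phi, scaling_function V phi].

Definition wavelet_family (psi : R -> R[i]) (jm : int * int) : R -> R[i] :=
  fun x => (2 `^ (jm.1%:~R / 2))%:C * psi ((2 : R) ^ jm.1 * x - jm.2%:~R).

Definition corresponding_wavelet (V : int -> set (R -> R[i]))
    (psi : R -> R[i]) : Prop :=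
  [/\ L2 leb psi,
      orthonormal_basis leb (L2 leb) (wavelet_family psi) &
      exists P : int -> (R -> R[i]) -> (R -> R[i]),
        (forall j, orthogonal_projection leb (V j) (P j)) /\
        forall j f, L2 leb f ->
          has_L2sum leb
            (fun (m : int) x => L2inner leb f (wavelet_family psi (j, m)) *
                                wavelet_family psi (j, m) x)
            (fun x => P (j + 1) f x - P j f x)].

Definition compactly_supported (f : R -> R[i]) : Prop :=
  exists K : set R, compact K /\ {ae leb, forall x, ~ K x -> f x = 0}.

(* phi(. - c m) for m in Z, and psi(2^j . - c m) for j >= 0, m in Z. *)
Definition system1d (phi psi : R -> R[i]) (c : R) (i : int + nat * int) :
    R -> R[i] :=
  match i with
  | inl m => fun x => phi (x - c * m%:~R)
  | inr (j, m) => fun x => psi (2 ^+ j * x - c * m%:~R)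
  end.

End Wavelets.

Section Shearlets.
Context (R : realType).

(* Column vectors are pairs (x1, x2): the matrices A_{2^j}, S_k, S_k^T and P, in
   this order, as linear maps; j./2 is the floor of j/2. *)
Definition dilation (j : nat) (x : R * R) : R * R :=
  (2 ^+ j * x.1, 2 ^+ j./2 * x.2).
Definition shear (k : int) (x : R * R) : R * R := (x.1 + k%:~R * x.2, x.2).
Definition shearT (k : int) (x : R * R) : R * R := (x.1, k%:~R * x.1 + x.2).
Definition swap (x : R * R) : R * R := (x.2, x.1).
Definition dilation_tilde (j : nat) (x : R * R) : R * R :=
  swap (dilation j (swap x)).

(* x - cm for c in R^2 and m in Z^2, with cm = (c1 m1, c2 m2). *)
Definition lattice_shift (c : R * R) (m : int * int) (x : R * R) : R * R :=
  (x.1 - c.1 * m.1%:~R, x.2 - c.2 * m.2%:~R).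

(* m for Phi, (j, k, m) for Psi and (j, k, m) for the tilde version of Psi;
   the range of k is constrained by shearlet_range. *)
Definition shearlet_parameter : choiceType :=
  (int * int + nat * int * (int * int) + nat * int * (int * int))%type.

Definition shearlet_range : set shearlet_parameter := fun i =>
  match i with
  | inl (inl _) => True
  | inl (inr (j, k, _)) => `|k| <= 2 ^+ j./2 :> int
  | inr (j, k, _) => `|k| <= 2 ^+ j./2 - 1 :> int
  end.

Definition shearlet_system (phi psi psit : R * R -> R[i]) (c : R * R)
    (i : shearlet_parameter) : R * R -> R[i] :=
  match i with
  | inl (inl m) => fun x => phi (lattice_shift (c.1, c.1) m x)
  | inl (inr (j, k, m)) => fun x =>
      (2 `^ (3 * j%:R / 4))%:C * psi (lattice_shift c m (shear k (dilation j x)))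
  | inr (j, k, m) => fun x =>
      (2 `^ (3 * j%:R / 4))%:C *
      psit (lattice_shift (swap c) m (shearT k (dilation_tilde j x)))
  end.

(* (phi, psi, psit, c) generates an admissible compactly supported separable
   shearlet system. *)
Definition admissible (phi psi psit : R * R -> R[i]) (c : R * R) : Prop :=
  exists (V : int -> set (R -> R[i])) (phi1 psi1 : R -> R[i])
         (a1 b1 a2 b2 : nat),
  [/\ [/\ MRA V, scaling_function V phi1 & corresponding_wavelet V psi1],
      [/\ continuous (phi1 : R -> (R[i])^o), compactly_supported phi1 &
          compactly_supported psi1],
      [/\ phi = (fun x => phi1 x.1 * phi1 x.2),
          psi = (fun x => psi1 x.1 * phi1 x.2) &
          psit = (fun x => psi (swap x))],
      [/\ (0 < a1)%N /\ (0 < a2)%N, odd b1 /\ odd b2 &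
          c = (a1%:R / b1%:R, a2%:R / b2%:R)] &
      linearly_independent (@lebesgue_measure R) setT
        (system1d phi1 psi1 c.1) /\
      linearly_independent (@lebesgue_measure R) setT
        (system1d phi1 psi1 c.2)].

End Shearlets.

(* Main.v *)
Require Import Defs.
From mathcomp Require Import all_boot all_order all_algebra.
From mathcomp Require Import cyclic finmap complex ring lra zify.
From mathcomp Require Import all_classical all_reals all_analysis measurable_realfun.

(** Write f for the scaling function and let p be the continuous representative
    of the wavelet found below.  Compact support makes the two-scale relations
    f(x/2) = sum h_k f(x-k) and p(x/2) = sum g_k f(x-k) finite, so that a
    combination of shearlets is almost everywhere equal to a continuous function.
    If it vanishes almost everywhere, it vanishes at every point, and it can be
    sampled on dyadic grids.  Stretching the plane by the product b of the odd
    denominators b1 and b2 makes all translations integral; the masks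
    h(z) = sum h_k z^k and g(z) then become h(z^b) and g(z^b), which does not
    change their values at 1 and -1.

    The samples of f on the grid of mesh 2^-t have the generating function
    S_t(z) = sum_n f(n/2^t) z^n = h(z) h(z^2) ... h(z^(2^(t-1))) S_0(z), and the
    translates and dilates of f and p that occur have the generating function
    E(z^(2^t)) S_t(z), where the Laurent polynomial E is the symbol of the function
    ([sample_refinement], [has_symbol]).  Two facts about the multiresolution
    analysis are used: h(1) g(-1) - h(-1) g(1) is nonzero, which expresses the
    orthogonality of V_(-1) and of the wavelets of level -1 inside V_0
    ([mra_masks]), and the integral of f is nonzero
    ([scaling_integral_neq0]), so that |S_t(1)| >= c 2^t ([sample_mass]).

    After a common dilation, the functions in the horizontal cone and the coarse
    ones are products u(x1 + sigma x2) v(x2) with |sigma| <= 1, and those in the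
    vertical cone are products u(x2 + tau x1) v(x1) with |tau| < 1.  Fix a nonzero
    slope sigma = K/2^r, multiply the relation by z^(n1 + K n2) y^n2 and sum over
    a fine grid, where z is a primitive root of unity of large prime order q, t + r is
    a multiple of q - 1, and y = exp(kap/2^t).  The terms of slope sigma add up to
    sum_i c_i E_i(z) E'_i(exp kap) times S_(t+r)(z) S_t(y).  The terms of the other
    horizontal slopes are smaller by the Riemann-Lebesgue lemma.  So are the terms
    of the vertical cone, because sigma tau is not 1, provided that z is chosen
    among the roots of order q so as to maximise the product of |h(z^(2^i))|, which
    prevents the product at z^K from exceeding the one at z ([relation_at_root]).
    As infinitely many z and kap are possible, the coefficients of one nonzero slope
    satisfy sum_i c_i E_i(z) E'_i(w) = 0 for all nonzero z and w ([slanted_free]).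
    Exchanging the coordinates treats the slopes of the vertical cone, and what is
    left is unsheared and yields the same identity by sampling at the integers.

    It remains to deduce c_i = 0 from these identities.  Every term except those of
    the finest scale is h(z) times a function of z^2, so comparing z and -z
    eliminates the finest scale by the determinant condition; the others then have
    the common factor h(z) h(w), and induction applies ([tensor_details_free]). *)

Set Implicit Arguments.
Unset Strict Implicit.
Unset Printing Implicit Defensive.

Import Order.TTheory GRing.Theory Num.Theory.
Import numFieldNormedType.Exports.

Local Open Scope ring_scope.

(** * Laurent functions and combinations of tensor products across scales *)

Section Laurent.
Context (C : numClosedFieldType).
Implicit Types (E F : C -> C) (z w : C).

(** Laurent polynomials as functions on the nonzero numbers: the generating
    functions below are only known through their values. *)
Definition laurent E := exists M (P : {poly C}),
  forall z, z != 0 -> z ^+ M * E z = P.[z].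

Lemma laurent_cst (a : C) : laurent (fun=> a).
Proof. by exists 0%N, a%:P => z _; rewrite hornerC expr0 mul1r. Qed.

Lemma laurent_exprz (k : int) : laurent (fun z => z ^ k).
Proof.
case: k => n.
  by exists 0%N, 'X^n => z _; rewrite hornerXn expr0 mul1r.
exists n.+1, 1 => z z0; rewrite hornerC NegzE -exprnN mulfV ?expf_neq0 //.
Qed.

Lemma laurentD E F : laurent E -> laurent F -> laurent (fun z => E z + F z).
Proof.
move=> [M [P EP]] [N [Q FQ]]; exists (M + N)%N, ('X^N * P + 'X^M * Q) => z z0.
rewrite hornerD !hornerM !hornerXn -EP // -FQ // exprD; ring.
Qed.

Lemma laurentM E F : laurent E -> laurent F -> laurent (fun z => E z * F z).
Proof.
move=> [M [P EP]] [N [Q FQ]]; exists (M + N)%N, (P * Q) => z z0.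
rewrite hornerM -EP // -FQ // exprD; ring.
Qed.

Lemma laurent_sum I (s : seq I) (P : pred I) (E : I -> C -> C) :
  (forall i, laurent (E i)) -> laurent (fun z => \sum_(i <- s | P i) E i z).
Proof.
move=> lE; elim: s => [|i s IH].
  by under [X in laurent X]eq_fun do rewrite big_nil; apply: laurent_cst.
under [X in laurent X]eq_fun do rewrite big_cons.
by case: (P i) => //; apply: laurentD.
Qed.

Lemma laurent_prod I (s : seq I) (P : pred I) (E : I -> C -> C) :
  (forall i, laurent (E i)) -> laurent (fun z => \prod_(i <- s | P i) E i z).
Proof.
move=> lE; elim: s => [|i s IH].
  by under [X in laurent X]eq_fun do rewrite big_nil; apply: laurent_cst.
under [X in laurent X]eq_fun do rewrite big_cons.
by case: (P i) => //; apply: laurentM.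
Qed.

Lemma laurent_expr E n : laurent E -> laurent (fun z => E (z ^+ n)).
Proof.
move=> [M [P EP]]; exists (n * M)%N, (P \Po 'X^n) => z z0.
by rewrite horner_comp hornerXn -EP ?expf_neq0 // exprM.
Qed.

Lemma notin_seq_exists (s : seq C) : exists z, z \notin s.
Proof.
pose t := [seq n%:R : C | n <- iota 0 (size s).+1].
have ut : uniq t.
  by rewrite map_inj_uniq ?iota_uniq // => i j /eqP; rewrite eqr_nat => /eqP.
have /allPn[z _ zs] : ~~ all (mem s) t.
  apply/negP => /allP ts; have := uniq_leq_size ut ts.
  by rewrite size_map size_iota ltnn.
by exists z.
Qed.

Lemma laurent_zeros E z0 : laurent E -> z0 != 0 -> E z0 != 0 ->
  exists s : seq C, forall z, z != 0 -> E z = 0 -> z \in s.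
Proof.
move=> [M [P EP]] z00 Ez0.
have P0 : P != 0.
  apply: contraNneq Ez0 => P0; have /eqP := EP z0 z00.
  by rewrite P0 horner0 mulf_eq0 expf_eq0 (negPf z00) andbF.
have [r Pr] := closed_field_poly_normal P.
exists r => z zn0 Ez; have := EP z zn0; rewrite Ez mulr0 => /esym/eqP.
by rewrite -/(root P z) Pr rootZ ?lead_coef_eq0 // root_prod_XsubC.
Qed.

Lemma laurent_eq0 E : laurent E ->
  (forall s : seq C, exists z, [/\ z != 0, z \notin s & E z = 0]) ->
  forall z, z != 0 -> E z = 0.
Proof.
move=> lE infE z z0; apply/eqP; apply: contraPT infE => Ez infE.
have [s sP] := laurent_zeros lE z0 Ez.
by have [y [y0 /negP ys /(sP _ y0)]] := infE s.
Qed.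

(** The nonzero function F has finitely many zeros, so E vanishes at all but
    finitely many points. *)
Lemma laurent_mulf_eq0 E F z0 : laurent E -> laurent F ->
  z0 != 0 -> F z0 != 0 ->
  (forall z, z != 0 -> E z * F z = 0) -> forall z, z != 0 -> E z = 0.
Proof.
move=> lE lF z00 Fz0 EF; apply: laurent_eq0 => // s.
have [t tP] := laurent_zeros lF z00 Fz0.
have [z] := notin_seq_exists (0 :: s ++ t).
rewrite inE mem_cat !negb_or => /and3P[zn0 zs zt]; exists z; split => //.
have /eqP := EF z zn0; rewrite mulf_eq0 => /orP[/eqP//|/eqP/(tP _ zn0)].
by rewrite (negPf zt).
Qed.

Lemma exists_root n z : (0 < n)%N -> z != 0 -> exists2 y, y != 0 & y ^+ n = z.
Proof.
move=> n0 z0; exists (n.-root z); last by rewrite rootCK.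
by rewrite rootC_eq0.
Qed.

(** Multiplication by a large power of z turns the sum into a polynomial with
    infinitely many roots. *)
Lemma laurent_monomials_free (I : eqType) (s : seq I) (P : pred I)
    (a : I -> int) (c : I -> C) :
  (forall z, z != 0 -> \sum_(i <- s | P i) c i * z ^ a i = 0) ->
  forall k : int, \sum_(i <- s | P i && (a i == k)) c i = 0.
Proof.
move=> sum0 k; pose M := maxn (\max_(i <- s | P i) `|a i|%N) `|k|%N.
have aM i : i \in s -> P i -> (`|a i| <= M)%N.
  by move=> si Pi; rewrite leq_max; apply/orP; left; apply: leq_bigmax_seq.
have kM : (`|k| <= M)%N by rewrite leq_max leqnn orbT.
pose Q := \sum_(i <- s | P i) c i *: 'X^(`|a i + M%:Z|) : {poly C}.
have Q0 : Q = 0.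
  apply/eqP/negP => /negP Qn0; have [r Qr] := closed_field_poly_normal Q.
  have [z] := notin_seq_exists (0 :: r); rewrite inE negb_or => /andP[z0].
  apply/negP; rewrite negbK.
  have : root Q z.
    apply/eqP; rewrite horner_sum.
    have /(congr1 ( *%R (z ^+ M))) := sum0 z z0; rewrite mulr0 => e; apply: etrans e.
    rewrite mulr_sumr [LHS]big_seq_cond [RHS]big_seq_cond.
    apply: eq_bigr => i /andP[si Pi].
    rewrite hornerZ hornerXn mulrCA; congr (_ * _).
    rewrite !exprnP -expfzDr // addrC gez0_abs //.
    by have := aM i si Pi; lia.
  by rewrite Qr rootZ ?lead_coef_eq0 // root_prod_XsubC.
have := congr1 (fun p : {poly C} => p`_(`|k + M%:Z|)) Q0.
rewrite coef0 coef_sum => e; apply: etrans e.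
rewrite big_mkcondr [LHS]big_seq_cond [RHS]big_seq_cond.
apply: eq_bigr => i /andP[si Pi].
rewrite coefZ coefXn.
have -> : (`|(k + M%:Z)%R| == `|(a i + M%:Z)%R|)%N = (a i == k).
  by have := aM i si Pi; lia.
by case: ifP; rewrite ?mulr1 ?mulr0.
Qed.

Section TwoScale.
Context (h g : C -> C).
Hypotheses (h_laurent : laurent h) (g_laurent : laurent g).
Hypothesis hg_det : h 1 * g (-1) - h (-1) * g 1 != 0.

(** The cascade product: the symbol of f(x / 2^n) if h is the mask of f. *)
Definition refinement n z := \prod_(i < n) h (z ^+ (2 ^ i)).
(** The symbol of p(x / 2^n) for n > 0, if g is the mask of p. *)
Definition detail n z := g (z ^+ (2 ^ n.-1)) * refinement n.-1 z.

Lemma refinementS n z : refinement n.+1 z = h z * refinement n (z ^+ 2).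
Proof.
rewrite /refinement big_ord_recl expn0 expr1; congr (_ * _).
by apply: eq_bigr => i _; rewrite -exprM -expnS.
Qed.

Lemma detailSS n z : detail n.+2 z = h z * detail n.+1 (z ^+ 2).
Proof. by rewrite /detail /= refinementS -exprM -expnS mulrCA. Qed.

Lemma detail1 z : detail 1 z = g z.
Proof. by rewrite /detail /refinement /= expn0 expr1 big_ord0 mulr1. Qed.

Lemma refinement_laurent n : laurent (refinement n).
Proof. by apply: laurent_prod => i; apply: laurent_expr. Qed.

Lemma detail_laurent n : laurent (detail n).
Proof. by apply: laurentM; [apply: laurent_expr | apply: refinement_laurent]. Qed.

Lemma mask_neq0 : exists2 z, z != 0 & h z != 0.
Proof.
have [h1|h1] := eqVneq (h 1) 0; last by exists 1; rewrite ?oner_eq0.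
exists (-1); first by rewrite oppr_eq0 oner_eq0.
by apply: contraNneq hg_det => hN1; rewrite h1 hN1 !mul0r subrr.
Qed.

Lemma refinement_neq0 n : exists2 z, z != 0 & refinement n z != 0.
Proof.
elim: n => [|n [z0 z00 IH]].
  by exists 1; rewrite ?oner_eq0 // /refinement big_ord0 oner_eq0.
have [y y0 yz] := @exists_root 2 z0 isT z00.
apply/not_exists2P => all0; have [z zn0 hz] := mask_neq0; case/negP: (hz).
apply/eqP; apply: (laurent_mulf_eq0 h_laurent (laurent_expr 2 (refinement_laurent n)) y0) => //.
  by rewrite yz.
move=> {zn0 hz}z zn0; rewrite -refinementS.
by case: (all0 z) => [/(_ zn0)//|/negP]; rewrite negbK => /eqP.
Qed.

Definition bilaurent (a : C -> C -> C) :=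
  (forall w, laurent (a^~ w)) /\ (forall z, laurent (a z)).

Lemma powers_eq0 (a : C -> C -> C) m n : (0 < m)%N -> (0 < n)%N ->
  (forall z w, z != 0 -> w != 0 -> a (z ^+ m) (w ^+ n) = 0) ->
  forall z w, z != 0 -> w != 0 -> a z w = 0.
Proof.
move=> m0 n0 a0 z w z0 w0.
have [y y0 <-] := exists_root m0 z0; have [v v0 <-] := exists_root n0 w0.
exact: a0.
Qed.

(** The relations at z and at -z form a linear system in a(z^2) and G(z^2), whose
    determinant is a Laurent function that is nonzero at 1. *)
Lemma top_detail_eq0 (a : C -> C) (G : C -> C) : laurent a -> 
  (forall z, z != 0 -> a (z ^+ 2) * g z + h z * G (z ^+ 2) = 0) ->
  forall z, z != 0 -> a z = 0.
Proof.
move=> la aG z z0; have [y y0 <-] := @exists_root 2 z isT z0.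
(* The determinant of the system at x and - x. *)
pose det x := h x * g (- x) - h (- x) * g x.
have lN E : laurent E -> laurent (fun x => E (- x)).
  move=> [M [P EP]]; exists M, ((-1) ^+ M *: (P \Po (- 'X))) => x x0.
  rewrite hornerZ horner_comp hornerN hornerX -EP ?oppr_eq0 //.
  by rewrite mulrA -exprMn mulN1r opprK.
have ldet : laurent det.
  apply: laurentD; first by apply: laurentM => //; apply: lN.
  under [X in laurent X]eq_fun do rewrite -mulNr -mulN1r.
  apply: laurentM => //; apply: laurentM; [exact: laurent_cst|exact: lN].
have : forall x, x != 0 -> a (x ^+ 2) = 0.
  apply: (laurent_mulf_eq0 (laurent_expr 2 la) ldet (oner_neq0 _)) => //.
  move=> x x0; have e1 := aG x x0.
  have := aG (- x); rewrite oppr_eq0 sqrrN => /(_ x0) e2.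
  rewrite /det.
  rewrite [LHS](_ : _ = h x * (a (x ^+ 2) * g (- x) + h (- x) * G (x ^+ 2))
    - h (- x) * (a (x ^+ 2) * g x + h x * G (x ^+ 2))); last by ring.
  by rewrite e1 e2 !mulr0 subrr.
by apply.
Qed.

Section TensorDetails.
Context (l : nat -> nat).
Hypothesis l_le : forall j, (l j <= j)%N.

(** Symbol of a combination of tensor products: level j carries a detail of scale
    L - j in one variable and a refinement of scale L - l j in the other.  The
    anisotropic dilations of shearlets correspond to l j = j / 2. *)
Definition tensor_details L (al be : nat -> C -> C -> C) (de : C -> C -> C) z w :=
  de (z ^+ (2 ^ L)) (w ^+ (2 ^ L)) * (refinement L z * refinement L w)
  + \sum_(j < L) al j (z ^+ (2 ^ (L - j))) (w ^+ (2 ^ (L - l j)))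
      * (detail (L - j) z * refinement (L - l j) w)
  + \sum_(j < L) be j (z ^+ (2 ^ (L - l j))) (w ^+ (2 ^ (L - j)))
      * (refinement (L - l j) z * detail (L - j) w).

Let flip (a : C -> C -> C) z w := a w z.

Lemma bilaurent_flip a : bilaurent a -> bilaurent (flip a).
Proof. by case. Qed.

Lemma tensor_details_flip L al be de z w :
  tensor_details L (fun j => flip (be j)) (fun j => flip (al j)) (flip de) w z =
  tensor_details L al be de z w.
Proof.
rewrite /tensor_details /flip -[LHS]addrA [X in _ + X]addrC addrA.
congr (_ + _ + _); first by rewrite [X in _ * X]mulrC.
  by apply: eq_bigr => j _; rewrite [X in _ * X]mulrC.
by apply: eq_bigr => j _; rewrite [X in _ * X]mulrC.
Qed.

Lemma tensor_details_laurent L al be de w :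
  (forall j, bilaurent (al j)) -> (forall j, bilaurent (be j)) -> bilaurent de ->
  laurent (fun z => tensor_details L al be de z w).
Proof.
move=> lal lbe lde; rewrite /tensor_details.
have lM (a : C -> C -> C) n v F c : bilaurent a -> laurent F ->
    laurent (fun z => a (z ^+ n) v * (F z * c)).
  move=> [la _] lF; apply: laurentM; first exact: laurent_expr (la v).
  by apply: laurentM => //; apply: laurent_cst.
apply: laurentD; first apply: laurentD.
- by apply: lM => //; apply: refinement_laurent.
- by apply: laurent_sum => j; apply: lM => //; apply: detail_laurent.
- by apply: laurent_sum => j; apply: lM => //; apply: refinement_laurent.
Qed.

(** All terms other than the one with [al L] are h(z) times a function of z^2. *)
Lemma top_level_free L al be de :
  (forall j, bilaurent (al j)) -> 
  (forall z w, z != 0 -> w != 0 -> tensor_details L.+1 al be de z w = 0) ->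
  forall z w, z != 0 -> w != 0 -> al L z w = 0.
Proof.
move=> lal id0.
suff al0 : forall z w, z != 0 -> w != 0 -> al L z (w ^+ (2 ^ (L.+1 - l L))) = 0.
  by apply: (@powers_eq0 _ 1 (2 ^ (L.+1 - l L))%N); rewrite ?expn_gt0.
move=> z w z0; have [w1 w10 w1n] := refinement_neq0 (L.+1 - l L).
have lE := laurent_expr (2 ^ (L.+1 - l L)) (proj2 (lal L) z).
apply: (laurent_mulf_eq0 lE (refinement_laurent _) w10 w1n) => {w lE} v v0.
move: z z0; set n := (L.+1 - l L)%N.
pose G y := de (y ^+ (2 ^ L)) (v ^+ (2 ^ L.+1)) * (refinement L y * refinement L.+1 v)
  + \sum_(j < L) al j (y ^+ (2 ^ (L - j))) (v ^+ (2 ^ (L.+1 - l j)))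
      * (detail (L - j) y * refinement (L.+1 - l j) v)
  + \sum_(j < L.+1) be j (y ^+ (2 ^ (L - l j))) (v ^+ (2 ^ (L.+1 - j)))
      * (refinement (L - l j) y * detail (L.+1 - j) v).
apply: (@top_detail_eq0 (fun y => al L y (v ^+ (2 ^ n)) * refinement n v) G) => //.
  by apply: laurentM; [case: (lal L) | apply: laurent_cst].
move=> y y0; rewrite -[RHS](id0 y v y0 v0) /tensor_details.
rewrite big_ord_recr /= subSn // subnn expn1 detail1 -/n.
rewrite /G !mulrDr (refinementS L y).
have -> : h y * (de ((y ^+ 2) ^+ (2 ^ L)) (v ^+ (2 ^ L.+1)) *
   (refinement L (y ^+ 2) * refinement L.+1 v)) =
  de (y ^+ (2 ^ L.+1)) (v ^+ (2 ^ L.+1)) *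
    (h y * refinement L (y ^+ 2) * refinement L.+1 v).
  by rewrite -exprM -expnS; ring.
have -> : h y * (\sum_(j < L) al j ((y ^+ 2) ^+ (2 ^ (L - j))) (v ^+ (2 ^ (L.+1 - l j)))
      * (detail (L - j) (y ^+ 2) * refinement (L.+1 - l j) v)) =
   \sum_(j < L) al j (y ^+ (2 ^ (L.+1 - j))) (v ^+ (2 ^ (L.+1 - l j)))
      * (detail (L.+1 - j) y * refinement (L.+1 - l j) v).
  rewrite mulr_sumr; apply: eq_bigr => j _.
  have -> : (L.+1 - j = (L - j.+1).+2)%N by have := ltn_ord j; lia.
  have -> : (L - j = (L - j.+1).+1)%N by have := ltn_ord j; lia.
  by rewrite detailSS -exprM -expnS; ring.
have -> : h y * (\sum_(j < L.+1) be j ((y ^+ 2) ^+ (2 ^ (L - l j))) (v ^+ (2 ^ (L.+1 - j)))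
      * (refinement (L - l j) (y ^+ 2) * detail (L.+1 - j) v)) =
   \sum_(j < L.+1) be j (y ^+ (2 ^ (L.+1 - l j))) (v ^+ (2 ^ (L.+1 - j)))
      * (refinement (L.+1 - l j) y * detail (L.+1 - j) v).
  rewrite mulr_sumr; apply: eq_bigr => j _.
  have -> : (L.+1 - l j = (L - l j).+1)%N by have := ltn_ord j; have := l_le j; lia.
  by rewrite refinementS -exprM -expnS; ring.
ring.
Qed.

(** Below the finest level, the symbols at scale L + 1 are those at scale L taken
    at squares, multiplied by h. *)
Lemma tensor_detailsS L al be de z w :
  al L (z ^+ 2) (w ^+ (2 ^ (L.+1 - l L))) = 0 ->
  be L (z ^+ (2 ^ (L.+1 - l L))) (w ^+ 2) = 0 ->
  tensor_details L.+1 al be de z w =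
  tensor_details L al be de (z ^+ 2) (w ^+ 2) * h w * h z.
Proof.
move=> al0 be0; rewrite /tensor_details !big_ord_recr /= !(@subSn L L) // !subnn.
rewrite expn1 al0 be0 !mul0r !addr0 !mulrDl; congr (_ + _ + _).
- by rewrite !refinementS -!exprM -!expnS; ring.
- rewrite !mulr_suml; apply: eq_bigr => j _.
  have -> : (L.+1 - j = (L - j.+1).+2)%N by have := ltn_ord j; lia.
  have -> : (L - j = (L - j.+1).+1)%N by have := ltn_ord j; lia.
  have -> : (L.+1 - l j = (L - l j).+1)%N by have := ltn_ord j; have := l_le j; lia.
  by rewrite detailSS refinementS -!exprM -!expnS; ring.
- rewrite !mulr_suml; apply: eq_bigr => j _.
  have -> : (L.+1 - j = (L - j.+1).+2)%N by have := ltn_ord j; lia.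
  have -> : (L - j = (L - j.+1).+1)%N by have := ltn_ord j; lia.
  have -> : (L.+1 - l j = (L - l j).+1)%N by have := ltn_ord j; have := l_le j; lia.
  by rewrite detailSS refinementS -!exprM -!expnS; ring.
Qed.

(** The finest level vanishes by [top_level_free] in each of the two variables;
    cancelling h(z) h(w) then lowers L. *)
Lemma tensor_details_free L al be de :
  (forall j, bilaurent (al j)) -> (forall j, bilaurent (be j)) -> bilaurent de ->
  (forall z w, z != 0 -> w != 0 -> tensor_details L al be de z w = 0) ->
  forall z w, z != 0 -> w != 0 ->
  de z w = 0 /\ forall j, (j < L)%N -> al j z w = 0 /\ be j z w = 0.
Proof.
move=> lal lbe lde; elim: L => [|L IH] id0.
  move=> z w z0 w0; split=> //; have := id0 z w z0 w0.
  by rewrite /tensor_details !big_ord0 /refinement !big_ord0 !expr1 !mulr1 !addr0.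
have al0 := top_level_free lal id0.
have be0 z w : z != 0 -> w != 0 -> be L z w = 0.
  move=> z0 w0; apply: (@top_level_free L (fun j => flip (be j))
    (fun j => flip (al j)) (flip de)) w0 z0 => [j|{}z {}w z0 w0].
    exact: bilaurent_flip.
  by rewrite tensor_details_flip id0.
have id1 z w : z != 0 -> w != 0 -> tensor_details L al be de z w = 0.
  move=> z0 w0; have [y y0 <-] := @exists_root 2 z isT z0.
  have [v v0 <-] := @exists_root 2 w isT w0 => {z w z0 w0}.
  have [z1 z10 hz1] := mask_neq0.
  have lT : laurent (fun w => tensor_details L al be de (y ^+ 2) w).
    under [X in laurent X]eq_fun do rewrite -tensor_details_flip.
    apply: tensor_details_laurent; [by move=> j; apply: bilaurent_flip..|].
    exact: bilaurent_flip.
  apply: (laurent_mulf_eq0 (laurent_expr 2 lT) h_laurent z10 hz1) => // {v0}v v0.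
  have lT' : laurent (fun z => tensor_details L al be de z (v ^+ 2)).
    exact: tensor_details_laurent.
  apply: (laurent_mulf_eq0 (laurentM (laurent_expr 2 lT') (laurent_cst (h v)))
    h_laurent z10 hz1) => // {y0}z z0.
  rewrite -tensor_detailsS ?id0 //; [apply: al0|apply: be0];
    by rewrite ?expf_neq0.
move=> z w z0 w0; have [de0 ab0] := IH id1 z w z0 w0; split=> // j.
by rewrite ltnS leq_eqVlt => /orP[/eqP->|/ab0//]; split; [apply: al0|apply: be0].
Qed.

End TensorDetails.
End TwoScale.
End Laurent.

(** * Sums over the integers and sampled generating functions *)

Local Open Scope complex_scope.

Local Notation normc := ComplexField.Normc.normc.

Section Modulus.
Context {R : rcfType}.
Implicit Types z w : R[i].

Lemma normc_ge0 z : 0 <= normc z.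
Proof. by case: z => a b; apply: sqrtr_ge0. Qed.

Lemma normc_eq0 z : (normc z == 0) = (z == 0).
Proof.
apply/eqP/eqP => [|->]; first exact: ComplexField.Normc.eq0_normc.
exact: ComplexField.Normc.normc0.
Qed.

Lemma normc_gt0 z : (0 < normc z) = (z != 0).
Proof. by rewrite lt0r normc_eq0 normc_ge0 andbT. Qed.

Lemma normcM z w : normc (z * w) = normc z * normc w.
Proof. exact: ComplexField.Normc.normcM. Qed.

Lemma normc0 : normc (0 : R[i]) = 0.
Proof. exact: ComplexField.Normc.normc0. Qed.

Lemma normc1 : normc (1 : R[i]) = 1.
Proof. exact: ComplexField.Normc.normc1. Qed.

Lemma normcV z : normc z^-1 = (normc z)^-1.
Proof. exact: ComplexField.Normc.normcV. Qed.

Lemma normcD z w : normc (z + w) <= normc z + normc w.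
Proof. exact: le_normcD. Qed.

Lemma normcN z : normc (- z) = normc z.
Proof. exact: complex.normcN. Qed.

Lemma normcB z w : normc (z - w) <= normc z + normc w.
Proof. by rewrite -(normcN w) normcD. Qed.

Lemma normc_prod I (s : seq I) P (F : I -> R[i]) :
  normc (\prod_(i <- s | P i) F i) = \prod_(i <- s | P i) normc (F i).
Proof.
by elim/big_ind2 : _ => [|x1 x2 y1 y2 <- <-|//]; [exact: normc1|exact: normcM].
Qed.

Lemma normc_sum I (s : seq I) P (F : I -> R[i]) :
  normc (\sum_(i <- s | P i) F i) <= \sum_(i <- s | P i) normc (F i).
Proof.
elim/big_ind2 : _ => // [|x1 x2 y1 y2 le1 le2]; first by rewrite normc0.
exact: le_trans (normcD _ _) (lerD le1 le2).
Qed.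

Lemma normcX z n : normc (z ^+ n) = normc z ^+ n.
Proof. by elim: n => [|n IH]; rewrite ?expr0 ?normc1 // !exprS normcM IH. Qed.

Lemma normcXz z (n : int) : normc (z ^ n) = normc z ^ n.
Proof.
by case: n => n; rewrite ?NegzE -?exprnN ?normcV -?exprnP ?normcX.
Qed.

Lemma normcR (x : R) : normc x%:C = `|x|.
Proof. by rewrite /normc /= expr0n addr0 sqrtr_sqr. Qed.

End Modulus.

Section IntegerSums.
Context {R : realType}.
Local Notation C := R[i].
Implicit Types F : int -> C.

(** On a family of infinite support this sum has the default value 0, whence the
    support conditions [bsupp] and [bsupp2]. *)
Definition zsum F := \sum_(n \in [set: int]) F n.

Definition bsupp F := exists W : nat, forall n : int, (W < `|n|)%N -> F n = 0.

Lemma zsum_shift F (k : int) : zsum (fun n => F (n + k)) = zsum F.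
Proof.
rewrite /zsum [RHS](reindex_fsbigT (fun n => n + k)) //.
by exists (fun n => n - k) => n; rewrite ?addrK ?subrK.
Qed.

Lemma zsumZ a F : zsum (fun n => a * F n) = a * zsum F.
Proof. by rewrite /zsum mulr_fsumr. Qed.

Lemma eq_zsum F G : F =1 G -> zsum F = zsum G.
Proof. by move=> FG; apply: eq_fsbigr => n _. Qed.

Definition zwindow (W : nat) : seq int := [seq k%:Z - W%:Z | k <- iota 0 (2 * W).+1].

Lemma zwindow_uniq W : uniq (zwindow W).
Proof. by rewrite map_inj_uniq ?iota_uniq // => i j; lia. Qed.

Lemma mem_zwindow W (n : int) : (n \in zwindow W) = (`|n| <= W)%N.
Proof.
apply/mapP/idP => [[k]|nW]; first by rewrite mem_iota => /andP[_ kW] ->; lia.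
by exists `|(n + W%:Z)%R|%N; [rewrite mem_iota|]; lia.
Qed.

Lemma zsumE F W : (forall n : int, (W < `|n|)%N -> F n = 0) ->
  zsum F = \sum_(n <- zwindow W) F n.
Proof.
move=> F0; rewrite /zsum [RHS]fsbig_seq ?zwindow_uniq //.
apply/esym/fsbig_widen => // n [_ /= nW]; apply: F0.
by rewrite ltnNge -mem_zwindow; apply/negP => /nW.
Qed.

Lemma zsum_sum I (s : seq I) (P : pred I) (F : I -> int -> C) :
  (forall i, bsupp (F i)) ->
  zsum (fun n => \sum_(i <- s | P i) F i n) = \sum_(i <- s | P i) zsum (F i).
Proof.
move=> bF; elim: s => [|i s IH].
  rewrite big_nil -[RHS](mul0r (zsum (fun=> 0))) -zsumZ.
  by apply: eq_zsum => n; rewrite big_nil mul0r.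
under eq_zsum do rewrite big_cons; rewrite big_cons; case: (P i) => //.
rewrite -IH; have [W FW] := bF i.
have [W' SW] : bsupp (fun n => \sum_(j <- s | P j) F j n).
  elim: s {IH} => [|j s [W1 IH]]; first by exists 0%N => n _; rewrite big_nil.
  have [W2 W2P] := bF j; exists (maxn W1 W2) => n; rewrite gtn_max => /andP[n1 n2].
  by rewrite big_cons; case: (P j); rewrite ?W2P // IH // addr0.
rewrite !(@zsumE _ (maxn W W')) ?big_split // => n;
  rewrite gtn_max => /andP[n1 n2]; rewrite ?FW ?SW //.
by rewrite addr0.
Qed.

(** The window may be centred anywhere, because the supports met below drift with
    the slope. *)
Lemma zsum_bound (k : int) (W : nat) F (b : R) :
  (forall n, (W < `|(n - k)%R|)%N -> F n = 0) ->
  (forall n, normc (F n) <= b) ->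
  normc (zsum F) <= (2 * W).+1%:R * b.
Proof.
move=> F0 Fb; rewrite -(zsum_shift F k) (@zsumE _ W); last first.
  by move=> n nW; apply: F0; rewrite addrK.
apply: le_trans (normc_sum _ _ _) _.
apply: le_trans (ler_sum _ (fun n _ => Fb _)) _.
by rewrite big_const_seq count_predT size_map size_iota iter_addr_0 mulr_natl.
Qed.

Definition bsupp2 (F : int -> int -> C) :=
  exists W : nat, forall n m : int, (W < `|n|)%N || (W < `|m|)%N -> F n m = 0.

Lemma zsum2E (F : int -> int -> C) W :
  (forall n m : int, (W < `|n|)%N || (W < `|m|)%N -> F n m = 0) ->
  zsum (fun n => zsum (F n)) = \sum_(n <- zwindow W) \sum_(m <- zwindow W) F n m.
Proof.
move=> F0; have E n : zsum (F n) = \sum_(m <- zwindow W) F n m.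
  by apply: zsumE => m mW; rewrite F0 // mW orbT.
under eq_zsum do rewrite E; apply: zsumE => n nW.
by rewrite big1 // => m _; rewrite F0 // nW.
Qed.

Lemma exchange_zsum (F : int -> int -> C) : bsupp2 F ->
  zsum (fun n => zsum (F n)) = zsum (fun m => zsum (F^~ m)).
Proof.
move=> [W F0]; rewrite (zsum2E F0) exchange_big /= -(@zsum2E (fun m n => F n m)) //.
by move=> n m; rewrite orbC; apply: F0.
Qed.

Lemma zsum2_sum I (s : seq I) (P : pred I) (F : I -> int -> int -> C) :
  (forall i, bsupp2 (F i)) ->
  zsum (fun n => zsum (fun m => \sum_(i <- s | P i) F i n m)) =
  \sum_(i <- s | P i) zsum (fun n => zsum (F i n)).
Proof.
move=> bF; rewrite -zsum_sum => [|i].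
  apply: eq_zsum => n; apply: zsum_sum => i; have [W FW] := bF i.
  by exists W => m mW; rewrite FW // mW orbT.
have [W FW] := bF i; exists W => n nW; rewrite (@zsumE _ 0%N) => [|m _].
  by rewrite big1 // => m _; rewrite FW // nW.
by rewrite FW // nW.
Qed.

End IntegerSums.

Section Sampling.
Context {R : realType}.
Local Notation C := R[i].
Implicit Types (e f : R -> C) (E : C -> C) (z : C) (t : nat) (d : R).

(** Continuous functions with compact support, in the quantitative form that the
    estimates use. *)
Definition Cc e := [/\ exists B : nat, forall x, B%:R < `|x| -> e x = 0,
  exists2 M : R, 0 <= M & forall x, normc (e x) <= M &
  forall eps : R, 0 < eps -> exists2 del : R, 0 < del &
    forall x y, `|x - y| < del -> normc (e x - e y) <= eps].

(** Generating function of the samples on the grid of mesh 2^-t through d. *)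
Definition sample e t d z := zsum (fun n => e (n%:~R / 2 ^+ t + d) * z ^ n).

Lemma exp2_gt0 n : 0 < 2 ^+ n :> R. Proof. exact: exprn_gt0. Qed.
Lemma exp2_neq0 n : 2 ^+ n != 0 :> R. Proof. by rewrite expf_neq0. Qed.

Lemma sample_shift e t d (k : int) z : z != 0 ->
  sample e t (d + k%:~R / 2 ^+ t) z = z ^ (- k) * sample e t d z.
Proof.
move=> z0; rewrite /sample -zsumZ -[RHS](zsum_shift _ k); apply: eq_zsum => n.
rewrite mulrCA -expfzDr // (_ : - k + (n + k) = n); last by ring.
by congr (e _ * _); rewrite rmorphD /=; field; rewrite expf_neq0.
Qed.

Lemma Cc_supp_window e (B : nat) t d (n : int) :
  (forall x, B%:R < `|x| -> e x = 0) ->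
  (B * 2 ^ t + 1 < `|(n + Num.floor (d * 2 ^+ t))%R|)%N ->
  e (n%:~R / 2 ^+ t + d) = 0.
Proof.
move=> eB nB; apply: eB; set k := Num.floor _ in nB.
have k1 : k%:~R <= d * 2 ^+ t by apply: floor_le.
have k2 : d * 2 ^+ t < k%:~R + 1 by have := floorD1_gt (d * 2 ^+ t); rewrite intrD.
have : (B * 2 ^ t + 2)%N%:R <= `|(n + k)%:~R| :> R.
  by rewrite -intr_norm -[(_ + 2)%N%:R]/((B * 2 ^ t + 2)%N%:Z%:~R) ler_int; lia.
rewrite natrD natrM natrX intrD => h.
have -> : n%:~R / 2 ^+ t + d = (n%:~R + d * 2 ^+ t) / 2 ^+ t.
  by field; exact: exp2_neq0.
rewrite normrM normfV (gtr0_norm (exp2_gt0 t)) ltr_pdivlMr ?exp2_gt0 //.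
set a := d * _ in k1 k2 *; set K := k%:~R in k1 k2 h; set N := n%:~R in h *.
have : `|N + K| <= `|N + a| + `|a - K|.
  have -> : N + K = (N + a) - (a - K) by ring.
  exact: ler_normB.
rewrite (@ger0_norm _ (a - K)) ?subr_ge0 //; lra.
Qed.

End Sampling.

(** * Refinable functions and their symbols *)

Section Refinable.
Context {R : realType}.
Local Notation C := R[i].
Implicit Types (e f : R -> C) (E : C -> C) (z : C) (t : nat) (d : R).
Implicit Types (hs : seq (C * int)).

Lemma Cc_bsupp e t d (w : int -> C) : Cc e ->
  bsupp (fun n => e (n%:~R / 2 ^+ t + d) * w n).
Proof.
move=> [[B eB] _ _]; exists (B * 2 ^ t + 1 + `|Num.floor (d * 2 ^+ t)|)%N => n nB.
rewrite (Cc_supp_window eB) ?mul0r //; lia.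
Qed.

Lemma Cc_affine e (a b : R) : a != 0 -> Cc e -> Cc (fun x => e (a * x + b)).
Proof.
move=> a0 [[B eB] [M M0 eM] eU]; have a_gt0 : 0 < `|a| by rewrite normr_gt0.
split.
- have [n nB] : exists n : nat, (B%:R + `|b|) / `|a| < n%:R.
    by exists (Num.bound ((B%:R + `|b|) / `|a|)); apply: archi_boundP;
       rewrite divr_ge0 ?addr_ge0.
  exists n => x xn; apply: eB; have := lt_trans nB xn.
  rewrite ltr_pdivrMr // => h; have := ler_normB (a * x + b) b.
  rewrite addrK normrM; lra.
- by exists M.
- move=> eps /eU[del del0 h]; exists (del / `|a|); first by rewrite divr_gt0.
  move=> x y xy; apply: h; rewrite (_ : _ - _ = a * (x - y)); last by ring.
  by rewrite normrM mulrC -ltr_pdivlMr.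
Qed.

(** Repeated shifts in [hs] are allowed, and their coefficients add up. *)
Definition mask hs z := \sum_(u <- hs) u.1 * z ^ u.2.

Lemma mask_laurent hs : laurent (mask hs).
Proof.
apply: laurent_sum => u; apply: laurentM; first exact: laurent_cst.
exact: laurent_exprz.
Qed.

Definition two_scale hs e f := forall x : R,
  e (x / 2) = \sum_(u <- hs) u.1 * f (x - u.2%:~R).

(** A unit shift consists of 2^t steps of the grid, and contributes z^(2^t). *)
Lemma sample_two_scale hs e f t d z : Cc f -> two_scale hs e f -> z != 0 ->
  sample e t.+1 d z = mask hs (z ^+ (2 ^ t)) * sample f t (2 * d) z.
Proof.
move=> nf ef z0; rewrite /mask mulr_suml.
under eq_bigr => u _.
  rewrite -mulrA (_ : (z ^+ (2 ^ t)) ^ u.2 * _ =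
     sample f t (2 * d + (- (u.2 * (2 ^ t)%N%:Z))%:~R / 2 ^+ t) z); last first.
    by rewrite sample_shift // opprK (exprnP z) exprz_exp [X in z ^ X * _ = _]mulrC.
  rewrite -zsumZ.
  over.
rewrite -zsum_sum => [|u]; last first.
  have [W WP] := @Cc_bsupp f t (2 * d + (- (u.2 * (2 ^ t)%N%:Z))%:~R / 2 ^+ t) (fun n => z ^ n) nf.
  by exists W => n nW; rewrite WP // mulr0.
apply: eq_zsum => n; rewrite (_ : _ + d = (n%:~R / 2 ^+ t + 2 * d) / 2); last first.
  by rewrite exprS; field; apply: exp2_neq0.
rewrite ef mulr_suml; apply: eq_bigr => u _; rewrite -mulrA; congr (_ * (f _ * _)).
rewrite rmorphN rmorphM /= -[(2 ^ t)%N%:~R]/((2 ^ t)%N%:R) natrX.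
by field; apply: exp2_neq0.
Qed.

Section Refinement.
Context (f : R -> C) (hs : seq (C * int)).
Hypotheses (f_Cc : Cc f) (f_refinable : two_scale hs f f).
Local Notation h := (mask hs).

Lemma sample_refinement t d z : z != 0 ->
  sample f t d z = refinement h t z * sample f 0 (2 ^+ t * d) z.
Proof.
move=> z0; elim: t d => [|t IH] d; first by rewrite /refinement big_ord0 !mul1r.
rewrite (sample_two_scale _ _ f_Cc f_refinable) // IH (mulrA (2 ^+ t)) -exprSr.
by rewrite mulrA [in RHS]/refinement big_ord_recr [X in X * _]mulrC.
Qed.

(** This holds when e is the combination of integer translates of f with generating
    function E.  The formulation with samples allows E to be evaluated at roots of
    unity, and is stable under dilation by 2. *)
Definition has_symbol e E := forall t d z, z != 0 ->
  sample e t d z = E (z ^+ (2 ^ t)) * sample f t d z.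

Lemma has_symbol_shift (m : int) :
  has_symbol (fun x => f (x - m%:~R)) (fun y => y ^ m).
Proof.
move=> t d z z0; rewrite -[RHS](_ : sample f t (d + (- (m * (2 ^ t)%N%:Z))%:~R / 2 ^+ t) z = _).
  apply: eq_zsum => n; congr (f _ * _).
  rewrite rmorphN rmorphM /= -[(2 ^ t)%N%:~R]/((2 ^ t)%N%:R) natrX.
  by field; apply: exp2_neq0.
by rewrite sample_shift // opprK (exprnP z) exprz_exp [X in z ^ X * _]mulrC.
Qed.

Lemma has_symbol_half e E : has_symbol e E ->
  has_symbol (fun x => e (x / 2)) (fun y => h y * E (y ^+ 2)).
Proof.
move=> eE t d z z0.
have half u : sample (fun x => u (x / 2)) t d z = sample u t.+1 (d / 2) z.
  apply: eq_zsum => n; congr (u _ * _); rewrite exprS.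
  by field; apply: exp2_neq0.
rewrite half eE // (sample_two_scale _ _ f_Cc f_refinable) //.
rewrite -exprM -expnSr (_ : 2 * (d / 2) = d); last by field.
by ring.
Qed.

Lemma eq_has_symbol e1 e2 E1 E2 : e1 =1 e2 -> (forall y, y != 0 -> E1 y = E2 y) ->
  has_symbol e1 E1 -> has_symbol e2 E2.
Proof.
move=> e12 E12 eE t d z z0; rewrite -E12 ?expf_neq0 // -eE //.
by apply: eq_zsum => n; rewrite e12.
Qed.

Lemma has_symbol_refinement n (m : int) : has_symbol
  (fun x => f (x / 2 ^+ n - m%:~R)) (fun y => (y ^+ (2 ^ n)) ^ m * refinement h n y).
Proof.
elim: n => [|n IH].
  apply: eq_has_symbol (has_symbol_shift m) => [x|y y0]; first by rewrite expr0 divr1.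
  by rewrite expn0 expr1 /refinement big_ord0 mulr1.
apply: eq_has_symbol (has_symbol_half IH) => [x|y y0].
  by congr (f (_ - _)); rewrite exprS; field; apply: exp2_neq0.
by rewrite refinementS -exprM -expnS; ring.
Qed.

Lemma has_symbol_detail p gs n (m : int) : two_scale gs p f -> has_symbol
  (fun x => p (x / 2 ^+ n.+1 - m%:~R))
  (fun y => (y ^+ (2 ^ n.+1)) ^ m * detail h (mask gs) n.+1 y).
Proof.
move=> pf; elim: n => [|n IH].
  move=> t d z z0; rewrite detail1 expn1.
  transitivity (sample p t.+1 (d / 2 + (- (m * (2 ^ t.+1)%N%:Z))%:~R / 2 ^+ t.+1) z).
    apply: eq_zsum => k; congr (p _ * _); rewrite expr1.
    rewrite rmorphN rmorphM /= -[(2 ^ t.+1)%N%:~R]/((2 ^ t.+1)%N%:R) natrX exprS.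
    by field; apply: exp2_neq0.
  rewrite sample_shift // opprK (sample_two_scale _ _ f_Cc pf) //.
  rewrite (_ : 2 * (d / 2) = d); last by field.
  rewrite mulrA -exprM -expnSr (exprnP z (2 ^ t.+1)) exprz_exp.
  by rewrite [X in z ^ X * _ * _ = _]mulrC.
apply: eq_has_symbol (has_symbol_half IH) => [x|y y0].
  by congr (p (_ - _)); rewrite [in RHS]exprS; field; apply: exp2_neq0.
by rewrite detailSS -exprM -expnS; ring.
Qed.

End Refinement.
End Refinable.

(** * Discrete Riemann-Lebesgue lemma and perturbation of generating functions *)

Section Estimates.
Context {R : realType}.
Local Notation C := R[i].
Implicit Types (e f : R -> C) (z : C) (t : nat).

Lemma zsumB (F G : int -> C) : bsupp F -> bsupp G ->
  zsum (fun n => F n - G n) = zsum F - zsum G.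
Proof.
move=> [W1 F0] [W2 G0]; rewrite !(@zsumE _ _ (maxn W1 W2)).
- by rewrite -sumrB.
- by move=> n; rewrite gtn_max => /andP[n1 n2]; rewrite G0.
- by move=> n; rewrite gtn_max => /andP[n1 n2]; rewrite F0.
- by move=> n; rewrite gtn_max => /andP[n1 n2]; rewrite F0 // G0 // subrr.
Qed.

Lemma sample_point_eq0 e (B : nat) t (n : int) :
  (forall x, B%:R < `|x| -> e x = 0) -> (B * 2 ^ t < `|n|)%N ->
  e (n%:~R / 2 ^+ t) = 0.
Proof.
move=> eB nB; apply: eB; rewrite normrM normfV (gtr0_norm (exp2_gt0 t)).
rewrite ltr_pdivlMr ?exp2_gt0 // -natrX -natrM -intr_norm.
by rewrite -[_%:R]/((B * 2 ^ t)%N%:Z%:~R) ltr_int; lia.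
Qed.

(** Moving the summation index by D multiplies the sum by mu, up to the modulus of
    continuity of e.  Hence (1 - mu) times the sum is o(2^t), uniformly in w. *)
Lemma riemann_lebesgue e (W : R) (D : nat) (mu : C) (eps : R) :
  Cc e -> 0 <= W -> mu != 1 -> 0 < eps ->
  exists t0, forall t, (t0 <= t)%N -> forall w : int -> C,
    (forall n, normc (w n) <= W) -> (forall n, w (n + D%:Z) = mu * w n) ->
    normc (zsum (fun n => e (n%:~R / 2 ^+ t) * w n)) <= eps * 2 ^+ t.
Proof.
move=> ne W0 mu1 eps0; have [[B eB] _ eU] := ne.
have a0 : 0 < normc (1 - mu) by rewrite normc_gt0 subr_eq0 eq_sym.
pose K : R := normc mu * W * (2 * B + 3)%:R + 1.
have K0 : 0 < K by rewrite ltr_wpDl // !mulr_ge0 // normc_ge0.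
pose eta := normc (1 - mu) * eps / K.
have eta0 : 0 < eta by rewrite divr_gt0 // mulr_gt0.
have etaE : normc (1 - mu) * eps = K * eta by rewrite /eta [RHS]mulrC divfK // lt0r_neq0.
have KE : normc mu * W * (2 * B + 3)%:R <= K by rewrite lerDl.
clearbody eta K.
have [del del0 eD] := eU _ eta0.
have [t0 t0P] : exists t0, forall t, (t0 <= t)%N -> D%:R / 2 ^+ t < del /\ (D <= 2 ^ t)%N.
  exists (maxn D (Num.bound (D%:R / del))) => t; rewrite geq_max => /andP[Dt dt].
  split; last by apply: (leq_trans Dt); apply: ltnW; apply: ltn_expl.
  rewrite ltr_pdivrMr ?exp2_gt0 // mulrC -ltr_pdivrMr //.
  apply: (lt_le_trans (archi_boundP _)); first by rewrite divr_ge0 // ltW.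
  rewrite -natrX ler_nat; apply: (leq_trans dt); apply: ltnW; exact: ltn_expl.
exists t0 => t /t0P[Dt Dt2] w wW wD.
set Q := zsum _.
have QE : (1 - mu) * Q =
    mu * zsum (fun n => (e ((n + D%:Z)%:~R / 2 ^+ t) - e (n%:~R / 2 ^+ t)) * w n).
  have bF k : bsupp (fun n => e ((n + k)%:~R / 2 ^+ t) * w n).
    have [W' W'P] := @Cc_bsupp _ e t (k%:~R / 2 ^+ t) w ne.
    exists W' => n /W'P <-; congr (e _ * _); rewrite intrD; field; exact: exp2_neq0.
  have b0 := bF 0; under eq_zsum do rewrite mulrBl.
  rewrite zsumB //; last first.
    by have [W' W'P] := b0; exists W' => n /W'P; rewrite addr0.
  rewrite mulrBr mulrBl mul1r; congr (_ - _).
  rewrite -zsumZ /Q -(zsum_shift (fun n => e _ * w n) D%:Z); apply: eq_zsum => n.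
  by rewrite wD; ring.
have : normc (1 - mu) * normc Q <= normc (1 - mu) * (eps * 2 ^+ t).
  rewrite -normcM QE normcM.
  apply: (@le_trans _ _ (normc mu * ((2 * (B * 2 ^ t + D)).+1%:R * (eta * W)))).
    rewrite ler_wpM2l ?normc_ge0 //; apply: (@zsum_bound _ 0) => n.
      rewrite subr0 => nB; rewrite !(sample_point_eq0 eB) ?subrr ?mul0r //; clear -nB; lia.
    rewrite normcM ler_pM ?normc_ge0 //; apply: eD.
    rewrite intrD mulrDl addrC addKr normrM normfV (gtr0_norm (exp2_gt0 t)).
    by rewrite ger0_norm // -[D%:~R]/(D%:R) ler0n.
  have h1 : (2 * (B * 2 ^ t + D)).+1%:R <= (2 * B + 3)%:R * 2 ^+ t :> R.
    rewrite -natrX -natrM ler_nat; have := expn_gt0 2 t; clear -Dt2; nia.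
  rewrite mulrCA; apply: (le_trans (ler_wpM2r _ h1)).
    by rewrite mulr_ge0 ?normc_ge0 // mulr_ge0 // ltW.
  rewrite [leRHS]mulrA etaE -mulrA -[leRHS]mulrA.
  rewrite [leLHS](_ : _ = normc mu * W * (2 * B + 3)%:R * (eta * 2 ^+ t)); last by ring.
  by rewrite ler_wpM2r ?mulr_ge0 ?exprn_ge0 ?(ltW eta0).
by rewrite ler_pM2l.
Qed.

Lemma expR_sub1_le (x : R) : `|expR x - 1| <= `|x| * expR `|x|.
Proof.
have [x0|x0] := leP 0 x.
  rewrite (ger0_norm x0) ger0_norm ?subr_ge0 -?expR0 ?ler_expR // expR0.
  have := expR_ge1Dx (- x); rewrite expRN => h.
  have := ler_wpM2l (expR_ge0 x) h; rewrite mulfV ?expR_eq0 //; lra.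
have e1 : expR x <= 1 by rewrite -expR0 ler_expR ltW.
rewrite (ltr0_norm x0) ler0_norm ?subr_le0 // opprB.
have := expR_ge1Dx x; have : 1 <= expR (- x) by rewrite -expR0 ler_expR oppr_ge0 ltW.
move=> h1 h2; apply: (@le_trans _ _ (- x)); first lra.
by rewrite ler_peMr // oppr_ge0 ltW.
Qed.

Definition cexp (x : R) : C := (expR x)%:C.

Lemma cexp_neq0 x : cexp x != 0.
Proof. by rewrite /cexp (inj_eq (@complexI _)) expR_eq0. Qed.

Lemma cexpD x y : cexp (x + y) = cexp x * cexp y.
Proof. by rewrite /cexp expRD rmorphM. Qed.

Lemma cexpX x n : cexp x ^+ n = cexp (n%:R * x).
Proof. by rewrite /cexp -rmorphXn -expRM_natl. Qed.

Lemma cexpXz x (n : int) : cexp x ^ n = cexp (n%:~R * x).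
Proof.
case: n => n; first by rewrite -exprnP cexpX.
rewrite NegzE -exprnN cexpX /cexp -fmorphV -expRN.
by rewrite rmorphN mulNr.
Qed.

Lemma normc_cexp x : normc (cexp x) = expR x.
Proof. by rewrite normcR ger0_norm ?expR_ge0. Qed.

Lemma normc_cexp_sub1 x : normc (cexp x - 1) <= `|x| * expR `|x|.
Proof. by rewrite /cexp -(rmorph1 (real_complex R)) -rmorphB normcR expR_sub1_le. Qed.

Lemma Cc_cexp e (k : R) : Cc e -> Cc (fun x => e x * cexp (k * x)).
Proof.
move=> [[B eB] [M M0 eM] eU]; pose X : R := expR (`|k| * (B + 1)%:R).
have X0 : 0 < X by apply: expR_gt0.
have expX x : `|x| <= (B + 1)%:R -> normc (cexp (k * x)) <= X.
  move=> xB; rewrite normc_cexp ler_expR (le_trans (ler_norm _)) // normrM.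
  by rewrite ler_wpM2l.
split.
- by exists B => x /eB ->; rewrite mul0r.
- exists (M * X); first by rewrite mulr_ge0 // ltW.
  move=> x; have [xB|xB] := leP `|x| B%:R; last first.
    by rewrite eB // mul0r normc0 mulr_ge0 // ltW.
  rewrite normcM ler_pM ?normc_ge0 // expX // (le_trans xB) // ler_nat leq_addr //.
- move=> eps eps0; have e4 : 0 < eps / (2 * X) by rewrite divr_gt0 // mulr_gt0.
  have [d1 d10 eD] := eU _ e4.
  pose Y : R := 2 * (M * X * (`|k| * expR `|k|) + 1).
  have Y0 : 0 < Y.
    by rewrite mulr_gt0 // ltr_wpDl // !mulr_ge0 ?expR_ge0 // ltW.
  exists (Num.min 1 (Num.min d1 (eps / Y))).
    by rewrite !lt_min ltr01 d10 divr_gt0.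
  move=> x y; rewrite !lt_min => /and3P[xy1 xyd xyY].
  have [yB|yB] := leP `|y| B%:R; last first.
    rewrite (eB y) // mul0r subr0; have [xB|xB] := leP `|x| (B + 1)%:R; last first.
      rewrite eB ?mul0r ?normc0 ?(ltW eps0) //.
      by apply: le_lt_trans xB; rewrite ler_nat leq_addr.
    have := eD x y xyd; rewrite (eB y) // subr0 => h.
    rewrite normcM (le_trans (ler_pM _ _ h (expX _ xB))) ?normc_ge0 //.
    rewrite [leLHS](_ : _ = eps / 2); first lra.
    by field; rewrite ?lt0r_neq0.
  have -> : e x * cexp (k * x) - e y * cexp (k * y) =
      (e x - e y) * cexp (k * x) + e y * (cexp (k * y) * (cexp (k * (x - y)) - 1)).
    have -> : cexp (k * x) = cexp (k * y) * cexp (k * (x - y)).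
      by rewrite -cexpD; congr cexp; ring.
    ring.
  have xB : `|x| <= (B + 1)%:R.
    by have := ler_normD (x - y) y; rewrite subrK natrD; lra.
  have yB1 : `|y| <= (B + 1)%:R by rewrite (le_trans yB) // ler_nat leq_addr.
  apply: (le_trans (normcD _ _)); rewrite !normcM.
  have h1 : normc (e x - e y) * normc (cexp (k * x)) <= eps / 2.
    rewrite (le_trans (ler_pM _ _ (eD x y xyd) (expX _ xB))) ?normc_ge0 //.
    rewrite [leLHS](_ : _ = eps / 2) //.
    by field; rewrite ?lt0r_neq0.
  have h2 : normc (cexp (k * (x - y)) - 1) <= `|k| * expR `|k| * (eps / Y).
    apply: (le_trans (normc_cexp_sub1 _)); rewrite normrM -!mulrA.
    rewrite ler_wpM2l // [leLHS]mulrC ler_pM ?expR_ge0 //; last exact: ltW.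
    by rewrite ler_expR ler_piMr // ltW.
  suff : normc (e y) * (normc (cexp (k * y)) * normc (cexp (k * (x - y)) - 1)) <= eps / 2 by lra.
  apply: (@le_trans _ _ (M * (X * (`|k| * expR `|k| * (eps / Y))))).
    by rewrite !ler_pM ?mulr_ge0 ?normc_ge0 // expX.
  rewrite [leLHS](_ : _ = (M * X * (`|k| * expR `|k|)) * (eps / Y)); last by ring.
  apply: (@le_trans _ _ ((Y / 2) * (eps / Y))).
    by rewrite ler_wpM2r ?divr_ge0 ?(ltW eps0) ?(ltW Y0) // /Y; lra.
  by rewrite [leLHS](_ : _ = eps / 2) //; field; rewrite lt0r_neq0.
Qed.

(** On the support, exp(k/2^t)^n differs from 1 by O(k), so that for small k half of
    the lower bound at 1 survives. *)
Lemma sample_cexp_lower f (c : R) : Cc f -> 0 < c ->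
  (forall t, c * 2 ^+ t <= normc (sample f t 0 1)) ->
  exists2 k0 : R, 0 < k0 & forall k, 0 <= k -> k <= k0 -> forall t,
    c / 2 * 2 ^+ t <= normc (sample f t 0 (cexp (k / 2 ^+ t))).
Proof.
move=> nf c0 fc; have [[B fB] [M M0 fM] _] := nf.
pose X : R := (2 * B + 1)%:R * (M * (B%:R * expR B%:R)).
have X0 : 0 <= X by rewrite !mulr_ge0 ?expR_ge0.
exists (Num.min 1 (c / 2 / (X + 1))).
  by rewrite lt_min ltr01 !divr_gt0 // ltr_wpDl.
move=> k k0; rewrite le_min => /andP[k1 kX] t.
suff : normc (sample f t 0 (cexp (k / 2 ^+ t)) - sample f t 0 1) <= c / 2 * 2 ^+ t.
  move: (fc t) (sample f t 0 (cexp _)); move: (sample f t 0 1) => a fa b.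
  have := normcB b (b - a); rewrite (_ : b - (b - a) = a); [lra|ring].
rewrite /sample -zsumB; [|exact: Cc_bsupp..].
apply: (@le_trans _ _ ((2 * (B * 2 ^ t)).+1%:R * (M * (k * (B%:R * expR B%:R))))).
  apply: (@zsum_bound _ 0) => n; rewrite ?subr0 addr0.
    move=> nB; apply: etrans (subrr 0); rewrite (sample_point_eq0 fB nB).
    by congr (_ - _); exact: mul0r.
  rewrite exp1rz -mulrBr cexpXz normcM.
  have [nB|nB] := leqP `|n| (B * 2 ^ t); last first.
    by rewrite (sample_point_eq0 fB) // normc0 mul0r !mulr_ge0 ?expR_ge0.
  rewrite ler_pM ?normc_ge0 // (le_trans (normc_cexp_sub1 _)) //.
  have h : `|n%:~R * (k / 2 ^+ t)| <= k * B%:R.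
    rewrite normrM (ger0_norm (divr_ge0 k0 _)) ?exprn_ge0 //.
    rewrite mulrA ler_pdivrMr ?exp2_gt0 // mulrC -mulrA ler_wpM2l //.
    by rewrite -natrX -natrM -intr_norm -[(_ * _)%:R]/((B * 2 ^ t)%N%:Z%:~R) ler_int; lia.
  rewrite [leRHS]mulrA ler_pM ?expR_ge0 // ler_expR (le_trans h) //.
  by rewrite ler_piMl.
have h1 : (2 * (B * 2 ^ t)).+1%:R <= (2 * B + 1)%:R * 2 ^+ t :> R.
  rewrite -natrX -natrM ler_nat; have := expn_gt0 2 t; nia.
apply: (le_trans (ler_wpM2r _ h1)); first by rewrite !mulr_ge0 ?expR_ge0.
rewrite [leLHS](_ : _ = k * X * 2 ^+ t); last by rewrite /X; ring.
rewrite ler_wpM2r ?exprn_ge0 //.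
have : k * (X + 1) <= c / 2 by rewrite -ler_pdivlMr // ltr_wpDl.
by rewrite mulrDr mulr1; lra.
Qed.

Section Perturbation.
Context (hs : seq (C * int)).
Local Notation h := (mask hs).

Lemma mask_perturb (k : R) : exists2 K : R, 0 <= K &
  forall z x, normc z = 1 -> 0 <= x -> x <= k ->
  normc (h (z * cexp x) - h z) <= K * x.
Proof.
exists (\sum_(u <- hs) normc u.1 * (`|u.2|%:~R * expR (`|u.2|%:~R * k))).
  apply: sumr_ge0 => u _; rewrite !mulr_ge0 ?normc_ge0 ?expR_ge0 //.
move=> z x z1 x0 xk; rewrite /mask -sumrB mulr_suml.
apply: (le_trans (normc_sum _ _ _)); apply: ler_sum => u _.
have zn0 : z != 0 by rewrite -normc_gt0 z1.
rewrite -mulrBr expfzMl cexpXz -[X in _ - X]mulr1 -mulrBr !normcM.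
rewrite normcXz z1 exp1rz mul1r -!mulrA ler_wpM2l ?normc_ge0 //.
apply: (le_trans (normc_cexp_sub1 _)); rewrite normrM (ger0_norm x0) -intr_norm.
rewrite -mulrA ler_wpM2l ?intr_norm // mulrC ler_wpM2r // ler_expR.
by rewrite ler_wpM2l ?intr_norm.
Qed.

(** The factor of index i changes by O(k 2^i / 2^t) relatively to its size, and these
    errors sum to O(k). *)
Lemma refinement_perturb (k m : R) : 0 <= k -> 0 < m -> exists2 K : R, 0 <= K &
  forall z t, normc z = 1 -> (forall i, m <= normc (h (z ^+ (2 ^ i)))) ->
  normc (refinement h t (z * cexp (k / 2 ^+ t))) <= K * normc (refinement h t z).
Proof.
move=> k0 m0; have [K K0 hK] := mask_perturb k; pose a := K * k / m.
have a0 : 0 <= a by rewrite divr_ge0 ?mulr_ge0 // ltW.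
exists (expR a); first exact: expR_ge0.
move=> z t z1 hm.
have normcE w : normc (refinement h t w) = \prod_(i < t) normc (h (w ^+ (2 ^ i))).
  exact: normc_prod.
rewrite [leLHS]normcE [X in _ <= _ * X]normcE.
apply: (@le_trans _ _ (\prod_(i < t) (normc (h (z ^+ (2 ^ i))) * expR (a * 2 ^+ i / 2 ^+ t)))).
  apply: ler_prod => i _; rewrite normc_ge0 /=.
  rewrite exprMn cexpX; set x := _ * (k / _).
  have x0 : 0 <= x by rewrite mulr_ge0 // divr_ge0.
  have xE : x = k * (2 ^+ i / 2 ^+ t) by rewrite /x natrX; ring.
  have it : 2 ^+ i / 2 ^+ t <= 1 :> R.
    rewrite ler_pdivrMr ?exp2_gt0 // mul1r.
    by apply: ler_weXn2l; [rewrite ler1n | exact: ltnW (ltn_ord i)].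
  have xk : x <= k by rewrite xE ler_piMr.
  have /hK/(_ x0 xk) : normc (z ^+ (2 ^ i)) = 1 by rewrite normcX z1 expr1n.
  set b := h (_ * _); set b0 := h _ => bb0.
  apply: (@le_trans _ _ (normc b0 * (1 + a * 2 ^+ i / 2 ^+ t))); last first.
    by rewrite ler_wpM2l ?normc_ge0 // expR_ge1Dx.
  have := normcB (b - b0) (- b0); rewrite opprK subrK normcN mulrDr mulr1 => h1.
  rewrite (le_trans h1) // addrC lerD2l (le_trans bb0) //.
  rewrite (_ : K * x = m * (a * 2 ^+ i / 2 ^+ t)); last first.
    by rewrite /a xE; field; rewrite exp2_neq0 lt0r_neq0.
  apply: ler_wpM2r; last exact: hm.
  by apply: divr_ge0; [apply: mulr_ge0 => //|]; apply: exprn_ge0.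
rewrite big_split /= mulrC ler_wpM2r //; first by apply: prodr_ge0 => i _; apply: normc_ge0.
rewrite -expR_sum ler_expR -mulr_suml -mulr_sumr -mulrA ler_piMr //.
rewrite ler_pdivrMr ?exp2_gt0 // mul1r.
have -> : \sum_(i < t) 2 ^+ i = 2 ^+ t - 1 :> R.
  by rewrite [RHS]subrX1 (_ : 2 - 1 = 1 :> R) ?mul1r //; ring.
lra.
Qed.

End Perturbation.
End Estimates.

(** * Double sums of sheared products *)

Section SlantedSums.
Context {R : realType}.
Local Notation C := R[i].
Implicit Types (e f u v : R -> C) (z : C) (t r : nat).

Lemma shear_bsupp2 u v (sg : R) s t : Cc u -> Cc v ->
  exists W : nat, forall n m : int, (W < `|n|)%N || (W < `|m|)%N ->
    u (m%:~R / 2 ^+ s + sg * (n%:~R / 2 ^+ t)) * v (n%:~R / 2 ^+ t) = 0.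
Proof.
move=> [[B1 uB] _ _] [[B2 vB] _ _].
have x0 : 0 <= 2 ^+ s * (B1%:R + `|sg| * B2%:R) :> R.
  by rewrite mulr_ge0 ?exprn_ge0 // addr_ge0 // mulr_ge0.
exists (maxn (B2 * 2 ^ t) (Num.bound (2 ^+ s * (B1%:R + `|sg| * B2%:R)))) => n m.
have [nB|nB _] := leqP `|n| (B2 * 2 ^ t); last first.
  by rewrite (sample_point_eq0 vB) // mulr0.
rewrite leq_gtF /= ?leq_max ?nB // gtn_max => /andP[_ mB].
rewrite uB ?mul0r //.
have h1 : `|n%:~R / 2 ^+ t| <= B2%:R :> R.
  rewrite normrM normfV (gtr0_norm (exp2_gt0 t)) ler_pdivrMr ?exp2_gt0 //.
  by rewrite -natrX -natrM -intr_norm -[(_ * _)%:R]/((B2 * 2 ^ t)%N%:Z%:~R) ler_int; lia.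
have h2 : B1%:R + `|sg| * B2%:R < `|m%:~R / 2 ^+ s| :> R.
  rewrite normrM normfV (gtr0_norm (exp2_gt0 s)) ltr_pdivlMr ?exp2_gt0 // mulrC.
  apply: (lt_trans (archi_boundP x0)); rewrite -intr_norm -[_%:R]/(_%:Z%:~R) ltr_int.
  by lia.
have h3 : `|sg * (n%:~R / 2 ^+ t)| <= `|sg| * B2%:R by rewrite normrM ler_wpM2l.
have := ler_normB (m%:~R / 2 ^+ s + sg * (n%:~R / 2 ^+ t)) (sg * (n%:~R / 2 ^+ t)).
rewrite addrK; lra.
Qed.

Lemma refinementD (h : C -> C) m n z :
  refinement h (m + n) z = refinement h m z * refinement h n (z ^+ (2 ^ m)).
Proof.
elim: m z => [|m IH] z; first by rewrite add0n [refinement h 0 z]big_ord0 mul1r.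
by rewrite addSn !refinementS IH -exprM -expnS mulrA.
Qed.

Section Fixed.
Context (f : R -> C) (hs : seq (C * int)).
Hypotheses (f_Cc : Cc f) (f_refinable : two_scale hs f f).
Local Notation h := (mask hs).

(** Replacing n1 by n1 + K n2 straightens the atom of slope K; the weight of slope k
    then leaves the power z^(k-K) in the variable n2. *)
Lemma shear_sum u v (U : C -> C) t r (k K : int) z y :
  Cc u -> Cc v -> has_symbol f u U -> z != 0 -> y != 0 ->
  zsum (fun n2 => zsum (fun n1 =>
    u (n1%:~R / 2 ^+ (t + r) + K%:~R / 2 ^+ r * (n2%:~R / 2 ^+ t)) * v (n2%:~R / 2 ^+ t) *
    (z ^ (n1 + k * n2) * y ^ n2))) =
  U (z ^+ (2 ^ (t + r))) * sample f (t + r) 0 z * sample v t 0 (z ^ (k - K) * y).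
Proof.
move=> nu nv uU z0 y0; rewrite -uU // /sample -zsumZ; apply: eq_zsum => n2.
rewrite [RHS]mulrC -zsumZ -[RHS](zsum_shift _ (K * n2)); apply: eq_zsum => n1.
rewrite !addr0 expfzMl exprz_exp.
have -> : (n1 + K * n2)%:~R / 2 ^+ (t + r) =
    n1%:~R / 2 ^+ (t + r) + K%:~R / 2 ^+ r * (n2%:~R / 2 ^+ t) :> R.
  by rewrite intrD intrM exprD; field; rewrite !exp2_neq0.
have -> : n1 + k * n2 = n1 + K * n2 + (k - K) * n2 by ring.
by rewrite (@expfzDr _ z (n1 + K * n2)) //; ring.
Qed.

(** For an atom sheared in the other direction, the sum over n2 is a generating
    function at z^k y with an offset depending on n1; the cascade product in
    it depends neither on the offset nor on n1. *)
Lemma cross_shear_sum a b (A : C -> C) t r (k T : int) z y :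
  Cc a -> Cc b -> has_symbol f a A -> z != 0 -> y != 0 ->
  zsum (fun n2 => zsum (fun n1 =>
    a (n2%:~R / 2 ^+ t + T%:~R / 2 ^+ r * (n1%:~R / 2 ^+ (t + r))) *
      b (n1%:~R / 2 ^+ (t + r)) * (z ^ (n1 + k * n2) * y ^ n2))) =
  A ((z ^ k * y) ^+ (2 ^ t)) * refinement h t (z ^ k * y) *
  zsum (fun n => b (n%:~R / 2 ^+ (t + r)) *
    (z ^ n * sample f 0 ((T * n)%:~R / 2 ^+ (2 * r)) (z ^ k * y))).
Proof.
move=> na nb aA z0 y0; have zy0 : z ^ k * y != 0 by rewrite mulf_neq0 ?expfz_neq0.
rewrite exchange_zsum; last first.
  have [W WP] := shear_bsupp2 (T%:~R / 2 ^+ r) t (t + r) na nb.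
  by exists W => n m; rewrite orbC => /WP ->; rewrite mul0r.
rewrite -zsumZ; apply: eq_zsum => n1.
have -> : (T * n1)%:~R / 2 ^+ (2 * r) =
   2 ^+ t * (T%:~R / 2 ^+ r * (n1%:~R / 2 ^+ (t + r))) :> R.
  by rewrite mulnC exprM expr2 exprD intrM; field; rewrite !exp2_neq0.
transitivity (b (n1%:~R / 2 ^+ (t + r)) * z ^ n1 *
    sample a t (T%:~R / 2 ^+ r * (n1%:~R / 2 ^+ (t + r))) (z ^ k * y)).
  rewrite /sample -zsumZ; apply: eq_zsum => n2.
  by rewrite expfzMl exprz_exp (@expfzDr _ z n1) //; ring.
by rewrite aA // (sample_refinement f_Cc f_refinable) //; ring.
Qed.

(** Increasing n by 2^(2r) increases the offset by the integer T, which multiplies the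
    summand by z^(2^(2r) - k T), after the growth of the powers of exp(kap/2^t) has
    been transferred to b.  The Riemann-Lebesgue lemma applies with this period. *)
Lemma twisted_sum_small b r (k T : int) z (kap eps : R) :
  Cc b -> 0 <= kap -> normc z = 1 -> z ^ ((2 ^ (2 * r))%N%:Z - k * T) != 1 -> 0 < eps ->
  exists t0, forall t, (t0 <= t)%N ->
    normc (zsum (fun n => b (n%:~R / 2 ^+ (t + r)) *
      (z ^ n * sample f 0 ((T * n)%:~R / 2 ^+ (2 * r)) (z ^ k * cexp (kap / 2 ^+ t)))))
    <= eps * 2 ^+ (t + r).
Proof.
move=> nb kap0 z1 mu1 eps0; have zn0 : z != 0 by rewrite -normc_gt0 z1.
have [[B fB] [M M0 fM] _] := f_Cc.
pose X : R := (2 * (B + 1)).+1%:R * (M * expR (B%:R * kap)).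
have X0 : 0 <= X by rewrite /X !mulr_ge0 ?expR_ge0.
have [t0 t0P] := riemann_lebesgue (2 ^ (2 * r))%N (Cc_cexp (- (kap * (T%:~R / 2 ^+ r))) nb)
  X0 mu1 eps0.
exists t0 => t tt0.
pose d (n : int) : R := (T * n)%:~R / 2 ^+ (2 * r).
(* The factor exp(d n kap/2^t) bounds w uniformly in n, and is compensated by an
   exponential of the fixed rate - kap T/2^r in b. *)
pose w (n : int) := z ^ n * (cexp (d n * (kap / 2 ^+ t)) *
  sample f 0 (d n) (z ^ k * cexp (kap / 2 ^+ t))).
have y0 : z ^ k * cexp (kap / 2 ^+ t) != 0 by rewrite mulf_neq0 ?expfz_neq0 ?cexp_neq0.
have dE n : d n * (kap / 2 ^+ t) = kap * (T%:~R / 2 ^+ r) * (n%:~R / 2 ^+ (t + r)).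
  by rewrite /d mulnC exprM expr2 exprD intrM; field; rewrite !exp2_neq0.
have -> : zsum (fun n => b (n%:~R / 2 ^+ (t + r)) *
      (z ^ n * sample f 0 ((T * n)%:~R / 2 ^+ (2 * r)) (z ^ k * cexp (kap / 2 ^+ t)))) =
  zsum (fun n => b (n%:~R / 2 ^+ (t + r)) *
      cexp (- (kap * (T%:~R / 2 ^+ r)) * (n%:~R / 2 ^+ (t + r))) * w n).
  apply: eq_zsum => n; rewrite /w dE mulNr -/(d n).
  set x := _ * (n%:~R / _); have : cexp (- x) * cexp x = 1.
    by rewrite -cexpD addNr /cexp expR0.
  by move=> e1; rewrite -[LHS]mul1r -e1; ring.
apply: t0P; first by rewrite (leq_trans tt0) ?leq_addr.
- move=> n; rewrite /w normcM normcXz z1 exp1rz mul1r /sample -zsumZ.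
  apply: (@zsum_bound _ (- Num.floor (d n)) (B + 1)) => m.
    rewrite opprK => mB.
    rewrite (Cc_supp_window fB) ?mul0r ?mulr0 //.
    by rewrite expn0 muln1 expr0 mulr1.
  rewrite expfzMl cexpXz (mulrC (f _)) !mulrA (mulrAC (cexp _)) -cexpD mulrAC.
  rewrite !normcM normcXz normcXz z1 !exp1rz mulr1 normc_cexp expr0 divr1 mulrC.
  have [mB|mB] := leP `|m%:~R + d n| B%:R; last first.
    by rewrite fB // normc0 mul0r mulr_ge0 ?expR_ge0.
  rewrite ler_pM ?normc_ge0 ?expR_ge0 // ler_expR -mulrDl addrC.
  have kt : 0 <= kap / 2 ^+ t by rewrite divr_ge0 ?exprn_ge0.
  apply: (@le_trans _ _ (B%:R * (kap / 2 ^+ t))).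
    by rewrite -mulrDl -mulrA ler_wpM2r // (le_trans (ler_norm _)).
  by rewrite ler_wpM2l // ler_pdivrMr ?exp2_gt0 // ler_peMr // exprn_ege1 // ler1n.
- move=> n; rewrite /w.
  have dD : d (n + (2 ^ (2 * r))%N%:Z) = d n + T%:~R / 2 ^+ 0.
    rewrite /d mulrDr intrD (intrM _ T (_ ^ _)%N) -[(2 ^ (2 * r))%N%:~R]/((2 ^ (2 * r))%N%:R) natrX.
    by field; rewrite exp2_neq0.
  rewrite dD sample_shift // mulrDl cexpD !(expfzDr _ _ zn0) expfzMl.
  rewrite cexpXz exprz_exp (_ : k * - T = - (k * T)); last by ring.
  rewrite expr0 divr1 rmorphN mulNr /cexp expRN fmorphV.
  have : (expR (T%:~R * (kap / 2 ^+ t)))%:C != 0 :> C by apply: cexp_neq0.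
  move=> x0; field.
  by rewrite x0.
Qed.

End Fixed.
End SlantedSums.

(** * The relation at a root of unity of prime order *)

Section RootsOfUnity.
Context {R : realType}.
Local Notation C := R[i].

Lemma seq_lower_bound (s : seq R) : (forall x, x \in s -> 0 < x) ->
  exists2 m : R, 0 < m & forall x, x \in s -> m <= x.
Proof.
elim: s => [|x s IH] s0; first by exists 1.
have [y ys|m m0 ms] := IH; first by apply: s0; rewrite inE ys orbT.
exists (Num.min x m); first by rewrite lt_min m0 s0 ?inE ?eqxx.
by move=> y; rewrite inE => /orP[/eqP->|/ms my]; rewrite ge_min ?lexx // my orbT.
Qed.

Lemma unity_roots_bound (F : C -> R) q (z : C) : q.-primitive_root z ->
  exists2 M : R, 0 <= M & forall x, x ^+ q = 1 -> F x <= M.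
Proof.
move=> zq; exists (\sum_(j < q) `|F (z ^+ j)|); first exact: sumr_ge0.
move=> x xq; have [i ->] := prim_rootP zq xq.
by rewrite (bigD1 i) //= (le_trans (ler_norm _)) // lerDl sumr_ge0.
Qed.

Lemma prim_roots_lower (F : C -> R) q (z : C) : q.-primitive_root z ->
  (forall x, q.-primitive_root x -> 0 < F x) ->
  exists2 m : R, 0 < m & forall x, q.-primitive_root x -> m <= F x.
Proof.
move=> zq F0.
have [x|m m0 mP] := @seq_lower_bound [seq F (z ^+ j) | j <- iota 0 q & q.-primitive_root (z ^+ j)].
  by case/mapP => j; rewrite mem_filter => /andP[jq _] ->; apply: F0.
exists m => // x xq; have [i xi] := prim_rootP zq (prim_expr_order xq).
apply: mP; apply/mapP; exists (i : nat); last by rewrite xi.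
by rewrite mem_filter -xi xq mem_iota /= ltn_ord.
Qed.

(** Fermat: 2^(q-1) = 1 modulo q. *)
Lemma root_pow2 q (z : C) n : prime q -> odd q -> z ^+ q = 1 ->
  z ^+ (2 ^ (q.-1 * n)) = z.
Proof.
move=> qp qo zq; rewrite -(expr_mod _ zq) expnM.
have -> : ((2 ^ q.-1) ^ n = 1 %[mod q])%N.
  rewrite -modnXm -totient_prime // Euler_exp_totient ?coprime2n //.
  by rewrite modnXm exp1n.
by rewrite modn_small ?prime_gt1.
Qed.

Lemma prim_pow2 q (z : C) n : odd q -> q.-primitive_root z ->
  q.-primitive_root (z ^+ (2 ^ n)).
Proof. by move=> qo zq; rewrite prim_root_exp_coprime // coprimeXl ?coprime2n. Qed.

Lemma normc_prim q (z : C) : q.-primitive_root z -> normc z = 1.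
Proof.
move=> zq; apply/eqP; rewrite -(@pexpr_eq1 _ _ q) ?normc_ge0 ?(prim_order_gt0 zq) //.
by rewrite -normcX prim_expr_order // normc1.
Qed.

Lemma refinementM (h : C -> C) q (z : C) n : prime q -> odd q -> z ^+ q = 1 ->
  refinement h (q.-1 * n) z = refinement h q.-1 z ^+ n.
Proof.
move=> qp qo zq; elim: n => [|n IH]; first by rewrite muln0 [LHS]big_ord0.
have zE : z ^+ (2 ^ q.-1) = z by rewrite -[q.-1]muln1 root_pow2.
by rewrite mulnS refinementD zE IH exprS.
Qed.

End RootsOfUnity.

Section Relation.
Context {R : realType}.
Local Notation C := R[i].
Context (f : R -> C) (hs : seq (C * int)) (c0 : R).
Hypotheses (f_Cc : Cc f) (f_refinable : two_scale hs f f) (c0_gt0 : 0 < c0).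
Hypothesis f_mass : forall t, c0 * 2 ^+ t <= normc (sample f t 0 1).
Local Notation h := (mask hs).

Context (I J : Type) (sA : seq I) (sB : seq J) (r : nat) (k : int).
Context (cA : I -> C) (K : I -> int) (u v : I -> R -> C) (U V : I -> C -> C).
Context (cB : J -> C) (T : J -> int) (a b : J -> R -> C) (A : J -> C -> C).
Hypotheses (u_Cc : forall i, Cc (u i)) (v_Cc : forall i, Cc (v i)).
Hypotheses (uU : forall i, has_symbol f (u i) (U i)) (vV : forall i, has_symbol f (v i) (V i)).
Hypotheses (a_Cc : forall j, Cc (a j)) (b_Cc : forall j, Cc (b j)).
Hypothesis aA : forall j, has_symbol f (a j) (A j).
Hypothesis slanted_sum0 : forall x1 x2 : R,
  \sum_(i <- sA) cA i * (u i (x1 + (K i)%:~R / 2 ^+ r * x2) * v i x2) +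
  \sum_(j <- sB) cB j * (a j (x2 + (T j)%:~R / 2 ^+ r * x1) * b j x1) = 0.

Section AtRoot.
Context (q : nat) (z : C).
Hypotheses (q_prime : prime q) (q_odd : odd q) (zq : q.-primitive_root z).
Hypothesis h_neq0 : forall x, q.-primitive_root x -> h x != 0.
Hypothesis S_neq0 : sample f 0 0 z != 0.
Hypothesis z_max : forall x, q.-primitive_root x ->
  normc (refinement h q.-1 x) <= normc (refinement h q.-1 z).
Hypothesis zk_prim : q.-primitive_root (z ^ k).
Hypothesis zA : forall i, K i != k -> z ^ (k - K i) != 1.
Hypothesis zB : forall j, z ^ ((2 ^ (2 * r))%N%:Z - k * T j) != 1.

Context (kap : R).
Hypothesis kap_ge0 : 0 <= kap.
Hypothesis kap_lower : forall t,
  c0 / 2 * 2 ^+ t <= normc (sample f t 0 (cexp (kap / 2 ^+ t))).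

(* lev N + r is a multiple of q - 1, so that z^(2^(lev N + r)) = z and the cascade
   product of length lev N + r is a power of the one of length q - 1. *)
Let lev N := (q.-1 * (N + r) - r)%N.
Let Lam := normc (refinement h q.-1 z).
(* Order of magnitude of S_(lev N + r)(z) S_(lev N)(exp(kap/2^(lev N))). *)
Let size_at N := Lam ^+ (N + r) * 2 ^+ lev N.
Let small (F : nat -> C) := forall eps : R, 0 < eps ->
  exists N0, forall N, (N0 <= N)%N -> normc (F N) <= eps * size_at N.

Let z1 : normc z = 1. Proof. exact: normc_prim zq. Qed.
Let z0 : z != 0. Proof. by rewrite -normc_gt0 z1. Qed.
Let q1_gt0 : (0 < q.-1)%N. Proof. by have := prime_gt1 q_prime; case: q => [|[]]. Qed.

Let levE N : (lev N + r = q.-1 * (N + r))%N.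
Proof. by rewrite subnK // (leq_trans (leq_addl N r)) // leq_pmull. Qed.

Let lev_ge N : (N <= lev N)%N.
Proof. by rewrite -(leq_add2r r) levE leq_pmull. Qed.

Let z_pow N : z ^+ (2 ^ (lev N + r)) = z.
Proof. by rewrite levE root_pow2 // prim_expr_order. Qed.

Let refinement_prim_neq0 x n : q.-primitive_root x -> refinement h n x != 0.
Proof.
by move=> xq; apply/prodf_neq0 => i _; apply/h_neq0/prim_pow2.
Qed.

Let Lam_gt0 : 0 < Lam. Proof. by rewrite /Lam normc_gt0 refinement_prim_neq0. Qed.

Let size_gt0 N : 0 < size_at N.
Proof. by rewrite /size_at mulr_gt0 ?exprn_gt0. Qed.

Let small_sum (I' : Type) (s : seq I') (P : pred I') (F : I' -> nat -> C) :
  (forall i, P i -> small (F i)) -> small (fun N => \sum_(i <- s | P i) F i N).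
Proof.
move=> sF; elim: s => [|i s IH] eps eps0.
  by exists 0%N => N _; rewrite big_nil normc0 mulr_ge0 // ltW.
have [Pi|nPi] := boolP (P i); last first.
  by have [N0 N0P] := IH eps eps0; exists N0 => N /N0P; rewrite big_cons (negPf nPi).
have e2 : 0 < eps / 2 by rewrite divr_gt0.
have [N1 N1P] := IH _ e2; have [N2 N2P] := sF i Pi _ e2.
exists (maxn N1 N2) => N; rewrite geq_max => /andP[/N1P h1 /N2P h2].
rewrite big_cons Pi (le_trans (normcD _ _)) //.
by move: h1 h2; set x := normc _; set y := normc _; lra.
Qed.

Let small_le (F : nat -> C) (M : R) : 0 <= M ->
  (forall eps, 0 < eps -> exists N0, forall N, (N0 <= N)%N ->
     normc (F N) <= M * (eps * size_at N)) -> small F.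
Proof.
move=> M0 FM eps eps0; have e1 : 0 < eps / (M + 1) by rewrite divr_gt0 // ltr_wpDl.
have [N0 N0P] := FM _ e1; exists N0 => N /N0P h1; apply: (le_trans h1).
rewrite mulrA ler_wpM2r ?(ltW (size_gt0 N)) //.
by rewrite mulrA ler_pdivrMr ?ltr_wpDl // mulrC ler_pM2l //; lra.
Qed.

Let sample_z N : normc (sample f (lev N + r) 0 z) = Lam ^+ (N + r) * normc (sample f 0 0 z).
Proof.
rewrite (sample_refinement f_Cc f_refinable) // mulr0 normcM levE.
by rewrite refinementM ?normcX // prim_expr_order.
Qed.

Let off_slope_small i : K i != k ->
  small (fun N => cA i * (U i (z ^+ (2 ^ (lev N + r))) * sample f (lev N + r) 0 z *
    sample (v i) (lev N) 0 (z ^ (k - K i) * cexp (kap / 2 ^+ lev N)))).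
Proof.
move=> Kk; pose M := normc (cA i) * normc (U i z) * normc (sample f 0 0 z).
apply: (@small_le _ M); first by rewrite /M !mulr_ge0 ?normc_ge0.
move=> eps eps0; have zk1 := zA Kk.
have [t0 t0P] := riemann_lebesgue 1 (Cc_cexp kap (v_Cc i)) ler01 zk1 eps0.
exists t0 => N tN; have tl := leq_trans tN (lev_ge N).
rewrite z_pow.
rewrite !normcM sample_z.
have : normc (sample (v i) (lev N) 0 (z ^ (k - K i) * cexp (kap / 2 ^+ lev N)))
    <= eps * 2 ^+ lev N.
  have -> : sample (v i) (lev N) 0 (z ^ (k - K i) * cexp (kap / 2 ^+ lev N)) =
    zsum (fun n => v i (n%:~R / 2 ^+ lev N) * cexp (kap * (n%:~R / 2 ^+ lev N)) *
      (z ^ (k - K i)) ^ n).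
    apply: eq_zsum => n; rewrite addr0 expfzMl cexpXz mulrA mulrAC.
    by congr (_ * cexp _ * _); ring.
  apply: t0P => // n; first by rewrite !normcXz z1 !exp1rz.
  by rewrite expfzDr ?expfz_neq0 // mulrC.
set S := normc (sample (v i) _ _ _) => SP.
rewrite /M /size_at.
apply: (@le_trans _ _ (normc (cA i) * (normc (U i z) * (Lam ^+ (N + r) *
   normc (sample f 0 0 z)) * (eps * 2 ^+ lev N)))).
  by do 2!rewrite ler_wpM2l ?mulr_ge0 ?normc_ge0 ?exprn_ge0 ?(ltW Lam_gt0) //.
by rewrite le_eqVlt; apply/orP; left; apply/eqP; ring.
Qed.

Let cross_small j :
  small (fun N => cB j * (A j ((z ^ k * cexp (kap / 2 ^+ lev N)) ^+ (2 ^ lev N)) *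
    refinement h (lev N) (z ^ k * cexp (kap / 2 ^+ lev N)) *
    zsum (fun n => b j (n%:~R / 2 ^+ (lev N + r)) *
    (z ^ n * sample f 0 (((T j) * n)%:~R / 2 ^+ (2 * r))
       (z ^ k * cexp (kap / 2 ^+ lev N)))))).
Proof.
have zkq : (z ^ k) ^+ q = 1 by rewrite prim_expr_order.
have [M1 M10 M1P] := unity_roots_bound (fun x => normc (A j (x * cexp kap))) zq.
have [m m0 mP] := prim_roots_lower (F := fun x => normc (h x)) zq
  (fun x xq => etrans (normc_gt0 _) (h_neq0 xq)).
have [M2 M20 M2P] := refinement_perturb hs kap_ge0 m0.
pose M := normc (cB j) * M1 * M2 / m ^+ r * 2 ^+ r.
have mr0 : 0 < m ^+ r by apply: exprn_gt0.
apply: (@small_le _ M).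
  by rewrite /M !mulr_ge0 ?invr_ge0 ?normc_ge0 ?exprn_ge0 // ltW.
move=> eps eps0.
have [t0 t0P] := twisted_sum_small f_Cc (b_Cc j) kap_ge0 z1 (zB j) eps0.
exists t0 => N tN; have := t0P _ (leq_trans tN (lev_ge N)).
rewrite !normcM; set Q := normc (zsum _) => QP.
have AP : normc (A j ((z ^ k * cexp (kap / 2 ^+ lev N)) ^+ (2 ^ lev N))) <= M1.
  rewrite exprMn cexpX (_ : _ * (kap / _) = kap); last first.
    by rewrite natrX; field; exact: exp2_neq0.
  by apply: M1P; rewrite exprAC zkq expr1n.
have RP : normc (refinement h (lev N) (z ^ k * cexp (kap / 2 ^+ lev N)))
    <= M2 * (Lam ^+ (N + r) / m ^+ r).
  have nzk : normc (z ^ k) = 1 by rewrite normcXz z1 exp1rz.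
  (* The last r factors, which are missing at level lev N, are at least m each. *)
  have zkm i : m <= normc (h ((z ^ k) ^+ (2 ^ i))) by apply/mP/prim_pow2.
  apply: (le_trans (M2P _ _ nzk zkm)); rewrite ler_wpM2l // ler_pdivlMr //.
  apply: (@le_trans _ _ (normc (refinement h (lev N + r) (z ^ k)))).
    rewrite refinementD normcM ler_wpM2l ?normc_ge0 //.
    rewrite /refinement normc_prod -[X in m ^+ X]card_ord -prodr_const.
    apply: ler_prod => i _; rewrite (ltW m0) /=.
    by apply: mP; apply: prim_pow2 => //; apply: prim_pow2.
  rewrite levE (refinementM h (N + r) q_prime q_odd zkq) normcX.
  apply: lerXn2r; [exact: normc_ge0|exact: normc_ge0|exact: z_max].
apply: (@le_trans _ _ (normc (cB j) * (M1 * (M2 * (Lam ^+ (N + r) / m ^+ r)) *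
   (eps * 2 ^+ (lev N + r))))).
  rewrite ler_wpM2l ?normc_ge0 //; apply: ler_pM => //; first by rewrite mulr_ge0 ?normc_ge0.
    exact: normc_ge0.
  by apply: ler_pM => //; exact: normc_ge0.
rewrite /M /size_at (exprD 2) le_eqVlt; apply/orP; left; apply/eqP.
move: (Lam ^+ _) (2 ^+ lev N) (2 ^+ r) (m ^+ r) mr0 => x1 x2 x3 x4 x40.
by field; rewrite lt0r_neq0.
Qed.

(** Sum the relation over n1/2^(t+r), n2/2^t against z^(n1 + k n2) exp(kap/2^t)^n2.
    The terms of slope k contribute the left-hand side times a quantity of exact order
    [size_at], and all others are [small] with respect to it. *)
Lemma relation_at_root : \sum_(i <- sA | K i == k) cA i * (U i z * V i (cexp kap)) = 0.
Proof.
pose X := \sum_(i <- sA | K i == k) cA i * (U i z * V i (cexp kap)).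
have third (x : R) : 0 < x -> x / 3 + x / 3 < x by lra.
apply: contraPP f_mass => /eqP X0 _.
have mainE N : X * (sample f (lev N + r) 0 z * sample f (lev N) 0 (cexp (kap / 2 ^+ lev N))) =
  - (\sum_(i <- sA | K i != k)
     cA i * (U i (z ^+ (2 ^ (lev N + r))) * sample f (lev N + r) 0 z *
    sample (v i) (lev N) 0 (z ^ (k - K i) * cexp (kap / 2 ^+ lev N))) +
   \sum_(j <- sB) cB j * (A j ((z ^ k * cexp (kap / 2 ^+ lev N)) ^+ (2 ^ lev N)) *
    refinement h (lev N) (z ^ k * cexp (kap / 2 ^+ lev N)) *
    zsum (fun n => b j (n%:~R / 2 ^+ (lev N + r)) *
    (z ^ n * sample f 0 (((T j) * n)%:~R / 2 ^+ (2 * r))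
       (z ^ k * cexp (kap / 2 ^+ lev N)))))).
  set t := lev N; set y := cexp (kap / 2 ^+ t).
  have y0 : y != 0 by apply: cexp_neq0.
  apply/eqP; rewrite -subr_eq0 opprK; apply/eqP.
  pose FA i (n2 n1 : int) := cA i * (u i (n1%:~R / 2 ^+ (t + r) + (K i)%:~R / 2 ^+ r * (n2%:~R / 2 ^+ t)) *
    v i (n2%:~R / 2 ^+ t) * (z ^ (n1 + k * n2) * y ^ n2)).
  pose FB j (n2 n1 : int) := cB j * (a j (n2%:~R / 2 ^+ t + (T j)%:~R / 2 ^+ r * (n1%:~R / 2 ^+ (t + r))) *
      b j (n1%:~R / 2 ^+ (t + r)) * (z ^ (n1 + k * n2) * y ^ n2)).
  have FAE i : zsum (fun n2 => zsum (FA i n2)) = cA i * (U i (z ^+ (2 ^ (t + r))) *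
      sample f (t + r) 0 z * sample (v i) t 0 (z ^ (k - K i) * y)).
    rewrite -(shear_sum t r k (K i) (u_Cc i) (v_Cc i) (uU i) z0 y0) -zsumZ.
    by apply: eq_zsum => n; rewrite -zsumZ.
  have FBE j : zsum (fun n2 => zsum (FB j n2)) = cB j * (A j ((z ^ k * y) ^+ (2 ^ t)) *
    refinement h t (z ^ k * y) *
    zsum (fun n => b j (n%:~R / 2 ^+ (t + r)) *
    (z ^ n * sample f 0 (((T j) * n)%:~R / 2 ^+ (2 * r)) (z ^ k * y)))).
    rewrite -(cross_shear_sum f_Cc f_refinable t r k (T j) (a_Cc j) (b_Cc j) (aA j) z0 y0) -zsumZ.
    by apply: eq_zsum => n; rewrite -zsumZ.
  have bA i : bsupp2 (FA i).
    have [W WP] := shear_bsupp2 ((K i)%:~R / 2 ^+ r) (t + r) t (u_Cc i) (v_Cc i).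
    by exists W => n m /WP e; rewrite /FA e mul0r mulr0.
  have bB j : bsupp2 (FB j).
    have [W WP] := shear_bsupp2 ((T j)%:~R / 2 ^+ r) t (t + r) (a_Cc j) (b_Cc j).
    by exists W => n m; rewrite orbC => /WP e; rewrite /FB e mul0r mulr0.
  pose F (i : I + J) := match i with inl i => FA i | inr j => FB j end.
  have : zsum (fun n2 => zsum (fun n1 =>
      \sum_(i <- [seq inl i | i <- sA] ++ [seq inr j | j <- sB]) F i n2 n1)) = 0.
    rewrite -[RHS](mul0r (zsum (fun=> 0))) -zsumZ; apply: eq_zsum => n2.
    rewrite mul0r -[RHS](mul0r (zsum (fun=> 0))) -zsumZ; apply: eq_zsum => n1.
    rewrite mul0r big_cat !big_map /=.
    have /(congr1 ( *%R (z ^ (n1 + k * n2) * y ^ n2))) :=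
      slanted_sum0 (n1%:~R / 2 ^+ (t + r)) (n2%:~R / 2 ^+ t).
    rewrite mulr0 => sum0; apply: etrans sum0; rewrite mulrDr !mulr_sumr.
    by congr (_ + _); apply: eq_bigr => i _; rewrite /FA /FB; ring.
  rewrite zsum2_sum => [|[i|j]]; [|exact: bA|exact: bB].
  rewrite big_cat !big_map /= (bigID (fun i => K i == k)) /= => sum0; apply: etrans sum0.
  rewrite addrA; congr (_ + _ + _); [|by apply: eq_bigr => i _; rewrite FAE
    |by apply: eq_bigr => i _; rewrite FBE].
  rewrite /X mulr_suml; apply: eq_bigr => i /eqP Ki.
  rewrite FAE /t z_pow -/t.
  rewrite Ki subrr expr0z mul1r vV // /y cexpX.
  rewrite (_ : _ * (kap / _) = kap) ?natrX; last by field; exact: exp2_neq0.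
  ring.
pose m := normc X * (normc (sample f 0 0 z) * (c0 / 2)).
have m0 : 0 < m by rewrite !mulr_gt0 ?normc_gt0 // ?divr_gt0.
have sm : small (fun N => \sum_(i <- sA | K i != k)
     cA i * (U i (z ^+ (2 ^ (lev N + r))) * sample f (lev N + r) 0 z *
    sample (v i) (lev N) 0 (z ^ (k - K i) * cexp (kap / 2 ^+ lev N)))).
  by apply: small_sum => i /off_slope_small.
have sm' := small_sum sB (P := xpredT) (fun j _ => cross_small j).
have m3 : 0 < m / 3 by rewrite divr_gt0.
have [N1 N1P] := sm _ m3; have [N2 N2P] := sm' _ m3.
pose N := maxn N1 N2.
have {N1P}h1 := N1P N (leq_maxl _ _); have {N2P}h2 := N2P N (leq_maxr _ _).
have := congr1 (@ComplexField.Normc.normc R) (mainE N); rewrite normcN => e.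
have := normcD (\sum_(i <- sA | K i != k)
     cA i * (U i (z ^+ (2 ^ (lev N + r))) * sample f (lev N + r) 0 z *
    sample (v i) (lev N) 0 (z ^ (k - K i) * cexp (kap / 2 ^+ lev N)))) 
   (\sum_(j <- sB) cB j * (A j ((z ^ k * cexp (kap / 2 ^+ lev N)) ^+ (2 ^ lev N)) *
    refinement h (lev N) (z ^ k * cexp (kap / 2 ^+ lev N)) *
    zsum (fun n => b j (n%:~R / 2 ^+ (lev N + r)) *
    (z ^ n * sample f 0 (((T j) * n)%:~R / 2 ^+ (2 * r))
       (z ^ k * cexp (kap / 2 ^+ lev N)))))).
rewrite -e !normcM sample_z => h3; have {h1 h2}h3 := le_trans h3 (lerD h1 h2).
have h4 : m * size_at N <= normc X * (Lam ^+ (N + r) * normc (sample f 0 0 z) *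
      normc (sample f (lev N) 0 (cexp (kap / 2 ^+ lev N)))).
  rewrite /m /size_at -!mulrA ler_wpM2l ?normc_ge0 // [leRHS]mulrCA.
  rewrite ler_wpM2l ?normc_ge0 //.
  rewrite [leLHS](_ : _ = Lam ^+ (N + r) * (c0 / 2 * 2 ^+ lev N)); last by ring.
  by rewrite ler_wpM2l ?exprn_ge0 // ltW.
have := le_trans h4 h3; rewrite -mulrDl ler_pM2r ?size_gt0 // leNgt => /negP; apply.
exact: third.
Qed.

End AtRoot.
End Relation.

(** * Separation of the slopes *)

Section PrimeRoots.
Context {R : realType}.
Local Notation C := R[i].

Lemma prime_prim_root q (x : C) : prime q -> x ^+ q = 1 -> x != 1 ->
  q.-primitive_root x.
Proof.
move=> qp xq x1; have [m xm mq] := prim_order_exists (prime_gt0 qp) xq.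
have /primeP[_ /(_ m mq)/orP[/eqP m1|/eqP <- //]] := qp.
by have := prim_expr_order xm; rewrite m1 expr1 => /eqP; rewrite (negPf x1).
Qed.

Lemma exists_prim_root q : prime q -> exists z : C, q.-primitive_root z.
Proof.
move=> qp; pose P : {poly C} := \poly_(i < q) 1.
have : size P != 1%N.
  rewrite size_poly_eq ?oner_neq0 //.
  by case: q qp {P} => [|[|q]].
move=> /closed_rootP[z /rootP]; rewrite horner_poly.
under eq_bigr do rewrite mul1r; move=> z0; exists z.
apply: prime_prim_root => //.
  by apply/eqP; rewrite -subr_eq0 subrX1 z0 mulr0.
apply/eqP => z1; move: z0; rewrite z1; under eq_bigr do rewrite expr1n.
rewrite sumr_const card_ord => /eqP; rewrite pnatr_eq0.
by case: q qp {P}.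
Qed.

(** A number is a primitive root of unity of at most one order, so a finite set meets
    finitely many orders. *)
Lemma prim_root_avoids (s : seq C) :
  exists Q, forall q z, (Q <= q)%N -> q.-primitive_root z -> z \notin s.
Proof.
elim: s => [|x s [Q QP]]; first by exists 0%N.
have [[n xn]|nx] := pselect (exists n, n.-primitive_root x).
  exists (maxn Q n.+1) => q z; rewrite geq_max => /andP[Qq nq] zq.
  rewrite inE negb_or (QP q z Qq zq) andbT; apply: contraTneq nq => zx.
  rewrite -leqNgt; apply: dvdn_leq; first exact: prim_order_gt0 xn.
  by rewrite (prim_order_dvd zq) zx prim_expr_order.
exists Q => q z Qq zq; rewrite inE negb_or (QP q z Qq zq) andbT.
by apply/eqP => zx; apply: nx; exists q; rewrite -zx.
Qed.

Lemma prim_exprz_neq1 q (z : C) (D : int) : q.-primitive_root z ->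
  D != 0 -> (`|D| < q)%N -> z ^ D != 1.
Proof.
move=> zq D0 Dq; have nq : z ^+ `|D| != 1.
  rewrite -(prim_order_dvd zq); apply/negP => /dvdn_leq.
  by rewrite absz_gt0 D0 => /(_ isT); rewrite leqNgt Dq.
case: D D0 Dq nq => n _ _; first by rewrite -exprnP.
by rewrite NegzE -exprnN invr_eq1.
Qed.

Lemma max_prim_root q (F : C -> R) : prime q ->
  exists2 z : C, q.-primitive_root z & forall x, q.-primitive_root x -> F x <= F z.
Proof.
move=> qp; have [z0 z0q] := exists_prim_root qp.
have i1 : q.-primitive_root (z0 ^+ Ordinal (prime_gt1 qp)) by rewrite expr1.
have [i iq iP] := @arg_maxP _ R _ (Ordinal (prime_gt1 qp))
  (fun i : 'I_q => q.-primitive_root (z0 ^+ i)) (fun i => F (z0 ^+ i)) i1.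
exists (z0 ^+ i) => // x xq; have [j xj] := prim_rootP z0q (prim_expr_order xq).
by rewrite xj; apply: iP; rewrite -xj.
Qed.

End PrimeRoots.

Section SlantedFree.
Context {R : realType}.
Local Notation C := R[i].
Context (f : R -> C) (hs : seq (C * int)) (c0 : R).
Hypotheses (f_Cc : Cc f) (f_refinable : two_scale hs f f) (c0_gt0 : 0 < c0).
Hypothesis f_mass : forall t, c0 * 2 ^+ t <= normc (sample f t 0 1).
Local Notation h := (mask hs).

Lemma sample0_laurent : laurent (sample f 0 0).
Proof.
have [W WP] := @Cc_bsupp _ f 0 0 (fun=> 1) f_Cc.
have fW (n : int) : (W < `|n|)%N -> f (n%:~R / 2 ^+ 0 + 0) = 0.
  by move=> /WP; rewrite mulr1.
rewrite (_ : sample f 0 0 = fun z => \sum_(n <- zwindow W) f (n%:~R / 2 ^+ 0 + 0) * z ^ n).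
  by apply: laurent_sum => n; apply: laurentM; [exact: laurent_cst|exact: laurent_exprz].
by apply/funext => z; apply: zsumE => n nW; rewrite fW // mul0r.
Qed.

Lemma sample_one_neq0 t : sample f t 0 1 != 0.
Proof. by rewrite -normc_gt0 (lt_le_trans _ (f_mass t)) // mulr_gt0. Qed.

Lemma mask_one_neq0 : h 1 != 0.
Proof.
have := sample_one_neq0 1; rewrite (sample_two_scale 0 0 f_Cc f_refinable (oner_neq0 _)).
by rewrite expr1 mulf_eq0 negb_or => /andP[].
Qed.

(** By [relation_at_root] the sum vanishes for infinitely many z and, for each of them,
    for all w = exp kap with kap small; it is a Laurent function of each variable. *)
Lemma slanted_free (I J : finType) (r : nat) (k : int)
  (cA : I -> C) (K : I -> int) (u v : I -> R -> C) (U V : I -> C -> C)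
  (cB : J -> C) (T : J -> int) (a b : J -> R -> C) (A : J -> C -> C) :
  (forall i, Cc (u i)) -> (forall i, Cc (v i)) ->
  (forall i, has_symbol f (u i) (U i)) -> (forall i, has_symbol f (v i) (V i)) ->
  (forall i, laurent (U i)) -> (forall i, laurent (V i)) ->
  (forall j, Cc (a j)) -> (forall j, Cc (b j)) ->
  (forall j, has_symbol f (a j) (A j)) ->
  (forall x1 x2 : R,
    \sum_i cA i * (u i (x1 + (K i)%:~R / 2 ^+ r * x2) * v i x2) +
    \sum_j cB j * (a j (x2 + (T j)%:~R / 2 ^+ r * x1) * b j x1) = 0) ->
  k != 0 -> (forall j, k * T j != (2 ^ (2 * r))%N%:Z) ->
  forall z w, z != 0 -> w != 0 -> \sum_(i | K i == k) cA i * (U i z * V i w) = 0.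
Proof.
move=> nu nv uU vV lU lV na nb aA sum0 k0 kT.
have [k1 k10 k1P] := sample_cexp_lower f_Cc c0_gt0 f_mass.
have [sh shP] := laurent_zeros (mask_laurent hs) (oner_neq0 _) mask_one_neq0.
have [sS sSP] := laurent_zeros sample0_laurent (oner_neq0 _) (sample_one_neq0 0).
have atroot (s : seq C) : exists z, [/\ z != 0, z \notin s &
    forall kap, 0 <= kap -> kap <= k1 ->
    \sum_(i | K i == k) cA i * (U i z * V i (cexp kap)) = 0].
  have [Q QP] := prim_root_avoids (s ++ sh ++ sS).
  (* A prime q beyond all these integers divides none of the nonzero exponents
     involved. *)
  pose D := (\max_i `|(k - K i)%R| + \max_j `|((2 ^ (2 * r))%N%:Z - k * T j)%R| + `|k| + 3 + Q)%N.
  have [q Dq qp] := prime_above D.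
  have qodd : odd q by case/even_prime: (qp) => // q2; move: Dq; rewrite q2 /D; lia.
  have Qq : (Q <= q)%N by move: Dq; rewrite /D; lia.
  have [z zq zmax] := max_prim_root (fun x => normc (refinement h q.-1 x)) qp.
  have pn0 (x : C) : q.-primitive_root x -> x != 0.
    by move=> xq; rewrite -normc_gt0 (normc_prim xq) ltr01.
  have := QP q z Qq zq; rewrite !mem_cat !negb_or => /and3P[zs _ zS].
  exists z; split=> //; first exact: pn0.
  move=> kap kap0 kap1.
  apply: (relation_at_root f_Cc f_refinable c0_gt0 f_mass nu nv uU vV na nb aA sum0
    qp qodd zq _ _ zmax _ _ _ kap0) => [x xq|||i Kk|j|t].
  - apply/eqP => hx; have := QP q x Qq xq; rewrite !mem_cat !negb_or => /and3P[_ /negP + _].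
    by apply; apply: shP => //; apply: pn0.
  - by apply/eqP => Sz; case/negP: zS; apply: sSP => //; apply: pn0.
  - apply: prime_prim_root => //.
      by rewrite exprnP exprzAC -exprnP prim_expr_order // exp1rz.
    by apply: prim_exprz_neq1 zq _ _ => //; move: Dq; rewrite /D; lia.
  - apply: prim_exprz_neq1 zq _ _; first by rewrite subr_eq0 eq_sym.
    have := @leq_bigmax _ (fun i => `|(k - K i)%R|%N) i; move: Dq; rewrite /D; lia.
  - apply: prim_exprz_neq1 zq _ _; first by rewrite subr_eq0 eq_sym.
    have := @leq_bigmax _ (fun j => `|((2 ^ (2 * r))%N%:Z - k * T j)%R|%N) j; move: Dq; rewrite /D; lia.
  - exact: k1P.
have lz w : laurent (fun z => \sum_(i | K i == k) cA i * (U i z * V i w)).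
  apply: laurent_sum => i; apply: laurentM; first exact: laurent_cst.
  by apply: laurentM => //; exact: laurent_cst.
have lw z : laurent (fun w => \sum_(i | K i == k) cA i * (U i z * V i w)).
  apply: laurent_sum => i; apply: laurentM; first exact: laurent_cst.
  by apply: laurentM => //; exact: laurent_cst.
have zkap kap z : 0 <= kap -> kap <= k1 -> z != 0 ->
    \sum_(i | K i == k) cA i * (U i z * V i (cexp kap)) = 0.
  move=> kap0 kap1; apply: (laurent_eq0 (lz _)) => s.
  by have [y [y0 ys yP]] := atroot s; exists y; split=> //; apply: yP.
move=> z w z0; apply: (laurent_eq0 (lw z)) => s.
(* More values exp kap with 0 < kap <= k1 than elements of s. *)
pose t := [seq cexp (k1 / n.+1%:R) | n <- iota 0 (size s).+1].
have ut : uniq t.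
  rewrite map_inj_uniq ?iota_uniq // => i j /complexI/expR_inj/(mulfI (lt0r_neq0 k10)).
  by move/invr_inj/eqP; rewrite eqr_nat => /eqP[].
have /allPn[x /mapP[n _ ->] xs] : ~~ all (mem s) t.
  apply/negP => /allP ts; have := uniq_leq_size ut ts.
  by rewrite size_map size_iota ltnn.
exists (cexp (k1 / n.+1%:R)); split=> //; first exact: cexp_neq0.
apply: zkap => //; first by rewrite divr_ge0 // ltW.
by rewrite ler_pdivrMr // ler_peMr ?ler1n // ltW.
Qed.

End SlantedFree.

(** * Pointwise independence of shearlets with integer lattices *)

Section Monomials2.
Context (C : numClosedFieldType).

Lemma laurent_monomials2_free (I : eqType) (s : seq I) (P : pred I)
    (a b : I -> int) (c : I -> C) :
  uniq s ->
  (forall z w, z != 0 -> w != 0 ->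
     \sum_(i <- s | P i) c i * (z ^ a i * w ^ b i) = 0) ->
  forall i0, i0 \in s -> P i0 ->
  (forall i, i \in s -> P i -> a i = a i0 -> b i = b i0 -> i = i0) ->
  c i0 = 0.
Proof.
move=> us sum0 i0 si0 Pi0 inj.
have h1 w : w != 0 -> \sum_(i <- s | P i && (a i == a i0)) c i * w ^ b i = 0.
  move=> w0; apply: (@laurent_monomials_free _ _ s P a (fun i => c i * w ^ b i)) => z z0.
  by apply: etrans (sum0 z w z0 w0); apply: eq_bigr => i _; rewrite mulrAC mulrA.
have := @laurent_monomials_free _ _ s (fun i => P i && (a i == a i0)) b c h1 (b i0).
rewrite -big_filter (bigD1_seq i0) ?mem_filter ?filter_uniq ?Pi0 ?eqxx //=.
rewrite big1_seq ?addr0 // => i /andP[ii0].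
rewrite mem_filter => /andP[/andP[/andP[Pi /eqP ai] /eqP bi] si].
by case/eqP: ii0; apply: inj.
Qed.

Lemma sum_by_level (I : eqType) (s : seq I) (P : pred I) (lvl : I -> nat) L
    (F : I -> nat -> C) :
  (forall i, i \in s -> P i -> (lvl i < L)%N) ->
  \sum_(i <- s | P i) F i (lvl i) =
  \sum_(j < L) \sum_(i <- s | P i && (lvl i == j)) F i j.
Proof.
move=> lP; rewrite (exchange_big_dep P) /=; last by move=> j i _ /andP[].
rewrite big_seq_cond [RHS]big_seq_cond; apply: eq_bigr => i /andP[si Pi].
rewrite (big_pred1 (Ordinal (lP i si Pi))) // => j.
by rewrite Pi /= eq_sym -val_eqE.
Qed.

End Monomials2.

Section Core.
Context {R : realType}.
Local Notation C := R[i].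
Context (f p : R -> C) (hs gs : seq (C * int)) (c0 : R) (A1 A2 : int).
Hypotheses (f_Cc : Cc f) (p_Cc : Cc p).
Hypotheses (f_refinable : two_scale hs f f) (p_detail : two_scale gs p f).
Hypothesis c0_gt0 : 0 < c0.
Hypothesis f_mass : forall t, c0 * 2 ^+ t <= normc (sample f t 0 1).
Hypothesis hg_det : mask hs 1 * mask gs (-1) - mask hs (-1) * mask gs 1 != 0.
Hypotheses (A1_neq0 : A1 != 0) (A2_neq0 : A2 != 0).
Local Notation h := (mask hs).
Local Notation g := (mask gs).
Local Notation param := shearlet_parameter.

(** Shearlets built from f and p, without the normalising powers of 2, with the
    integral lattice constants A1 and A2. *)
Definition shearlet_atom (i : param) (x : R * R) : C :=
  match i with
  | inl (inl m) => f (x.1 - (A1 * m.1)%:~R) * f (x.2 - (A1 * m.2)%:~R)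
  | inl (inr (j, k, m)) =>
      p (2 ^+ j * x.1 + k%:~R * (2 ^+ j./2 * x.2) - (A1 * m.1)%:~R) *
      f (2 ^+ j./2 * x.2 - (A2 * m.2)%:~R)
  | inr (j, k, m) =>
      p (k%:~R * (2 ^+ j./2 * x.1) + 2 ^+ j * x.2 - (A1 * m.2)%:~R) *
      f (2 ^+ j./2 * x.1 - (A2 * m.1)%:~R)
  end.

Definition level (i : param) : nat :=
  match i with inl (inl _) => 0%N | inl (inr (j, _, _)) => j | inr (j, _, _) => j end.

Definition kind (i : param) : nat :=
  match i with inl (inl _) => 0%N | inl (inr _) => 1%N | inr _ => 2%N end.

Definition shift1 (i : param) : int :=
  match i with
  | inl (inl m) => A1 * m.1 | inl (inr (_, _, m)) => A1 * m.1
  | inr (_, _, m) => A2 * m.1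
  end.

Definition shift2 (i : param) : int :=
  match i with
  | inl (inl m) => A1 * m.2 | inl (inr (_, _, m)) => A2 * m.2
  | inr (_, _, m) => A1 * m.2
  end.

Section Level.
Context (L : nat).

(** The plane is dilated by 2^L, with L beyond all levels: slopes become fractions of
    denominator 2^L, and [slope] is the numerator. *)
Definition slope (i : param) : int :=
  match i with
  | inl (inl _) => 0
  | inl (inr (j, k, _)) => k * (2 ^ (L - j + j./2))%N%:Z
  | inr (j, k, _) => k * (2 ^ (L - j + j./2))%N%:Z
  end.

Definition scaled (e : R -> C) n (m : int) (x : R) := e (x / 2 ^+ n - m%:~R).

Definition factor1 (i : param) : R -> C :=
  match i with
  | inl (inl _) => scaled f L (shift1 i)
  | inl (inr (j, _, _)) => scaled p (L - j) (shift1 i)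
  | inr (j, _, _) => scaled f (L - j./2) (shift1 i)
  end.

Definition factor2 (i : param) : R -> C :=
  match i with
  | inl (inl _) => scaled f L (shift2 i)
  | inl (inr (j, _, _)) => scaled f (L - j./2) (shift2 i)
  | inr (j, _, _) => scaled p (L - j) (shift2 i)
  end.

Definition symbol1 (i : param) (z : C) : C :=
  match i with
  | inl (inl _) => (z ^+ (2 ^ L)) ^ shift1 i * refinement h L z
  | inl (inr (j, _, _)) => (z ^+ (2 ^ (L - j))) ^ shift1 i * detail h g (L - j) z
  | inr (j, _, _) => (z ^+ (2 ^ (L - j./2))) ^ shift1 i * refinement h (L - j./2) z
  end.

Definition symbol2 (i : param) (z : C) : C :=
  match i with
  | inl (inl _) => (z ^+ (2 ^ L)) ^ shift2 i * refinement h L z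
  | inl (inr (j, _, _)) => (z ^+ (2 ^ (L - j./2))) ^ shift2 i * refinement h (L - j./2) z
  | inr (j, _, _) => (z ^+ (2 ^ (L - j))) ^ shift2 i * detail h g (L - j) z
  end.

Lemma Cc_scaled e n m : Cc e -> Cc (scaled e n m).
Proof.
move=> ne; have : Cc (fun x => e ((2 ^+ n)^-1 * x + (- m%:~R))).
  by apply: Cc_affine => //; rewrite invr_eq0 exp2_neq0.
by rewrite /scaled; under [X in Cc X -> _]eq_fun do rewrite mulrC.
Qed.

Lemma factor1_Cc i : Cc (factor1 i).
Proof. by case: i => [[m|[[j k] m]]|[[j k] m]]; apply: Cc_scaled. Qed.

Lemma factor2_Cc i : Cc (factor2 i).
Proof. by case: i => [[m|[[j k] m]]|[[j k] m]]; apply: Cc_scaled. Qed.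

Lemma detail_has_symbol j m : (j < L)%N ->
  has_symbol f (scaled p (L - j) m)
    (fun z => (z ^+ (2 ^ (L - j))) ^ m * detail h g (L - j) z).
Proof.
by move=> jL; rewrite -(subnSK jL); apply: has_symbol_detail.
Qed.

Lemma factor1_has_symbol i : (level i < L)%N -> has_symbol f (factor1 i) (symbol1 i).
Proof.
case: i => [[m|[[j k] m]]|[[j k] m]] jL; [exact: has_symbol_refinement
  |exact: detail_has_symbol|exact: has_symbol_refinement].
Qed.

Lemma factor2_has_symbol i : (level i < L)%N -> has_symbol f (factor2 i) (symbol2 i).
Proof.
case: i => [[m|[[j k] m]]|[[j k] m]] jL; [exact: has_symbol_refinement
  |exact: has_symbol_refinement|exact: detail_has_symbol].
Qed.

Lemma monomial_laurent n (m : int) : laurent (fun z : C => (z ^+ n) ^ m).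
Proof. exact: laurent_expr (laurent_exprz _ m). Qed.

Lemma symbol1_laurent i : laurent (symbol1 i).
Proof.
case: i => [[m|[[j k] m]]|[[j k] m]]; apply: laurentM; try exact: monomial_laurent;
  try apply: refinement_laurent; try apply: detail_laurent; exact: mask_laurent.
Qed.

Lemma symbol2_laurent i : laurent (symbol2 i).
Proof.
case: i => [[m|[[j k] m]]|[[j k] m]]; apply: laurentM; try exact: monomial_laurent;
  try apply: refinement_laurent; try apply: detail_laurent; exact: mask_laurent.
Qed.

Lemma atom_inl i x1 x2 : (level i < L)%N -> (kind i != 2)%N ->
  shearlet_atom i (x1 / 2 ^+ L, x2 / 2 ^+ L) =
  factor1 i (x1 + (slope i)%:~R / 2 ^+ L * x2) * factor2 i x2.
Proof.
case: i => [[m|[[j k] m]]|//] /= jL _; rewrite /scaled.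
  by rewrite mul0r mul0r addr0.
have [n Ln] : exists n, L = (n + j)%N by exists (L - j)%N; rewrite subnK // ltnW.
have [l' jl] : exists l', j = (l' + j./2)%N.
  by exists (j - j./2)%N; rewrite subnK // -{2}(odd_double_half j); lia.
congr (p (_ - _) * f (_ - _)).
  rewrite Ln addnK intrM -[(2 ^ _)%N%:~R]/((2 ^ _)%N%:R) natrX !exprD.
  by field; rewrite !exp2_neq0.
have e : 2 ^+ j = 2 ^+ l' * 2 ^+ j./2 :> R by rewrite -exprD -jl.
rewrite (_ : L - j./2 = n + l')%N; last by rewrite Ln {1}jl addnA addnK.
by rewrite Ln !exprD e; field; rewrite !exp2_neq0.
Qed.

Lemma atom_inr i x1 x2 : (level i < L)%N -> kind i = 2%N ->
  shearlet_atom i (x1 / 2 ^+ L, x2 / 2 ^+ L) =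
  factor2 i (x2 + (slope i)%:~R / 2 ^+ L * x1) * factor1 i x1.
Proof.
case: i => [[//|[[//]]]|[[j k] m]] /= jL _; rewrite /scaled.
have [n Ln] : exists n, L = (n + j)%N by exists (L - j)%N; rewrite subnK // ltnW.
have [l' jl] : exists l', j = (l' + j./2)%N.
  by exists (j - j./2)%N; rewrite subnK // -{2}(odd_double_half j); lia.
congr (p (_ - _) * f (_ - _)).
  rewrite Ln addnK intrM -[(2 ^ _)%N%:~R]/((2 ^ _)%N%:R) natrX !exprD.
  by field; rewrite !exp2_neq0.
have e : 2 ^+ j = 2 ^+ l' * 2 ^+ j./2 :> R by rewrite -exprD -jl.
rewrite (_ : L - j./2 = n + l')%N; last by rewrite Ln {1}jl addnA addnK.
by rewrite Ln !exprD e; field; rewrite !exp2_neq0.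
Qed.

(** The inequality is strict in the vertical cone, where |k| is at most
    2^(j/2) - 1; hence no two slopes of the two cones have product 1. *)
Lemma slope_bound i : shearlet_range i -> (level i < L)%N ->
  (`|slope i| <= 2 ^ L)%N /\ (kind i = 2%N -> (`|slope i| < 2 ^ L)%N).
Proof.
have e j : (j < L)%N -> (2 ^ j./2 * 2 ^ (L - j + j./2) <= 2 ^ L)%N.
  move=> jL; rewrite -expnD leq_pexp2l // -[in X in (_ - X)%N](odd_double_half j).
  by have := odd_double_half j; lia.
have e2 j : (2 ^+ j./2 : int) = (2 ^ j./2)%N%:Z by rewrite -natz natrX.
case: i => [[m|[[j k] m]]|[[j k] m]] /=; first by [].
  rewrite e2 => kj jL; split=> //; apply: leq_trans (e j jL).
  by rewrite abszM absz_nat leq_mul2r; lia.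
rewrite e2 => kj jL; have kl : (`|k| < 2 ^ j./2)%N by lia.
have lt : (`|(k * (2 ^ (L - j + j./2))%N%:Z)%R| < 2 ^ L)%N.
  by apply: leq_trans (e j jL); rewrite abszM absz_nat ltn_mul2r expn_gt0 kl.
by split=> [|_]; first apply: ltnW.
Qed.

(** The terms of one slope form an instance of [tensor_details], which separates the
    kinds and levels.  Within one level the slope determines k, so that distinct
    indices give distinct monomials. *)
Lemma same_slope_free (s : seq param) (kap : int) (c : param -> C) :
  uniq s -> (forall i, i \in s -> slope i = kap /\ (level i < L)%N) ->
  (forall z w, z != 0 -> w != 0 ->
    \sum_(i <- s) c i * (symbol1 i z * symbol2 i w) = 0) ->
  forall i, i \in s -> c i = 0.
Proof.
move=> us sP sum0.
pose mon i (z w : C) := c i * (z ^ shift1 i * w ^ shift2 i).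
pose al j z w := \sum_(i <- s | (kind i == 1%N) && (level i == j)) mon i z w.
pose be j z w := \sum_(i <- s | (kind i == 2%N) && (level i == j)) mon i z w.
pose de z w := \sum_(i <- s | kind i == 0%N) mon i z w.
have bl (P : pred param) : bilaurent (fun z w => \sum_(i <- s | P i) mon i z w).
  split=> y; apply: laurent_sum => i; apply: laurentM; try exact: laurent_cst;
  apply: laurentM; first [exact: laurent_cst|exact: laurent_exprz].
have id0 z w : z != 0 -> w != 0 ->
    tensor_details h g half L al be de z w = 0.
  move=> z0 w0; apply: etrans (sum0 z w z0 w0).
  rewrite [RHS](bigID (fun i => kind i == 0%N)) /=.
  rewrite [X in _ = _ + X](bigID (fun i => kind i == 1%N)) /= addrA.
  rewrite /tensor_details; congr (_ + _ + _).
  - rewrite mulr_suml; apply: eq_bigr => i; rewrite /mon.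
    by case: i => [[m|[[j k] m]]|[[j k] m]] //= _; rewrite -mulrA mulrACA.
  - rewrite [RHS](eq_bigl (fun i => kind i == 1%N)); last first.
      by case => [[m|[[j k] m]]|[[j k] m]].
    pose F i j := mon i (z ^+ (2 ^ (L - j))) (w ^+ (2 ^ (L - j./2))) *
       (detail h g (L - j) z * refinement h (L - j./2) w).
    transitivity (\sum_(i <- s | kind i == 1%N) F i (level i)); last first.
      apply: eq_bigr => i; rewrite /F /mon.
      by case: i => [[m|[[j k] m]]|[[j k] m]] //= _; rewrite -mulrA mulrACA.
    rewrite (@sum_by_level _ _ _ _ _ L) => [|i /sP[]//].
    by apply: eq_bigr => j _; rewrite mulr_suml.
  - rewrite [RHS](eq_bigl (fun i => kind i == 2%N)); last first.
      by case => [[m|[[j k] m]]|[[j k] m]].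
    pose F i j := mon i (z ^+ (2 ^ (L - j./2))) (w ^+ (2 ^ (L - j))) *
       (refinement h (L - j./2) z * detail h g (L - j) w).
    transitivity (\sum_(i <- s | kind i == 2%N) F i (level i)); last first.
      apply: eq_bigr => i; rewrite /F /mon.
      by case: i => [[m|[[j k] m]]|[[j k] m]] //= _; rewrite -mulrA mulrACA.
    rewrite (@sum_by_level _ _ _ _ _ L) => [|i /sP[]//].
    by apply: eq_bigr => j _; rewrite mulr_suml.
have half_le j : (half j <= j)%N by rewrite -{2}(odd_double_half j); lia.
have free := tensor_details_free (mask_laurent hs) (mask_laurent gs) hg_det
  half_le (fun j => bl _) (fun j => bl _) (bl _) id0.
move=> i si; have [si1 si2] := sP i si.
pose Q i' := (kind i' == kind i) && (level i' == level i).
apply: (@laurent_monomials2_free _ _ s Q shift1 shift2 c us _ i si).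
- move=> z w z0 w0; have [de0 ab0] := free z w z0 w0.
  have [al0 be0] := ab0 _ si2; move: de0 al0 be0; rewrite /de /al /be /Q /mon.
  case: i {si si1 si2 Q} => [[m|[[j k] m]]|[[j k] m]] //= de0 al0 be0.
  apply: etrans de0; apply: eq_bigl => i'.
  by case: i' => [[m'|[[j' k'] m']]|[[j' k'] m']].
- by rewrite /Q !eqxx.
- move=> i' /sP[]; rewrite -si1 /Q => s1 _.
  case: i i' si1 si2 s1 {si Q} => [[[m1 m2]|[[j k] [m1 m2]]]|[[j k] [m1 m2]]]
    [[[n1 n2]|[[j' k'] [n1 n2]]]|[[j' k'] [n1 n2]]] //= _ _.
  + by move=> _ _ /(mulfI A1_neq0) -> /(mulfI A1_neq0) ->.
  + move=> s1 /eqP jj; move: s1; rewrite jj => /mulIf -> .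
      by move=> /(mulfI A1_neq0) -> /(mulfI A2_neq0) ->.
    by rewrite -natz pnatr_eq0 expn_eq0.
  + move=> s1 /eqP jj; move: s1; rewrite jj => /mulIf -> .
      by move=> /(mulfI A2_neq0) -> /(mulfI A1_neq0) ->.
    by rewrite -natz pnatr_eq0 expn_eq0.
Qed.

Lemma tilted_free (s1 s2 : seq param) (k : int) (c : param -> C)
    (u1 v1 u2 v2 : param -> R -> C) (U V A : param -> C -> C) :
  uniq s1 -> k != 0 ->
  (forall i, Cc (u1 i)) -> (forall i, Cc (v1 i)) ->
  (forall i, Cc (u2 i)) -> (forall i, Cc (v2 i)) ->
  (forall i, i \in s1 -> has_symbol f (u1 i) (U i)) ->
  (forall i, i \in s1 -> has_symbol f (v1 i) (V i)) ->
  (forall i, i \in s2 -> has_symbol f (u2 i) (A i)) ->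
  (forall i, laurent (U i)) -> (forall i, laurent (V i)) ->
  (forall j, j \in s2 -> k * slope j != (2 ^ (2 * L))%N%:Z) ->
  (forall x1 x2,
    \sum_(i <- s1) c i * (u1 i (x1 + (slope i)%:~R / 2 ^+ L * x2) * v1 i x2) +
    \sum_(j <- s2) c j * (u2 j (x2 + (slope j)%:~R / 2 ^+ L * x1) * v2 j x1) = 0) ->
  forall z w, z != 0 -> w != 0 ->
  \sum_(i <- s1 | slope i == k) c i * (U i z * V i w) = 0.
Proof.
move=> us k0 nu1 nv1 nu2 nv2 tu tv tu2 lU lV kT sum0 z w z0 w0.
pose t1 := tnth (in_tuple s1); pose t2 := tnth (in_tuple s2).
have m1 i : t1 i \in s1 by apply: mem_tnth.
have m2 i : t2 i \in s2 by apply: mem_tnth.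
rewrite big_tnth.
apply: (@slanted_free _ f hs c0 f_Cc f_refinable c0_gt0 f_mass _ _ L k
  (c \o t1) (slope \o t1) (u1 \o t1) (v1 \o t1) (U \o t1) (V \o t1)
  (c \o t2) (slope \o t2) (u2 \o t2) (v2 \o t2) (A \o t2)) => //=.
- by move=> i; apply: tu.
- by move=> i; apply: tv.
- by move=> i; apply: tu2.
- move=> x1 x2; apply: etrans (sum0 x1 x2).
  by rewrite [X in _ = X + _]big_tnth [X in _ = _ + X]big_tnth.
- by move=> j; apply: kT.
Qed.

End Level.

(** Without shear, sampling at the integers gives the product of the symbols with
    S_0(z) S_0(w), which is a nonzero Laurent function. *)
Lemma symbol_sum_free (s : seq param) L (c : param -> C) :
  (forall i, i \in s -> (level i < L)%N) ->
  (forall x1 x2, \sum_(i <- s) c i * (factor1 L i x1 * factor2 L i x2) = 0) ->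
  forall z w, z != 0 -> w != 0 ->
  \sum_(i <- s) c i * (symbol1 L i z * symbol2 L i w) = 0.
Proof.
move=> sL sum0.
have S0 := sample_one_neq0 c0_gt0 f_mass 0.
have lz w : laurent (fun z => \sum_(i <- s) c i * (symbol1 L i z * symbol2 L i w)).
  apply: laurent_sum => i; apply: laurentM; first exact: laurent_cst.
  by apply: laurentM; [exact: symbol1_laurent|exact: laurent_cst].
have lw z : laurent (fun w => \sum_(i <- s) c i * (symbol1 L i z * symbol2 L i w)).
  apply: laurent_sum => i; apply: laurentM; first exact: laurent_cst.
  by apply: laurentM; [exact: laurent_cst|exact: symbol2_laurent].
suff main z w : z != 0 -> w != 0 ->
    \sum_(i <- s) c i * (symbol1 L i z * symbol2 L i w) *
      sample f 0 0 w * sample f 0 0 z = 0.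
  move=> z w z0 w0.
  apply: (laurent_mulf_eq0 (lw z) (sample0_laurent f_Cc) (oner_neq0 _) S0) => // {w0}w w0.
  apply: (laurent_mulf_eq0 (laurentM (lz w) (laurent_cst (sample f 0 0 w)))
    (sample0_laurent f_Cc) (oner_neq0 _) S0) => // {z0}z z0.
  by rewrite mulr_suml mulr_suml; apply: main.
move=> z0 w0.
pose F i (n2 n1 : int) := c i * (factor1 L i (n1%:~R / 2 ^+ (0 + 0) + 0%:~R / 2 ^+ 0 * (n2%:~R / 2 ^+ 0)) *
    factor2 L i (n2%:~R / 2 ^+ 0) * (z ^ (n1 + 0 * n2) * w ^ n2)).
have FE i : i \in s -> zsum (fun n2 => zsum (F i n2)) =
    c i * (symbol1 L i z * symbol2 L i w) * sample f 0 0 w * sample f 0 0 z.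
  move=> si; transitivity (c i * (symbol1 L i (z ^+ (2 ^ (0 + 0))) * sample f (0 + 0) 0 z *
    sample (factor2 L i) 0 0 (z ^ (0 - 0) * w))).
    rewrite -(shear_sum 0 0 0 0 (factor1_Cc L i) (factor2_Cc L i)
      (factor1_has_symbol (sL i si)) z0 w0) -zsumZ.
    by apply: eq_zsum => n; rewrite -zsumZ.
  rewrite subrr expr0z mul1r (factor2_has_symbol (sL i si)) // !expr1; ring.
have bF i : bsupp2 (F i).
  have [W WP] := shear_bsupp2 (0%:~R / 2 ^+ 0) 0 0 (factor1_Cc L i) (factor2_Cc L i).
  by exists W => n m /WP e; rewrite /F e mul0r mulr0.
have := zsum2_sum s xpredT bF.
have -> : zsum (fun n => zsum (fun m => \sum_(i <- s) F i n m)) = 0.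
  rewrite -[RHS](mul0r (zsum (fun=> 0))) -zsumZ; apply: eq_zsum => n2.
  rewrite mul0r -[RHS](mul0r (zsum (fun=> 0))) -zsumZ; apply: eq_zsum => n1.
  rewrite mul0r; have /(congr1 ( *%R (z ^ (n1 + 0 * n2) * w ^ n2))) :=
      sum0 (n1%:~R / 2 ^+ (0 + 0)) (n2%:~R / 2 ^+ 0).
  rewrite mulr0 => sum1; apply: etrans sum1; rewrite mulr_sumr.
  by apply: eq_bigr => i _; rewrite /F mul0r mul0r addr0; ring.
move=> /esym e; apply: etrans e; rewrite big_seq_cond [RHS]big_seq_cond.
by apply: eq_bigr => i /andP[si _]; rewrite FE.
Qed.

(** Coefficients of nonzero slope are removed first, in both cones; the rest is
    unsheared. *)
Theorem shearlet_atoms_free (J : {fset param}) (c : param -> C) :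
  (forall i, i \in J -> shearlet_range i) ->
  (forall x, \sum_(i <- J) c i * shearlet_atom i x = 0) ->
  forall i, i \in J -> c i = 0.
Proof.
move=> Jr sum0.
pose L := (\max_(i <- J) level i).+1.
have JL i : i \in J -> (level i < L)%N by move=> iJ; rewrite ltnS leq_bigmax_seq.
pose s1 := [seq i <- J | kind i != 2%N]; pose s2 := [seq i <- J | kind i == 2%N].
have u1 : uniq s1 by rewrite filter_uniq.
have u2 : uniq s2 by rewrite filter_uniq.
have s1P i : i \in s1 -> i \in J /\ kind i != 2%N by rewrite mem_filter => /andP[].
have s2P i : i \in s2 -> i \in J /\ kind i = 2%N.
  by rewrite mem_filter => /andP[/eqP].
have split0 x1 x2 :
    \sum_(i <- s1) c i * (factor1 L i (x1 + (slope L i)%:~R / 2 ^+ L * x2) * factor2 L i x2) +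
    \sum_(j <- s2) c j * (factor2 L j (x2 + (slope L j)%:~R / 2 ^+ L * x1) * factor1 L j x1) = 0.
  apply: etrans (sum0 (x1 / 2 ^+ L, x2 / 2 ^+ L)).
  rewrite [RHS](bigID (fun i => kind i != 2%N)) /= /s1 /s2 !big_filter; congr (_ + _).
    rewrite big_seq_cond [RHS]big_seq_cond; apply: eq_bigr => i /andP[/JL iL ik].
    by rewrite atom_inl.
  rewrite big_seq_cond [RHS]big_seq_cond; apply: eq_big => [i|i /andP[/JL iL /eqP ik]].
    by rewrite negbK.
  by rewrite (atom_inr _ _ iL).
have kTneq i j : i \in s1 -> j \in s2 -> slope L i * slope L j != (2 ^ (2 * L))%N%:Z.
  move=> /s1P[iJ _] /s2P[jJ jk].
  have [iB _] := slope_bound (Jr i iJ) (JL i iJ).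
  have [_ /(_ jk) jB] := slope_bound (Jr j jJ) (JL j jJ).
  apply/eqP => /(congr1 absz); rewrite abszM absz_nat mul2n -addnn expnD => e.
  have : (`|slope L i| * `|slope L j| < 2 ^ L * 2 ^ L)%N.
    by apply: leq_ltn_trans (leq_mul iB (leqnn _)) _; rewrite ltn_mul2l expn_gt0.
  by rewrite e ltnn.
have tilt1 i0 : i0 \in s1 -> slope L i0 != 0 -> c i0 = 0.
  move=> si0 k0.
  apply: (@same_slope_free L [seq i <- s1 | slope L i == slope L i0] (slope L i0)).
  - by rewrite filter_uniq.
  - by move=> i; rewrite mem_filter => /andP[/eqP-> /s1P[/JL]].
  - move=> z w z0 w0; rewrite big_filter.
    apply: (@tilted_free L s1 s2 (slope L i0) c (factor1 L) (factor2 L)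
      (factor2 L) (factor1 L) (symbol1 L) (symbol2 L) (symbol2 L)) => //.
    + exact: factor1_Cc.
    + exact: factor2_Cc.
    + exact: factor2_Cc.
    + exact: factor1_Cc.
    + by move=> i /s1P[/JL iL _]; apply: factor1_has_symbol.
    + by move=> i /s1P[/JL iL _]; apply: factor2_has_symbol.
    + by move=> i /s2P[/JL iL _]; apply: factor2_has_symbol.
    + exact: symbol1_laurent.
    + exact: symbol2_laurent.
    + by move=> j sj; apply: kTneq.
  - by rewrite mem_filter eqxx.
have tilt2 i0 : i0 \in s2 -> slope L i0 != 0 -> c i0 = 0.
  move=> si0 k0.
  apply: (@same_slope_free L [seq i <- s2 | slope L i == slope L i0] (slope L i0)).
  - by rewrite filter_uniq.
  - by move=> i; rewrite mem_filter => /andP[/eqP-> /s2P[/JL]].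
  - move=> z w z0 w0; rewrite big_filter.
    transitivity (\sum_(i <- s2 | slope L i == slope L i0) c i * (symbol2 L i w * symbol1 L i z)).
      by apply: eq_bigr => i _; rewrite [X in _ * X]mulrC.
    apply: (@tilted_free L s2 s1 (slope L i0) c (factor2 L) (factor1 L)
      (factor1 L) (factor2 L) (symbol2 L) (symbol1 L) (symbol1 L)) => //.
    + exact: factor2_Cc.
    + exact: factor1_Cc.
    + exact: factor1_Cc.
    + exact: factor2_Cc.
    + by move=> i /s2P[/JL iL _]; apply: factor2_has_symbol.
    + by move=> i /s2P[/JL iL _]; apply: factor1_has_symbol.
    + by move=> i /s1P[/JL iL _]; apply: factor1_has_symbol.
    + exact: symbol2_laurent.
    + exact: symbol1_laurent.
    + by move=> j sj; rewrite mulrC; apply: kTneq.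
    + by move=> x1 x2; rewrite addrC; apply: split0.
  - by rewrite mem_filter eqxx.
have tilt i : i \in J -> slope L i != 0 -> c i = 0.
  move=> iJ; have [ik|ik] := eqVneq (kind i) 2%N.
    by apply: tilt2; rewrite mem_filter ik iJ.
  by apply: tilt1; rewrite mem_filter ik iJ.
move=> i iJ; have [k0|k0] := eqVneq (slope L i) 0; last exact: tilt.
pose s0 := [seq i <- J | slope L i == 0].
apply: (@same_slope_free L s0 0); rewrite ?filter_uniq //; last first.
- by rewrite mem_filter k0 eqxx.
- apply: symbol_sum_free => [i'|x1 x2]; first by rewrite mem_filter => /andP[_ /JL].
  apply: etrans (sum0 (x1 / 2 ^+ L, x2 / 2 ^+ L)).
  rewrite big_filter [RHS](bigID (fun i => slope L i == 0)) /= [X in _ + X]big1_seq ?addr0.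
    rewrite big_seq_cond [RHS]big_seq_cond; apply: eq_bigr => i' /andP[/JL iL /eqP ik].
    have [k2|k2] := eqVneq (kind i') 2%N.
      by rewrite atom_inr // ik mul0r mul0r addr0 [X in _ * X = _]mulrC.
    by rewrite atom_inl // ik mul0r mul0r addr0.
  by move=> i' /andP[ik iJ']; rewrite tilt ?mul0r.
- by move=> i'; rewrite mem_filter => /andP[/eqP -> /JL].
Qed.

End Core.

(** * Orthogonality in complex L2 spaces *)

Local Open Scope classical_set_scope.
Local Open Scope ring_scope.
Local Open Scope complex_scope.

Local Notation Re := complex.Re.
Local Notation Im := complex.Im.

Section L2Theory.
Context d (T : measurableType d) (R : realType) (mu : {measure set T -> \bar R}).
Local Notation C := R[i].
Implicit Types f g : T -> C.

Definition normsq (z : C) : R := Re z ^+ 2 + Im z ^+ 2.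
(** The squared norm as a real number. *)
Definition L2mass f : R := \int[mu]_x normsq (f x).

Lemma normsq_ge0 z : 0 <= normsq z.
Proof. by rewrite addr_ge0 ?sqr_ge0. Qed.

Lemma normsqE z : normsq z = normc z ^+ 2.
Proof. by case: z => a b; rewrite /normsq /= sqr_sqrtr // addr_ge0 ?sqr_ge0. Qed.

Lemma L2norm_pow2 f : (L2norm mu f `^ 2 = \int[mu]_x (normsq (f x))%:E)%E.
Proof.
rewrite /L2norm poweR_Lnorm ?pnatr_eq0 //; apply: eq_integral => x _.
by rewrite abse_EFin poweR_EFin powR_mulrn // normsqE real_normK ?num_real // normsqE.
Qed.

Lemma L2P f : L2 mu f <-> [/\ measurable_fun setT (fun x => Re (f x)),
  measurable_fun setT (fun x => Im (f x)) &
  mu.-integrable setT (EFin \o (fun x => normsq (f x)))].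
Proof.
have mI : measurable_fun setT (fun x => Re (f x)) ->
    measurable_fun setT (fun x => Im (f x)) ->
    measurable_fun setT (fun x => normsq (f x)).
  by move=> m1 m2; apply: measurable_funD; apply: measurable_funX.
have iE : (\int[mu]_x `|(EFin \o (fun x => normsq (f x))) x| =
    \int[mu]_x (normsq (f x))%:E)%E.
  by apply: eq_integral => x _; rewrite /= ger0_norm // normsq_ge0.
split=> [[m1 [m2 n]]|[m1 m2 /integrableP[_ n]]]; split=> //.
  by apply/integrableP; split; [by apply/measurable_EFinP; exact: mI|rewrite iE -L2norm_pow2; exact: poweR_lty].
split=> //; move: n; rewrite iE -L2norm_pow2; apply: lty_poweRy.
by rewrite pnatr_eq0.
Qed.

Lemma L2norm_lt_mass f (eps : R) : L2 mu f -> 0 < eps ->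
  (L2norm mu f < eps%:E)%E -> L2mass f < eps ^+ 2.
Proof.
move=> Lf e0; have [_ _ iF] := (L2P f).1 Lf.
have : (0 <= L2norm mu f)%E by apply: Lnorm_ge0.
move: (L2norm_pow2 f); rewrite -[(\int[mu]_x (normsq (f x))%:E)%E]fineK; last first.
  exact: (integrable_fin_num measurableT iF).
rewrite /L2mass /Rintegral; case: (L2norm mu f) => [r| |]; [|by move=> _ _; rewrite ltNge leey|by rewrite leeNy_eq].
rewrite poweR_EFin => -[<-]; rewrite lee_fin lte_fin => r0 re.
by rewrite powR_mulrn // ltrXn2r // ?nnegrE // ltW.
Qed.

Lemma L2norm_mass_lt f (eps : R) : L2 mu f -> 0 < eps ->
  L2mass f = 0 -> (L2norm mu f < eps%:E)%E.
Proof.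
move=> Lf e0 f0; have [_ _ iF] := (L2P f).1 Lf.
suff -> : (L2norm mu f = 0)%E by rewrite lte_fin.
have : (L2norm mu f `^ 2 = 0)%E.
  rewrite L2norm_pow2 -[(\int[mu]_x (normsq (f x))%:E)%E]fineK; last first.
    exact: (integrable_fin_num measurableT iF).
  by rewrite -[fine _]/(L2mass f) f0.
by apply: poweR_eq0_eq0; apply: Lnorm_ge0.
Qed.

Lemma L2mass_eq0 f : L2 mu f -> L2mass f = 0 -> eq0_L2 mu f.
Proof.
move=> Lf f0; have [m1 m2 iF] := (L2P f).1 Lf.
have /integrableP[mF _] := iF.
have : (\int[mu]_x `|(EFin \o (fun x => normsq (f x))) x| = 0)%E.
  transitivity (\int[mu]_x (normsq (f x))%:E)%E.
    by apply: eq_integral => x _; rewrite /= ger0_norm // normsq_ge0.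
  rewrite -[LHS]fineK; first by rewrite -[fine _]/(L2mass f) f0.
  exact: (integrable_fin_num measurableT iF).
move/(ae_eq_integral_abs mu measurableT mF); apply: filterS => x /= /(_ I) [].
by rewrite normsqE => /eqP; rewrite expf_eq0 /= normc_eq0 => /eqP.
Qed.

Lemma L2_inner_integrable f g : L2 mu f -> L2 mu g ->
  mu.-integrable setT (EFin \o (fun x => Re (f x * (g x)^*))) /\
  mu.-integrable setT (EFin \o (fun x => Im (f x * (g x)^*))).
Proof.
move=> /L2P[mf1 mf2 iF] /L2P[mg1 mg2 iG].
have iFG := integrableD measurableT iF iG.
have bnd (a b c e : R) : `|a * c - b * - e| <= `|(a ^+ 2 + b ^+ 2) + (c ^+ 2 + e ^+ 2)| /\
    `|a * - e + b * c| <= `|(a ^+ 2 + b ^+ 2) + (c ^+ 2 + e ^+ 2)|.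
  have h0 : 0 <= (a ^+ 2 + b ^+ 2) + (c ^+ 2 + e ^+ 2) by rewrite !addr_ge0 ?sqr_ge0.
  rewrite (ger0_norm h0) !ler_norml.
  have := sqr_ge0 (a + c); have := sqr_ge0 (a - c); have := sqr_ge0 (b + e).
  have := sqr_ge0 (b - e); have := sqr_ge0 (a + e); have := sqr_ge0 (a - e).
  have := sqr_ge0 (b + c); have := sqr_ge0 (b - c).
  rewrite !expr2; move=> *; split; apply/andP; split; lra.
split; apply: (le_integrable measurableT _ _ iFG).
- apply/measurable_EFinP; rewrite (_ : (fun x => _) =
    (fun x => Re (f x) * Re (g x) - Im (f x) * - Im (g x))); last first.
    by apply/funext => x; case: (f x) (g x) => [a b] [c e].
  apply: measurable_funB; first exact: measurable_funM.
  by apply: measurable_funM => //; apply: measurableT_comp.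
- move=> x _ /=; rewrite lee_fin /normsq.
  by case: (f x) (g x) => [a b] [c e]; have [] := bnd a b c e.
- apply/measurable_EFinP; rewrite (_ : (fun x => _) =
    (fun x => Re (f x) * - Im (g x) + Im (f x) * Re (g x))); last first.
    by apply/funext => x; case: (f x) (g x) => [a b] [c e].
  apply: measurable_funD; last exact: measurable_funM.
  by apply: measurable_funM => //; apply: measurableT_comp.
- move=> x _ /=; rewrite lee_fin /normsq.
  by case: (f x) (g x) => [a b] [c e]; have [] := bnd a b c e.
Qed.

Lemma L2_lin a f g : L2 mu f -> L2 mu g -> L2 mu (fun x => a * f x + g x).
Proof.
move=> /L2P[mf1 mf2 iF] /L2P[mg1 mg2 iG].
have m1 : measurable_fun setT (fun x => Re (a * f x + g x)).
  rewrite (_ : (fun x => _) = (fun x => (Re a * Re (f x) - Im a * Im (f x)) + Re (g x))).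
    by apply: measurable_funD => //; apply: measurable_funB; apply: measurable_funM.
  by apply/funext => x; move: (f x) (g x) => [? ?] [? ?]; case: (a).
have m2 : measurable_fun setT (fun x => Im (a * f x + g x)).
  rewrite (_ : (fun x => _) = (fun x => (Re a * Im (f x) + Im a * Re (f x)) + Im (g x))).
    by apply: measurable_funD => //; apply: measurable_funD; apply: measurable_funM.
  by apply/funext => x; move: (f x) (g x) => [? ?] [? ?]; case: (a).
apply/L2P; split=> //.
have iFG := integrableD measurableT (integrableZl measurableT (2 * normsq a) iF)
  (integrableZl measurableT 2 iG).
apply: (le_integrable measurableT _ _ iFG).
  by apply/measurable_EFinP; apply: measurable_funD; apply: measurable_funX.
move=> x _ /=; rewrite lee_fin (ger0_norm (normsq_ge0 _)) ger0_norm; last first.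
  by apply: addr_ge0; apply: mulr_ge0 => //; try apply: mulr_ge0 => //; apply: normsq_ge0.
rewrite /normsq; move: (f x) (g x) => [c e] [u v]; case: (a) => p q /=.
rewrite -subr_ge0 [leRHS](_ : _ = (p * c - q * e - u) ^+ 2 + (p * e + q * c - v) ^+ 2).
  by rewrite addr_ge0 ?sqr_ge0.
ring.
Qed.

Lemma L2_0 : L2 mu (fun=> 0).
Proof.
apply/L2P; split=> //; rewrite (_ : _ \o _ = cst 0%E); first exact: integrable0.
by apply/funext => x /=; rewrite /normsq expr0n addr0.
Qed.

Lemma L2_sum (I : Type) (s : seq I) (c : I -> C) (e : I -> T -> C) :
  (forall i, L2 mu (e i)) -> L2 mu (fun x => \sum_(i <- s) c i * e i x).
Proof.
move=> Le; elim: s => [|i s IH].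
  by under eq_fun do rewrite big_nil; exact: L2_0.
by under eq_fun do rewrite big_cons; apply: L2_lin.
Qed.

Lemma L2inner_lin a f1 f2 g : L2 mu f1 -> L2 mu f2 -> L2 mu g ->
  L2inner mu (fun x => a * f1 x + f2 x) g = a * L2inner mu f1 g + L2inner mu f2 g.
Proof.
move=> L1 L2 Lg; have [i1 i1'] := L2_inner_integrable L1 Lg.
have [i2 i2'] := L2_inner_integrable L2 Lg.
have iZ (k : R) u : mu.-integrable setT (EFin \o u) ->
    mu.-integrable setT (EFin \o (fun x => k * u x)).
  by move=> iu; apply: (integrableZl measurableT k iu).
have e1 : \int[mu]_x Re ((a * f1 x + f2 x) * (g x)^*) =
    Re a * \int[mu]_x Re (f1 x * (g x)^*) - Im a * \int[mu]_x Im (f1 x * (g x)^*)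
    + \int[mu]_x Re (f2 x * (g x)^*).
  rewrite -!RintegralZl // -RintegralB ?iZ // -RintegralD //; last first.
    have := integrableB measurableT (iZ (Re a) _ i1) (iZ (Im a) _ i1').
    by apply: eq_integrable => // x _.
  apply: eq_Rintegral => x _; move: (f1 x) (f2 x) (g x) => [? ?] [? ?] [? ?]; case: (a) => ? ? /=.
  by ring.
have e2 : \int[mu]_x Im ((a * f1 x + f2 x) * (g x)^*) =
    Re a * \int[mu]_x Im (f1 x * (g x)^*) + Im a * \int[mu]_x Re (f1 x * (g x)^*)
    + \int[mu]_x Im (f2 x * (g x)^*).
  rewrite -!RintegralZl // -RintegralD ?iZ // -RintegralD //; last first.
    have := integrableD measurableT (iZ (Re a) _ i1') (iZ (Im a) _ i1).
    by apply: eq_integrable => // x _.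
  apply: eq_Rintegral => x _; move: (f1 x) (f2 x) (g x) => [? ?] [? ?] [? ?]; case: (a) => ? ? /=.
  by ring.
by rewrite /L2inner e1 e2; case: a {e1 e2}.
Qed.

Lemma L2innerC f g : L2 mu f -> L2 mu g -> L2inner mu g f = (L2inner mu f g)^*.
Proof.
move=> Lf Lg; have [i1 i2] := L2_inner_integrable Lf Lg.
rewrite /L2inner /=; congr (_ +i* _).
  by apply: eq_Rintegral => x _; case: (f x) (g x) => [? ?] [? ?] /=; ring.
rewrite -mulN1r -RintegralZl //.
by apply: eq_Rintegral => x _; case: (f x) (g x) => [? ?] [? ?] /=; ring.
Qed.

Lemma L2inner_mass f : L2inner mu f f = (L2mass f)%:C.
Proof.
rewrite /L2inner /L2mass; congr (_ +i* _).
  by apply: eq_Rintegral => x _; rewrite /normsq; case: (f x) => a b /=; ring.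
rewrite -[RHS](mul0r (fine (mu setT))) -Rintegral_cst //.
by apply: eq_Rintegral => x _; case: (f x) => a b /=; ring.
Qed.

Lemma L2inner_ae f1 f2 g : L2 mu f1 -> L2 mu f2 -> L2 mu g ->
  {ae mu, forall x, f1 x = f2 x} -> L2inner mu f1 g = L2inner mu f2 g.
Proof.
move=> L1 L2 Lg f12.
have [/integrableP[i1 _] /integrableP[i1' _]] := L2_inner_integrable L1 Lg.
have [/integrableP[i2 _] /integrableP[i2' _]] := L2_inner_integrable L2 Lg.
rewrite /L2inner /Rintegral; congr (fine _ +i* fine _); apply: ae_eq_integral => //;
  by apply: filterS f12 => x e _ /=; rewrite e.
Qed.

Lemma L2inner_suml (I : Type) (s : seq I) (c : I -> C) (e : I -> T -> C) g :
  (forall i, L2 mu (e i)) -> L2 mu g ->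
  L2inner mu (fun x => \sum_(i <- s) c i * e i x) g = \sum_(i <- s) c i * L2inner mu (e i) g.
Proof.
move=> Le Lg; elim: s => [|i s IH].
  rewrite big_nil; have := L2inner_lin (-1) L2_0 L2_0 Lg.
  under [X in L2inner mu X]eq_fun do rewrite mulr0 addr0.
  rewrite mulN1r addNr => h0; rewrite -[RHS]h0.
  by congr L2inner; apply/funext => x; rewrite big_nil.
rewrite big_cons -IH -L2inner_lin //; last exact: L2_sum.
by congr L2inner; apply/funext => x; rewrite big_cons.
Qed.

Lemma L2_sub f g : L2 mu f -> L2 mu g -> L2 mu (fun x => f x - g x).
Proof.
move=> Lf Lg; have := L2_lin (-1) Lg Lf.
by under eq_fun do rewrite mulN1r addrC.
Qed.

Lemma L2inner_subl f1 f2 g : L2 mu f1 -> L2 mu f2 -> L2 mu g ->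
  L2inner mu (fun x => f1 x - f2 x) g = L2inner mu f1 g - L2inner mu f2 g.
Proof.
move=> L1 L2 Lg; rewrite -[RHS](_ : L2inner mu (fun x => -1 * f2 x + f1 x) g = _).
  by congr L2inner; apply/funext => x; rewrite mulN1r addrC.
by rewrite L2inner_lin // mulN1r addrC.
Qed.

Lemma L2mass_sub_orth f g : L2 mu f -> L2 mu g -> L2inner mu f g = 0 ->
  L2mass (fun x => f x - g x) = L2mass f + L2mass g.
Proof.
move=> Lf Lg fg0; apply: complexI; rewrite rmorphD /= -!L2inner_mass.
have gf0 : L2inner mu g f = 0 by rewrite L2innerC // fg0 conjc0.
have Lfg := L2_sub Lf Lg.
rewrite L2inner_subl // (L2innerC Lfg Lf) (L2innerC Lfg Lg) !L2inner_subl //.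
rewrite gf0 fg0 subr0 sub0r rmorphN opprK.
by congr (_ + _); apply: esym; apply: L2innerC.
Qed.

Lemma L2mass_ge0 f : 0 <= L2mass f.
Proof. by apply: Rintegral_ge0 => x _; apply: normsq_ge0. Qed.

Lemma small_mass_eq0 f : L2 mu f ->
  (forall eps : R, 0 < eps -> L2mass f < eps ^+ 2) -> eq0_L2 mu f.
Proof.
move=> Lf fe; apply: L2mass_eq0 => //; apply/eqP; rewrite eq_le L2mass_ge0 andbT.
rewrite leNgt; apply/negP => f0.
have /fe : 0 < Num.sqrt (L2mass f) by rewrite sqrtr_gt0.
by rewrite sqr_sqrtr ?ltxx // ltW.
Qed.

(** The remainder r of the expansion is orthogonal to the span of the basis.  If g in
    the span approaches f, then f - g is r minus an element of the span, so that its
    norm is at least that of r. *)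
Lemma orthonormal_expansion (V : set (T -> C)) (I : choiceType) (e : I -> T -> C)
    (J : {fset I}) f :
  closed_subspace mu V -> orthonormal_basis mu V e -> V f ->
  (forall i, i \notin J -> L2inner mu f (e i) = 0) ->
  {ae mu, forall x, f x = \sum_(i <- J) L2inner mu f (e i) * e i x}.
Proof.
move=> [VL2 _ _ _] [Ve eON eV] Vf fJ.
have Lf := VL2 _ Vf; have Le i := VL2 _ (Ve i).
pose s x := \sum_(i <- J) L2inner mu f (e i) * e i x.
have Ls : L2 mu s by apply: L2_sum.
pose r x := f x - s x; have Lr : L2 mu r by apply: L2_sub.
have re i : L2inner mu r (e i) = 0.
  rewrite L2inner_subl // L2inner_suml //.
  under eq_bigr do rewrite eON.
  have [iJ|iJ] := boolP (i \in J).
    rewrite (bigD1_seq i) //= eqxx mulr1 big1 ?addr0 ?subrr // => j /negPf ->.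
    by rewrite mulr0.
  rewrite fJ // sub0r big1_seq ?oppr0 // => j /andP[_ jJ].
  by have [ji|_] := eqVneq j i; rewrite ?mulr0 //; move: iJ; rewrite -ji jJ.
suff : eq0_L2 mu r by apply: filterS => x /eqP; rewrite subr_eq0 => /eqP.
apply: small_mass_eq0 => // eps eps0.
have [_ /(_ eps eps0)[g [J' [c gE]] fg]] : L2closure mu (linear_span e) f by rewrite eV.
pose g' x := g x - s x.
have Lg : L2 mu g by rewrite gE; apply: L2_sum.
have Lg' : L2 mu g' by apply: L2_sub.
have rg0 : L2inner mu r g' = 0.
  rewrite L2innerC // -[RHS](conjc0 R); congr (_ ^*).
  have er i : L2inner mu (e i) r = 0 by rewrite L2innerC // re conjc0.
  rewrite L2inner_subl // gE /lincomb !L2inner_suml //.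
  by rewrite !big1 ?subr0 // => i _; rewrite er mulr0.
have rgE : (fun x => r x - g' x) = (fun x => f x - g x).
  by apply/funext => x; rewrite /r /g'; ring.
have := L2mass_sub_orth Lr Lg' rg0; rewrite rgE => massE.
have := L2norm_lt_mass (L2_sub Lf Lg) eps0 fg; rewrite massE.
by have := L2mass_ge0 g'; lra.
Qed.

End L2Theory.

(** * Continuous functions with compact support *)

Section CcFunctions.
Context {R : realType}.
Local Notation C := R[i].
Implicit Types e f : R -> C.

Lemma normc_norm (z : C) : `|z| = (normc z)%:C.
Proof. by []. Qed.

Lemma continuous_normc f : continuous (f : R -> C^o) -> forall x (eps : R), 0 < eps ->
  exists2 del : R, 0 < del & forall y, `|x - y| < del -> normc (f x - f y) < eps.
Proof.
move=> cf x eps eps0; have e0 : 0 < eps%:C by rewrite ltcR.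
have /cvgrPdist_lt/(_ _ e0) := cf x.
move=> /nbhs_ballP[del /= del0 h]; exists del => // y xy.
by have := h y xy; rewrite /= normc_norm ltcR.
Qed.

(** Heine-Cantor: on a compact interval, continuity gives a bound and uniform
    continuity, and the support condition extends both to the line. *)
Lemma normc_continuous_Cc f (B : nat) :
  (forall x (eps : R), 0 < eps ->
    exists2 del : R, 0 < del & forall y, `|x - y| < del -> normc (f x - f y) < eps) ->
  (forall x, B%:R < `|x| -> f x = 0) -> Cc f.
Proof.
move=> cf fB.
pose K := `[- (B.+1%:R), B.+1%:R]%classic : set R.
have /compact_near_coveringP cK : compact K by apply: segment_compact.
have inK x : `|x| <= B.+1%:R -> K x by rewrite ler_norml /K /= in_itv.
split; first by exists B.
- have : \forall M \near +oo, K `<=` (fun x => normc (f x) <= M).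
    apply: (cK _ _ (fun M x => normc (f x) <= M)) => x _.
    have [del del0 h] := cf x 1 ltr01.
    exists (ball x del, [set M | normc (f x) + 1 < M]).
      split; first exact: nbhsx_ballx.
      by apply: nbhs_pinfty_gt; exact: num_real.
    move=> [y M] [/= xy fM]; have := normcB (f x) (f x - f y).
    rewrite (_ : f x - (f x - f y) = f y); last by ring.
    by have := h y xy; lra.
  move=> [M [_ /(_ (Num.max M 0 + 1))]]; rewrite (le_lt_trans (_ : M <= Num.max M 0)) ?ltrDl //.
    move=> /(_ isT) KM; exists (Num.max M 0 + 1).
      by rewrite addr_ge0 // le_max lexx orbT.
    move=> x; have [xB|xB] := leP `|x| B.+1%:R; first exact/KM/inK.
    rewrite fB ?normc0 ?addr_ge0 ?le_max ?lexx ?orbT //.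
    by apply: lt_trans xB; rewrite ltr_nat.
  by rewrite le_max lexx.
- move=> eps eps0.
  have : \forall del \near (0 : R)^'+, K `<=`
      (fun x => forall y, `|x - y| < del -> normc (f x - f y) <= eps).
    apply: (cK _ _ (fun (del : R) x => forall y, `|x - y| < del -> normc (f x - f y) <= eps)).
    move=> x _; have e2 : 0 < eps / 2 by rewrite divr_gt0.
    have [del del0 h] := cf x _ e2; have d2 : 0 < del / 2 by rewrite divr_gt0.
    exists (ball x (del / 2), [set d : R | d < del / 2]).
      split; first exact: nbhsx_ballx.
      exact: nbhs_right_lt.
    move=> [x' d] [/= xx' dd] y x'y.
    have h1 : normc (f x - f x') < eps / 2.
      by apply: h; apply: lt_trans xx' _; lra.
    have h2 : normc (f x - f y) < eps / 2.
      apply: h; have := ler_normD (x - x') (x' - y); rewrite addrA subrK.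
      by move: xx'; rewrite /ball /=; lra.
    have := normcB (f x - f y) (f x - f x').
    by rewrite (_ : f x - f y - (f x - f x') = f x' - f y); [lra|ring].
  move=> [d /= d0 dP]; exists (Num.min (d / 2) 1).
    by rewrite lt_min ltr01 divr_gt0.
  move=> x y; rewrite lt_min => /andP[xyd xy1].
  have d2P z : K z -> forall y, `|z - y| < d / 2 -> normc (f z - f y) <= eps.
    have := dP (d / 2); rewrite /= sub0r normrN ger0_norm ?divr_ge0 ?(ltW d0) //.
    by apply; rewrite ?divr_gt0 // ltr_pdivrMr // ltr_pMr // ltr1n.
  have [xB|xB] := leP `|x| B.+1%:R; first by apply: d2P => //; apply: inK.
  have yB : B%:R < `|y|.
    by have := ler_normD (x - y) y; rewrite subrK; move: xB; rewrite -natr1; lra.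
  rewrite !fB ?subrr ?normc0 ?ltW //.
  by apply: lt_trans xB; rewrite ltr_nat.
Qed.

Lemma Cc_conj e : Cc e -> Cc (fun x => (e x)^*).
Proof.
have nJ (z : C) : normc z^* = normc z by case: z => a b; rewrite /= sqrrN.
move=> [[B eB] [M M0 eM] eU]; split.
- by exists B => x /eB ->; rewrite conjc0.
- by exists M => // x; rewrite nJ.
- by move=> eps /eU[del del0 h]; exists del => // x y /h; rewrite -rmorphB nJ.
Qed.

Lemma Cc_mul e f : Cc e -> Cc f -> Cc (fun x => e x * f x).
Proof.
move=> [[B eB] [M M0 eM] eU] [_ [M' M'0 fM'] fU]; split.
- by exists B => x /eB ->; rewrite mul0r.
- exists (M * M'); first exact: mulr_ge0.
  by move=> x; rewrite normcM ler_pM ?normc_ge0.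
- move=> eps eps0; pose k := M + M' + 1.
  have k0 : 0 < k by rewrite ltr_wpDl // addr_ge0.
  have ek : 0 < eps / k by rewrite divr_gt0.
  have [d1 d10 h1] := eU _ ek; have [d2 d20 h2] := fU _ ek.
  exists (Num.min d1 d2); first by rewrite lt_min d10 d20.
  move=> x y; rewrite lt_min => /andP[/h1 x1 /h2 x2].
  rewrite (_ : _ - _ = (e x - e y) * f x + e y * (f x - f y)); last by ring.
  apply: (le_trans (normcD _ _)); rewrite !normcM.
  have := ler_pM (normc_ge0 _) (normc_ge0 _) x1 (fM' x).
  have := ler_pM (normc_ge0 _) (normc_ge0 _) (eM y) x2.
  have : eps = eps / k * k by rewrite divfK // lt0r_neq0.
  move: (normc _ * normc _) (normc _ * normc _) (ltW ek) => p q; set t := eps / k => t0 -> hp hq.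
  by rewrite /k; move: M0 M'0 hp hq t0; lra.
Qed.

Lemma normc_Re (z : C) : `|Re z| <= normc z.
Proof.
by case: z => a b; rewrite /= -sqrtr_sqr; apply: ler_wsqrtr; rewrite lerDl sqr_ge0.
Qed.

Lemma normc_Im (z : C) : `|Im z| <= normc z.
Proof.
by case: z => a b; rewrite /= -sqrtr_sqr; apply: ler_wsqrtr; rewrite lerDr sqr_ge0.
Qed.

Lemma normc_le_ReIm (z : C) : normc z <= `|Re z| + `|Im z|.
Proof.
rewrite -(@ler_pXn2r _ 2) ?nnegrE ?normc_ge0 ?addr_ge0 //.
rewrite -normsqE /normsq sqrrD !real_normK ?num_real //.
by rewrite addrAC lerDl mulrn_wge0 // mulr_ge0.
Qed.

End CcFunctions.

Section RiemannSums.
Context {R : realType}.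
Local Notation C := R[i].
Local Notation leb := (@lebesgue_measure R).
Implicit Types e f : R -> C.

Definition unif_supp (B : nat) (g : R -> R) := (forall x, B%:R < `|x| -> g x = 0) /\
  forall eps : R, 0 < eps -> exists2 del : R, 0 < del &
    forall x y, `|x - y| < del -> `|g x - g y| <= eps.

Lemma Cc_Re_Im e : Cc e -> exists B, unif_supp B (fun x => Re (e x)) /\
  unif_supp B (fun x => Im (e x)).
Proof.
move=> [[B eB] _ eU]; exists B; split; split.
- by move=> x /eB ->.
- move=> eps /eU[del del0 h]; exists del => // x y /h; apply: le_trans.
  by rewrite -raddfB normc_Re.
- by move=> x /eB ->.
- move=> eps /eU[del del0 h]; exists del => // x y /h; apply: le_trans.
  by rewrite -raddfB normc_Im.
Qed.

Lemma unif_supp_measurable B g : unif_supp B g -> measurable_fun setT g.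
Proof.
move=> [_ gU]; apply: continuous_measurable_fun => x.
apply/cvgrPdist_le => eps eps0; have [del del0 h] := gU _ eps0.
by near=> y; apply: h; near: y; apply: cvgr_dist_lt.
Unshelve. all: by end_near.
Qed.

Lemma unif_supp_bound B g : unif_supp B g -> exists2 M : R, 0 <= M & forall x, `|g x| <= M.
Proof.
move=> [gB gU].
have : Cc (fun x => (g x)%:C).
  apply: (@normc_continuous_Cc _ _ B) => [x eps eps0|x /gB ->//].
  have e2 : 0 < eps / 2 by rewrite divr_gt0.
  have [del del0 h] := gU _ e2; exists del => // y /h.
  by rewrite -rmorphB normcR; lra.
by case=> _ [M M0 gM] _; exists M => // x; have := gM x; rewrite normcR.
Qed.

Lemma unif_supp_integrable B g : unif_supp B g -> leb.-integrable setT (EFin \o g).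
Proof.
move=> gs; have mg := unif_supp_measurable gs.
have [M M0 gM] := unif_supp_bound gs; have [gB _] := gs.
have iI := integrableZl measurableT M (integrable_indic_itv (- B%:R) B%:R true false).
apply: (le_integrable measurableT _ _ iI); first exact/measurable_EFinP.
move=> x _ /=; rewrite lee_fin [leRHS]ger0_norm ?mulr_ge0 //.
have [xB|xB] := leP `|x| B%:R.
  rewrite indicE mem_setE in_itv /= (_ : _ && _ = true) ?mulr1 ?gM //.
  by move: xB; rewrite ler_norml.
by rewrite gB // normr0 mulr_ge0.
Qed.

End RiemannSums.

(** * Riemann sums *)

Section RiemannSums.
Context {R : realType}.
Local Notation C := R[i].
Local Notation leb := (@lebesgue_measure R).
Implicit Types e f : R -> C.

Lemma Rintegral_indic_itv (a b : R) b0 b1 : a < b ->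
  \int[leb]_x \1_([set` Interval (BSide b0 a) (BSide b1 b)] : set R) x = b - a.
Proof.
move=> ab; rewrite /Rintegral.
have -> : (\int[leb]_x (\1_([set` Interval (BSide b0 a) (BSide b1 b)] : set R) x)%:E =
    leb [set` Interval (BSide b0 a) (BSide b1 b)])%E.
  by rewrite integral_indic ?setIT.
by rewrite lebesgue_measure_itv /= lte_fin ab.
Qed.

Definition cell (N : nat) (n : int) : set R := `[n%:~R / N%:R, (n + 1)%:~R / N%:R[%classic.

Lemma mem_cell N (n : int) (x : R) : (0 < N)%N -> (x \in cell N n) = (Num.floor (x * N%:R) == n).
Proof.
move=> N0; have N0' : 0 < N%:R :> R by rewrite ltr0n.
rewrite mem_setE in_itv /= ler_pdivrMr // ltr_pdivlMr //.
by rewrite floor_eq.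
Qed.

Lemma step_sum (g : R -> R) N (s : seq int) : (0 < N)%N ->
  leb.-integrable setT (EFin \o (fun x => \sum_(n <- s) g (n%:~R / N%:R) * \1_(cell N n) x)) /\
  \int[leb]_x (\sum_(n <- s) g (n%:~R / N%:R) * \1_(cell N n) x) =
  (\sum_(n <- s) g (n%:~R / N%:R)) / N%:R.
Proof.
move=> N0; have N0' : 0 < N%:R :> R by rewrite ltr0n.
have iI n : leb.-integrable setT (EFin \o \1_(cell N n)) by apply: integrable_indic_itv.
have iZ n (k : R) : leb.-integrable setT (EFin \o (fun x => k * \1_(cell N n) x)).
  exact: (integrableZl measurableT k (iI n)).
have intI n : \int[leb]_x \1_(cell N n) x = N%:R^-1.
  rewrite Rintegral_indic_itv ?ltr_pM2r ?invr_gt0 // ?ltr_int ?ltrDl //.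
  by rewrite -mulrBl -intrB addrC addKr mul1r.
elim: s => [|n s [IH1 IH2]].
  split; last first.
    under eq_Rintegral do rewrite big_nil.
    by rewrite big_nil mul0r Rintegral_cst // mul0r.
  rewrite (_ : _ \o _ = cst 0%E); first exact: integrable0.
  by apply/funext => x /=; rewrite big_nil.
split.
  have := integrableD measurableT (iZ n (g (n%:~R / N%:R))) IH1.
  by apply: eq_integrable => // x _; rewrite /= big_cons.
under eq_Rintegral do rewrite big_cons.
by rewrite RintegralD // IH2 RintegralZl // intI big_cons mulrDl.
Qed.

(** The Riemann sum is the integral of the step function x |-> g(floor(x N)/N), which is
    uniformly close to g and vanishes outside a bounded interval. *)
Lemma riemann_sum_real B (g : R -> R) : unif_supp B g -> forall eps : R, 0 < eps ->
  exists N0, forall N, (N0 <= N)%N -> (0 < N)%N ->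
  `|(\sum_(n <- zwindow (B.+2 * N)) g (n%:~R / N%:R)) / N%:R - \int[leb]_x g x| <= eps.
Proof.
move=> gs eps eps0; have [gB gU] := gs; have ig := unif_supp_integrable gs.
pose eta := eps / (2 * B.+1%:R).
have eta0 : 0 < eta by rewrite divr_gt0 // mulr_gt0.
have [del del0 gdel] := gU _ eta0.
exists (Num.bound del^-1) => N Nb N0; have N0' : 0 < N%:R :> R by rewrite ltr0n.
have Ndel : N%:R^-1 < del.
  rewrite -(invrK del) ltf_pV2 ?posrE ?invr_gt0 //.
  apply: lt_le_trans (archi_boundP _) _; first by rewrite invr_ge0 ltW.
  by rewrite ler_nat.
have N1 : N%:R^-1 <= 1 :> R by rewrite invf_le1 // ler1n.
have [is_ <-] := step_sum g (zwindow (B.+2 * N)) N0.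
set s := fun x => \sum_(n <- _) _ in is_ *.
pose fl (x : R) := Num.floor (x * N%:R).
have flx x : (fl x)%:~R / N%:R <= x /\ x < (fl x)%:~R / N%:R + N%:R^-1.
  have := floor_le (x * N%:R); have := floorD1_gt (x * N%:R); rewrite -/(fl x) intrD => h1 h2.
  by rewrite ler_pdivrMr // -[X in _ + X]mul1r -mulrDl ltr_pdivlMr.
have flB x : (B.+2 * N < `|fl x|)%N -> g ((fl x)%:~R / N%:R) = 0.
  move=> h; apply: gB; rewrite normrM normfV (gtr0_norm N0') ltr_pdivlMr //.
  rewrite -natrM -intr_norm -[_%:R]/((B * N)%N%:Z%:~R) ltr_int; move: h; lia.
have sE x : s x = g ((fl x)%:~R / N%:R).
  have [flW|flW] := leqP `|fl x| (B.+2 * N).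
    rewrite /s (bigD1_seq (fl x)) ?zwindow_uniq ?mem_zwindow //= big1.
      by rewrite addr0 indicE mem_cell // eqxx mulr1.
    by move=> n nx; rewrite indicE mem_cell // eq_sym (negPf nx) mulr0.
  rewrite flB // /s big1_seq // => n /andP[_]; rewrite mem_zwindow => nW.
  rewrite indicE mem_cell //; case: eqP => [e|_]; last by rewrite mulr0.
  by move: flW; rewrite /fl e ltnNge nW.
have gsx x : `|s x - g x| <= eta * \1_`[- B.+1%:R, B.+1%:R]%classic x.
  rewrite sE; have [h1 h2] := flx x.
  have xd : `|(fl x)%:~R / N%:R - x| < del.
    by rewrite ler0_norm ?subr_le0 // opprB; lra.
  have [xB|xB] := leP `|x| B.+1%:R.
    rewrite indicE mem_setE in_itv /= (_ : _ && _ = true) ?mulr1; first exact: gdel.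
    by move: xB; rewrite ler_norml.
  rewrite (gB x) ?subr0; last by apply: lt_trans xB; rewrite ltr_nat.
  have fB : B%:R < `|(fl x)%:~R / N%:R : R|.
    move: h1 h2 xB; rewrite -natr1; move: ((fl x)%:~R / N%:R) => q h1 h2 xB.
    have h3 := ler_normD (x - q) q; have h4 : `|x - q| = x - q by rewrite ger0_norm ?subr_ge0.
    by move: h3; rewrite subrK h4; lra.
  rewrite gB // normr0; apply: mulr_ge0; first exact: ltW.
  by rewrite indicE.
have iI : leb.-integrable setT (EFin \o (fun x => eta * \1_`[- B.+1%:R, B.+1%:R]%classic x)).
  exact: (integrableZl measurableT eta (integrable_indic_itv (- B.+1%:R) B.+1%:R true false)).
have isg : leb.-integrable setT (EFin \o (fun x => s x - g x)).
  by have := integrableB measurableT is_ ig; apply: eq_integrable.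
rewrite -RintegralB //; apply: le_trans (le_normr_Rintegral measurableT isg) _.
apply: (@le_trans _ _ (\int[leb]_x (eta * \1_`[- B.+1%:R, B.+1%:R]%classic x))).
  by apply: le_Rintegral => //; exact: integrable_norm.
rewrite RintegralZl //; last exact: integrable_indic_itv.
have B0 : 0 < B.+1%:R :> R by rewrite ltr0n.
rewrite Rintegral_indic_itv; last by lra.
rewrite /eta (_ : B.+1%:R - - B.+1%:R = 2 * B.+1%:R :> R); last by ring.
by rewrite divfK // mulf_neq0 // lt0r_neq0.
Qed.

Definition cint e : C := (\int[leb]_x Re (e x)) +i* (\int[leb]_x Im (e x)).

Lemma riemann_sum e : Cc e -> forall eps : R, 0 < eps ->
  exists N0, forall N, (N0 <= N)%N -> (0 < N)%N ->
  normc ((N%:R^-1)%:C * zsum (fun n => e (n%:~R / N%:R)) - cint e) <= eps.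
Proof.
move=> ne eps eps0; have [B [reS imS]] := Cc_Re_Im ne.
have e2 : 0 < eps / 2 by rewrite divr_gt0.
have [N1 N1P] := riemann_sum_real reS e2; have [N2 N2P] := riemann_sum_real imS e2.
exists (maxn N1 N2) => N; rewrite geq_max => /andP[/N1P h1 /N2P h2] N0.
have N0' : 0 < N%:R :> R by rewrite ltr0n.
rewrite (@zsumE _ _ (B.+2 * N)); last first.
  move=> n nB; have xB : B%:R < `|n%:~R / N%:R| :> R.
    rewrite normrM normfV (gtr0_norm N0') ltr_pdivlMr //.
    rewrite -natrM -intr_norm -[_%:R]/((B * N)%N%:Z%:~R) ltr_int; move: nB; lia.
  by rewrite [LHS]complexE; case: reS imS => /(_ _ xB) -> _ [/(_ _ xB) -> _]; rewrite mulr0 addr0.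
apply: le_trans (normc_le_ReIm _) _.
move/(_ N0): h1; move/(_ N0): h2.
set S := \sum_(n <- _) e _.
have -> : \sum_(n <- zwindow (B.+2 * N)) Re (e (n%:~R / N%:R)) = Re S.
  by rewrite /S; elim/big_rec2: _ => // n x y _ ->; rewrite raddfD.
have -> : \sum_(n <- zwindow (B.+2 * N)) Im (e (n%:~R / N%:R)) = Im S.
  by rewrite /S; elim/big_rec2: _ => // n x y _ ->; rewrite raddfD.
rewrite /cint; case: S => a b /=; rewrite !mul0r subr0 addr0 !(mulrC N%:R^-1).
by lra.
Qed.

End RiemannSums.

(** * Null sets under affine maps and finite sums *)

Section AffineNullSets.
Context {R : realType}.
Local Notation leb := (@lebesgue_measure R).

Lemma affine_measurable (a b : R) : measurable_fun setT (fun x : R => a * x + b).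
Proof. by apply: measurable_funD => //; apply: measurable_funM. Qed.

(** The pushforward of a multiple of Lebesgue measure by the affine map has the right
    value on intervals. *)
Lemma lebesgue_affine (a b : R) (A : set R) : 0 < a -> measurable A ->
  leb A = (a%:E * leb ((fun x => (a * x + b)%R) @^-1` A))%E.
Proof.
move=> a0 mA; pose r : {nonneg R} := NngNum (ltW a0).
pose f : measurableTypeR R -> measurableTypeR R := fun x => a * x + b.
have mf : measurable_fun setT f := affine_measurable a b.
transitivity (pushforward (mscale r leb) f A); last by [].
apply: lebesgue_measure_unique => //= _ [[c d] _ <-].
rewrite /pushforward /mscale /=.
have -> : f @^-1` `]c, d]%classic = `](c - b) / a, (d - b) / a]%classic.
  apply/seteqP; split=> x /=; rewrite !in_itv /=.
    by rewrite ltr_pdivrMr // ler_pdivlMr // ltrBlDr lerBrDr mulrC.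
  by rewrite ltr_pdivrMr // ler_pdivlMr // ltrBlDr lerBrDr mulrC.
rewrite !lebesgue_measure_itv /= !lte_fin ltr_pM2r ?invr_gt0 // ltrD2r.
case: ifP => _; last by rewrite mule0.
rewrite -!EFinB -EFinM; congr (_%:E); field.
by rewrite lt0r_neq0.
Qed.

Lemma affine_null (a b : R) (A : set R) : 0 < a -> measurable A -> leb A = 0%E ->
  leb ((fun x => a * x + b) @^-1` A) = 0%E.
Proof.
move=> a0 mA A0; have := lebesgue_affine b a0 mA; rewrite A0 => /esym/eqP.
by rewrite mule_eq0 eqe (negPf (lt0r_neq0 a0)) /= => /eqP.
Qed.

Lemma ae_affine (a b : R) (P : R -> Prop) : 0 < a ->
  {ae leb, forall x, P x} -> {ae leb, forall x, P (a * x + b)}.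
Proof.
move=> a0 [A [mA A0 PA]]; exists ((fun x => a * x + b) @^-1` A); split.
- by rewrite -[X in measurable X]setTI; apply: affine_measurable.
- exact: affine_null.
- by move=> x /= nP; apply: PA.
Qed.

(** A null set contains no interval. *)
Lemma ae_dense (P : R -> Prop) (x del : R) : {ae leb, forall x, P x} -> 0 < del ->
  exists2 y, `|x - y| < del & P y.
Proof.
move=> [A [mA A0 PA]] del0; apply: contrapT => nP.
pose I := `]x - del, x + del[%classic : set R.
have sub : I `<=` A.
  move=> y; rewrite /I /= in_itv /= => /andP[y1 y2]; apply: PA => /= Py.
  by apply: nP; exists y => //; rewrite ltr_norml; lra.
have : (leb I <= leb A)%E by apply: le_measure => //; rewrite inE //; exact: measurable_itv.
rewrite A0 /I lebesgue_measure_itv /= lte_fin (_ : x - del < x + del); last by lra.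
by rewrite -EFinB lee_fin; lra.
Qed.

End AffineNullSets.

Section CcSums.
Context {R : realType}.
Local Notation C := R[i].
Local Notation leb := (@lebesgue_measure R).
Implicit Types e f : R -> C.

Lemma Cc0 : Cc (fun _ : R => 0 : C).
Proof.
split; first by exists 0%N.
- by exists 0 => // x; rewrite normc0.
- by move=> eps eps0; exists 1 => // x y _; rewrite subrr normc0 ltW.
Qed.

Lemma Cc_scale a e : Cc e -> Cc (fun x => a * e x).
Proof.
move=> [[B eB] [M M0 eM] eU]; split.
- by exists B => x /eB ->; rewrite mulr0.
- exists (normc a * M); first by rewrite mulr_ge0 ?normc_ge0.
  by move=> x; rewrite normcM ler_wpM2l ?normc_ge0.
- move=> eps eps0; have a1 : 0 < normc a + 1 by rewrite ltr_wpDl ?normc_ge0.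
  have /eU[del del0 h] : 0 < eps / (normc a + 1) by rewrite divr_gt0.
  exists del => // x y /h; rewrite ler_pdivlMr // -mulrBr normcM => k.
  by apply: le_trans k; rewrite mulrC ler_wpM2l ?normc_ge0 // lerDl.
Qed.

Lemma Cc_add e f : Cc e -> Cc f -> Cc (fun x => e x + f x).
Proof.
move=> [[B eB] [M M0 eM] eU] [[B' fB] [M' M'0 fM] fU]; split.
- exists (maxn B B') => x xB; rewrite eB ?fB ?addr0 //; apply: le_lt_trans xB;
  by rewrite ler_nat leq_max leqnn ?orbT.
- exists (M + M'); first exact: addr_ge0.
  by move=> x; rewrite (le_trans (normcD _ _)) // lerD.
- move=> eps eps0; have e2 : 0 < eps / 2 by rewrite divr_gt0.
  have [d1 d10 h1] := eU _ e2; have [d2 d20 h2] := fU _ e2.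
  exists (Num.min d1 d2); first by rewrite lt_min d10 d20.
  move=> x y; rewrite lt_min => /andP[/h1 x1 /h2 x2].
  rewrite (_ : _ - _ = (e x - e y) + (f x - f y)); last by ring.
  by rewrite (le_trans (normcD _ _)) //; move: (normc _) (normc _) x1 x2 => *; lra.
Qed.

Lemma Cc_sum (I : Type) (s : seq I) (e : I -> R -> C) :
  (forall i, Cc (e i)) -> Cc (fun x => \sum_(i <- s) e i x).
Proof.
move=> ne; elim: s => [|i s IH].
  by under [X in Cc X]eq_fun do rewrite big_nil; exact: Cc0.
by under [X in Cc X]eq_fun do rewrite big_cons; apply: Cc_add.
Qed.

Lemma Cc_ae_eq e f : Cc e -> Cc f -> {ae leb, forall x, e x = f x} -> e =1 f.
Proof.
move=> ne nf ef x.
have [_ _ eU] := Cc_add ne (Cc_scale (-1) nf).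
apply/eqP; rewrite -subr_eq0 -normc_eq0; apply/negPn/negP => nz.
have n0 : 0 < normc (e x - f x) by rewrite lt0r nz normc_ge0.
have n2 : 0 < normc (e x - f x) / 2 by rewrite divr_gt0.
have [del del0 h] := eU _ n2; have [y xy efy] := ae_dense x ef del0.
have := h x y xy; rewrite efy !mulN1r subrr subr0.
by move: n0; set n := normc _; lra.
Qed.

Lemma zsumD (F G : int -> C) : bsupp F -> bsupp G ->
  zsum (fun n => F n + G n) = zsum F + zsum G.
Proof.
move=> bF [W GW]; rewrite -(opprK (zsum G)) -[X in _ - X]mulN1r -zsumZ -zsumB //.
  by apply: eq_zsum => n; ring.
by exists W => n /GW ->; rewrite mulr0.
Qed.

Lemma signz_even (n : int) : (-1 : C) ^ (2 * n) = 1.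
Proof. by rewrite -exprz_exp -exprnP sqrrN expr1n exp1rz. Qed.

Lemma zsum_even (F : int -> C) :
  zsum (fun m => F m * (1 + (-1) ^ m)) = 2 * zsum (fun n => F (2 * n)).
Proof.
have N1 : (-1 : C) != 0 by rewrite oppr_eq0 oner_eq0.
have inj2 : set_inj [set: int] (fun n : int => 2 * n) by move=> x y _ _; lia.
rewrite -zsumZ /zsum -(@fsbig_image _ _ _ _ _ _ _ (fun m => 2 * F m) inj2).
transitivity (\sum_(m \in (fun n : int => 2 * n) @` setT) F m * (1 + (-1) ^ m)).
  apply/esym/fsbig_widen => // m [_ /= mo].
  have -> : m = 2 * (m %/ 2)%Z + 1.
    suff : (m %% 2)%Z != 0 by lia.
    by apply/negP => m2; apply: mo; exists (m %/ 2)%Z => //; lia.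
  by rewrite expfzDr // signz_even expr1z mul1r subrr mulr0.
by apply: eq_fsbigr => m; rewrite inE => -[n _ <-]; rewrite signz_even; ring.
Qed.

(** The values at 1 and -1 of the generating functions: 1 + (-1)^m is 2 if m is even and
    0 otherwise, so only pairs of indices with even difference contribute. *)
Lemma parity_sum (a b : int -> C) : bsupp a -> bsupp b ->
  zsum a * zsum b + zsum (fun k => a k * (-1) ^ k) * zsum (fun k => b k * (-1) ^ k) =
  2 * zsum (fun n => zsum (fun k => a k * b (k + 2 * n))).
Proof.
move=> [Wa a0] [Wb b0].
have N1 : (-1 : C) != 0 by rewrite oppr_eq0 oner_eq0.
rewrite (@exchange_zsum _ (fun n k => a k * b (k + 2 * n))); last first.
  exists (Wa + Wb)%N => n k; have [kW|kW _] := leqP `|k| Wa; last by rewrite a0 // mul0r.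
  by move=> nW; rewrite b0 ?mulr0 //; lia.
rewrite -[RHS]zsumZ [X in X + _]mulrC [X in _ + X]mulrC -(zsumZ (zsum b))
  -(zsumZ (zsum (fun k => b k * _))) -zsumD; last first.
- by exists Wa => n /a0 ->; rewrite mul0r mulr0.
- by exists Wa => n /a0 ->; rewrite mulr0.
apply: eq_zsum => k; rewrite zsumZ [RHS]mulrCA.
rewrite -[2 * _]/(2 * zsum (fun n => (fun m => b (k + m)) (2 * n))) -zsum_even.
transitivity (a k * (zsum b + (-1) ^ k * zsum (fun l => b l * (-1) ^ l))); first by ring.
congr (_ * _); rewrite -zsumZ -zsumD; last first.
- by exists Wb => n /b0 ->; rewrite mul0r mulr0.
- by exists Wb.
rewrite -(zsum_shift _ k); apply: eq_zsum => m.
rewrite (addrC m k) expfzDr // mulrDr mulr1; congr (_ + _).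
have e : (-1 : C) ^ k * (-1) ^ k = 1 by rewrite -expfzDr // -[k + k]mulr2n -mulr_natl signz_even.
transitivity (((-1) ^ k * (-1) ^ k) * (b (k + m) * (-1) ^ m)); first by ring.
by rewrite e mul1r.
Qed.

End CcSums.

(** * The mass of a refinable function *)

Section Mass.
Context {R : realType}.
Local Notation C := R[i].
Implicit Types f : R -> C.

(** The mask of f(x/b) if hs is the mask of f. *)
Definition rescale (b : nat) (hs : seq (C * int)) := [seq (u.1, b%:Z * u.2) | u <- hs].

Lemma two_scale_rescale b hs e f : (0 < b)%N -> two_scale hs e f ->
  two_scale (rescale b hs) (fun x => e (x / b%:R)) (fun x => f (x / b%:R)).
Proof.
move=> b0 ef x; have b0' : b%:R != 0 :> R by rewrite pnatr_eq0 -lt0n.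
rewrite /rescale big_map (_ : x / 2 / b%:R = (x / b%:R) / 2); last by ring.
rewrite ef; apply: eq_bigr => u _; congr (_ * f _).
by rewrite intrM -[b%:~R]/(b%:R); field.
Qed.

Lemma Cc_rescale b f : (0 < b)%N -> Cc f -> Cc (fun x => f (x / b%:R)).
Proof.
move=> b0 nf; have : Cc (fun x => f (b%:R^-1 * x + 0)).
  by apply: Cc_affine => //; rewrite invr_eq0 pnatr_eq0 -lt0n.
by under [X in Cc X -> _]eq_fun do rewrite addr0 mulrC.
Qed.

(** For large t the sum divided by 2^t is close to the integral of f(x/b), being a Riemann
    sum.  For the other t it is nonzero, since by refinement a zero at t would persist at all larger t. *)
Lemma sample_mass f hs (b : nat) : (0 < b)%N -> Cc f -> two_scale hs f f ->
  cint f != 0 ->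
  exists2 c0 : R, 0 < c0 &
    forall t, c0 * 2 ^+ t <= normc (sample (fun x => f (x / b%:R)) t 0 1).
Proof.
move=> b0 nf ff I0; have b0' : 0 < b%:R :> R by rewrite ltr0n.
pose fb x := f (x / b%:R).
have nI : 0 < normc (cint f) by rewrite normc_gt0.
have nI2 : 0 < normc (cint f) / 2 by rewrite divr_gt0.
have [N0 N0P] := riemann_sum nf nI2.
pose c1 := normc (cint f) / 2.
have big t : (N0 <= t)%N -> c1 * 2 ^+ t <= normc (sample fb t 0 1).
  move=> tN; have tb : (t <= b * 2 ^ t)%N.
    by apply: leq_trans (ltnW (ltn_expl t (ltnSn 1))) _; rewrite leq_pmull.
  have N1 : (0 < b * 2 ^ t)%N by rewrite muln_gt0 b0 expn_gt0.
  have := N0P _ (leq_trans tN tb) N1.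
  have -> : sample fb t 0 1 = zsum (fun n => f (n%:~R / (b * 2 ^ t)%N%:R)).
    apply: eq_zsum => n; rewrite exp1rz mulr1 addr0 /fb; congr f.
    by rewrite natrM natrX; field; rewrite exp2_neq0 lt0r_neq0.
  set S := zsum _; set N := (b * 2 ^ t)%N in N1 *.
  have N1' : 0 < N%:R :> R by rewrite ltr0n.
  move=> h; have := normcB ((N%:R^-1)%:C * S) ((N%:R^-1)%:C * S - cint f).
  rewrite (_ : (N%:R^-1)%:C * S - _ = cint f); last by ring.
  rewrite normcM normcR ger0_norm ?invr_ge0 ?ler0n // => h'.
  have h2 : c1 <= N%:R^-1 * normc S by rewrite /c1; lra.
  have : c1 * N%:R <= normc S by rewrite mulrC -ler_pdivlMl.
  apply: le_trans; rewrite ler_wpM2l ?(ltW nI2) //.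
  by rewrite -natrX ler_nat leq_pmull.
have nfb : Cc fb by exact: Cc_rescale.
have ffb := two_scale_rescale b0 ff.
have nz t : sample fb t 0 1 != 0.
  have step t' : sample fb t' 0 1 = 0 -> sample fb t'.+1 0 1 = 0.
    by move=> e; rewrite (sample_two_scale _ _ nfb ffb (oner_neq0 _)) mulr0 e mulr0.
  apply/eqP => e; have e' k : sample fb (k + t) 0 1 = 0.
    by elim: k => [//|k IH]; rewrite addSn step.
  have := big (N0 + t)%N (leq_addr _ _); rewrite e' normc0 leNgt => /negP; apply.
  by rewrite mulr_gt0.
have [x|m m0 mP] := @seq_lower_bound R [seq normc (sample fb t 0 1) / 2 ^+ t | t <- iota 0 N0].
  by case/mapP => t _ ->; rewrite divr_gt0 // normc_gt0.
exists (Num.min m c1); first by rewrite lt_min m0.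
move=> t; have [tN|tN] := leqP N0 t.
  by apply: le_trans (big t tN); rewrite ler_wpM2r ?exprn_ge0 // ge_min lexx orbT.
rewrite -ler_pdivlMr //; apply: (@le_trans _ _ m); first by rewrite ge_min lexx.
by apply: mP; apply/mapP; exists t; rewrite // mem_iota.
Qed.

(** On the support of f(x - k) the function f(x / 2^s) is almost constant, so the integral
    is almost a multiple of the conjugate of the integral of f.  The comparison is made on
    Riemann sums, where it only involves finite sums. *)
Lemma translate_coef_small f : Cc f -> cint f = 0 -> forall eta : R, 0 < eta ->
  exists s0, forall s, (s0 <= s)%N -> forall k : int,
  normc (cint (fun x => f (x / 2 ^+ s) * (f (x - k%:~R))^*)) <= eta.
Proof.
move=> nf I0 eta eta0; have [[B fB] [M M0 fM] fU] := nf.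
(* The tolerance e1 bounds the variation of f(x/2^s) on the support of f(x - k), and
   e2 below the errors of the two Riemann sums. *)
pose e1 := eta / (2 * ((2 * B + 1)%:R * M + 1)).
have K0 : 0 <= (2 * B + 1)%:R * M by rewrite mulr_ge0.
have e10 : 0 < e1 by rewrite divr_gt0 // mulr_gt0 // ltr_wpDl.
have [del del0 fdel] := fU _ e10.
pose e2 := eta / (2 * (M + 1)).
have e20 : 0 < e2 by rewrite divr_gt0 // mulr_gt0 // ltr_wpDl.
exists (Num.bound (B%:R / del)) => s sb k.
have Bs : B%:R / 2 ^+ s < del.
  rewrite ltr_pdivrMr // mulrC -ltr_pdivrMr //.
  apply: lt_le_trans (archi_boundP _) _; first by rewrite divr_ge0 // ltW.
  by rewrite -natrX ler_nat (leq_trans sb) // ltnW // ltn_expl.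
pose e x := f (x / 2 ^+ s) * (f (x - k%:~R))^*.
have ne : Cc e.
  apply: Cc_mul; last apply: Cc_conj.
    have : Cc (fun x => f ((2 ^+ s)^-1 * x + 0)).
      by apply: Cc_affine => //; rewrite invr_eq0 exp2_neq0.
    by under [X in Cc X -> _]eq_fun do rewrite addr0 mulrC.
  have : Cc (fun x => f (1 * x + - k%:~R)) by apply: Cc_affine; rewrite ?oner_neq0.
  by under [X in Cc X -> _]eq_fun do rewrite mul1r.
have [N1 N1P] := riemann_sum ne e20; have [N2 N2P] := riemann_sum nf e20.
pose N := (maxn N1 N2).+1.
have N0 : (0 < N)%N by [].
have N0' : 0 < N%:R :> R by rewrite ltr0n.
have h1 := N1P N (leqW (leq_maxl _ _)) N0; have := N2P N (leqW (leq_maxr _ _)) N0.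
rewrite I0 subr0 => h2.
have shiftE : zsum (fun n => (f (n%:~R / N%:R - k%:~R))^*) = (zsum (fun n => f (n%:~R / N%:R)))^*.
  have fW n : (B * N < `|n|)%N -> f (n%:~R / N%:R) = 0.
    move=> nB; apply: fB; rewrite normrM normfV (gtr0_norm N0') ltr_pdivlMr //.
    by rewrite -natrM -intr_norm -[_%:R]/((B * N)%N%:Z%:~R) ltr_int; clear -nB; lia.
  transitivity (zsum (fun n : int => (f (n%:~R / N%:R))^*)).
    rewrite -(zsum_shift _ (k * N%:Z)); apply: eq_zsum => n; congr ((f _)^*).
    by rewrite intrD intrM -[N%:~R]/(N%:R); field; rewrite lt0r_neq0.
  rewrite !(@zsumE _ _ (B * N)) ?rmorph_sum // => n /fW -> //.
  by rewrite conjc0.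
pose u n : C := (f (n%:~R / N%:R / 2 ^+ s) - f (k%:~R / 2 ^+ s)) * (f (n%:~R / N%:R - k%:~R))^*.
have nJ (z : C) : normc z^* = normc z by case: z => a b; rewrite /= sqrrN.
have far n : (B * N < `|(n - k * N%:Z)%R|)%N -> f (n%:~R / N%:R - k%:~R) = 0.
  move=> nB; apply: fB; rewrite (_ : _ - _ = (n - k * N%:Z)%:~R / N%:R); last first.
    by rewrite intrB intrM -[N%:~R]/(N%:R); field; rewrite lt0r_neq0.
  rewrite normrM normfV (gtr0_norm N0') ltr_pdivlMr //.
  by rewrite -natrM -intr_norm -[_%:R]/((B * N)%N%:Z%:~R) ltr_int; clear -nB; lia.
have absM (k' : int) : (`|(k' * N%:Z)%R| = `|k'| * N)%N by rewrite abszM.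
have sumE : zsum (fun n => e (n%:~R / N%:R)) =
    zsum u + f (k%:~R / 2 ^+ s) * (zsum (fun n => f (n%:~R / N%:R)))^*.
  transitivity (zsum u + f (k%:~R / 2 ^+ s) * zsum (fun n => (f (n%:~R / N%:R - k%:~R))^*)); last first.
    by rewrite shiftE.
  rewrite -zsumZ -zsumD.
  - by apply: eq_zsum => n; rewrite /e /u; ring.
  - exists (B * N + `|k| * N)%N => n nW; rewrite /u far ?rmorph0 ?mulr0 //; move: nW; rewrite -absM; move: (k * _) (B * N)%N; clear; lia.
  - exists (B * N + `|k| * N)%N => n nW; rewrite far ?rmorph0 ?mulr0 //; move: nW; rewrite -absM; move: (k * _) (B * N)%N; clear; lia.
have ub : normc (zsum u) <= (2 * (B * N)).+1%:R * (e1 * M).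
  apply: (@zsum_bound _ (k * N%:Z)) => n; first by move=> /far e0; rewrite /u e0 rmorph0 mulr0.
  have [xB|xB] := leP `|(n%:~R / N%:R - k%:~R : R)| B%:R; last first.
    by rewrite /u (fB _ xB) rmorph0 mulr0 normc0 mulr_ge0 // ltW.
  rewrite /u normcM nJ ler_pM ?normc_ge0 //; apply: fdel.
  rewrite -mulrBl normrM normfV (gtr0_norm (exp2_gt0 s)).
  by apply: le_lt_trans Bs; rewrite ler_wpM2r ?invr_ge0 ?exprn_ge0.
have ub' : N%:R^-1 * normc (zsum u) <= eta / 2.
  have h3 : (2 * (B * N)).+1%:R <= (2 * B + 1)%:R * N%:R :> R.
    by rewrite -natrM ler_nat mulnDl mul1n mulnA -addn1 leq_add2l.
  have e1M : 0 <= e1 * M by rewrite mulr_ge0 // ltW.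
  rewrite ler_pdivrMl //; apply: (le_trans (le_trans ub (ler_wpM2r e1M h3))).
  rewrite [leLHS](_ : _ = N%:R * ((2 * B + 1)%:R * M * e1)); last by ring.
  rewrite ler_pM2l //.
  have -> : eta / 2 = ((2 * B + 1)%:R * M + 1) * e1.
    by rewrite /e1; field; rewrite lt0r_neq0 // ltr_wpDl // mulr_ge0 // addr_ge0 // mulr_ge0.
  by rewrite ler_wpM2r ?(ltW e10) // lerDl.
have e2E : eta / 2 = (M + 1) * e2 by rewrite /e2; field; rewrite lt0r_neq0 // ltr_wpDl.
clearbody e2.
have h3 : normc (f (k%:~R / 2 ^+ s) * ((N%:R^-1)%:C * zsum (fun n => f (n%:~R / N%:R)))^*) <= M * e2.
  by rewrite normcM nJ ler_pM ?normc_ge0.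
rewrite sumE in h1; move: h1 h2 h3 ub'; move: (cint e) (zsum u) (zsum (fun n => f (n%:~R / N%:R))) (f (k%:~R / _)).
move=> I U Z F h1 h2 h3 hU.
have := normcB ((N%:R^-1)%:C * (U + F * Z^*)) ((N%:R^-1)%:C * (U + F * Z^*) - I).
rewrite (_ : _ - (_ - I) = I); last by ring.
have := normcD ((N%:R^-1)%:C * U) (F * ((N%:R^-1)%:C * Z)^*).
rewrite [X in normc X <= _](_ : _ = (N%:R^-1)%:C * (U + F * Z^*)); last first.
  have cR (x : R) : (x%:C)^*%R = x%:C :> C by apply/eqP; rewrite eq_complex /= oppr0 !eqxx.
  by rewrite rmorphM -[X in F * (X * _)]/((N%:R^-1)%:C^*%R) cR; ring.
have -> : normc ((N%:R^-1)%:C * U) = N%:R^-1 * normc U.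
  by rewrite normcM normcR ger0_norm ?invr_ge0 ?ler0n.
move: h1 hU h3 e2E; set p1 := normc (_ - I); set p2 := _ * normc U.
move: (normc (F * _)) (normc (_ * (U + _))) (normc I); clearbody p1 p2.
by rewrite mulrDl mul1r => *; lra.
Qed.

End Mass.

(** * The masks of a multiresolution analysis *)

Section L2Extra.
Context d (T : measurableType d) (R : realType) (mu : {measure set T -> \bar R}).
Local Notation C := R[i].
Implicit Types f g : T -> C.

Lemma ae_sub (P Q : T -> Prop) : (forall x, P x -> Q x) ->
  {ae mu, forall x, P x} -> {ae mu, forall x, Q x}.
Proof. by move=> PQ; apply: filterS. Qed.

Lemma ae_and (P Q : T -> Prop) : {ae mu, forall x, P x} ->
  {ae mu, forall x, Q x} -> {ae mu, forall x, P x /\ Q x}.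
Proof. by move=> hP hQ; apply: filterS2 hP hQ. Qed.

Lemma L2inner_disjoint f g : L2 mu f -> L2 mu g ->
  {ae mu, forall x, f x = 0 \/ g x = 0} -> L2inner mu f g = 0.
Proof.
move=> f2 g2 fg; have [iR iI] := L2_inner_integrable f2 g2.
have fg0 x : f x = 0 \/ g x = 0 -> f x * (g x)^* = 0.
  by case=> ->; rewrite ?mul0r // rmorph0 mulr0.
apply/eqP; rewrite /L2inner eq_complex /= /Rintegral; apply/andP; split; apply/eqP.
- rewrite (@ae_eq_integral _ _ _ mu setT (cst 0%E)) ?integral0 //.
  + exact: (measurable_int mu iR).
  + by apply: filterS fg => x /fg0 /= -> _.
- rewrite (@ae_eq_integral _ _ _ mu setT (cst 0%E)) ?integral0 //.
  + exact: (measurable_int mu iI).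
  + by apply: filterS fg => x /fg0 /= -> _.
Qed.

(** The closure condition allows g itself as an approximation of f. *)
Lemma closed_subspace_ae V f g : closed_subspace mu V -> L2 mu f -> V g ->
  {ae mu, forall x, f x = g x} -> V f.
Proof.
move=> [VL2 _ _ Vcl] f2 Vg fg; apply: Vcl; split=> // eps eps0; exists g => //.
have fg2 := L2_sub f2 (VL2 _ Vg).
apply: L2norm_mass_lt => //.
have : L2inner mu (fun x => f x - g x) (fun x => f x - g x) = 0.
  by apply: L2inner_disjoint => //; apply: filterS fg => x ->; left; rewrite subrr.
by rewrite L2inner_mass => -[].
Qed.

End L2Extra.

Section MRAMasks.
Context {R : realType}.
Local Notation C := R[i].
Local Notation leb := (@lebesgue_measure R).
Implicit Types f : R -> C.

Lemma compactly_supported_bound f : compactly_supported f ->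
  exists B : nat, {ae leb, forall x, B%:R < `|x| -> f x = 0}.
Proof.
move=> [K [/compact_bounded [M [_ KM]] fK]].
exists (Num.truncn M).+1; apply: ae_sub fK => x Kx Bx; apply: Kx => Kx.
by have /= := KM _ (truncnS_gt M) x Kx; rewrite leNgt Bx.
Qed.

Lemma continuous_supported_Cc f : continuous (f : R -> C^o) ->
  compactly_supported f -> Cc f.
Proof.
move=> /continuous_normc fC /compactly_supported_bound[B fB].
apply: (@normc_continuous_Cc _ _ B) => // x Bx.
have [//|fx] := eqVneq (f x) 0.
have nfx : 0 < normc (f x) by rewrite normc_gt0.
have [del del0 fdel] := fC x _ nfx.
have dB : 0 < Num.min del (`|x| - B%:R) by rewrite lt_min del0 subr_gt0.
have [y] := ae_dense x fB dB; rewrite lt_min => /andP[xy1 xy2] fy.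
have := fdel y xy1; rewrite fy ?subr0 ?ltxx //.
have := ler_normB x (x - y); rewrite (_ : x - (x - y) = y); last by ring.
have := ler_normD (x - y) y; rewrite subrK; lra.
Qed.

Section Masks.
Variables (V : int -> set (R -> C)) (phi psi : R -> C).
Hypotheses (VM : MRA V) (phiV : scaling_function V phi) (psiV : corresponding_wavelet V psi).
Hypotheses (phi_Cc : Cc phi) (psi_supp : compactly_supported psi).

Definition dilated (s : nat) : R -> C := fun x => phi (x / 2 ^+ s).

Lemma V_closed j : closed_subspace leb (V j). Proof. by case: VM. Qed.

Lemma V_L2 j f : V j f -> L2 leb f.
Proof. by case: (V_closed j) => VL2 _ _ _ /VL2. Qed.

Lemma translates_V0 m : V 0 (translates phi m).
Proof. by case: phiV => _ []. Qed.

Lemma translates_orthonormal m n :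
  L2inner leb (translates phi m) (translates phi n) = (m == n)%:R.
Proof. by case: phiV => _ []. Qed.

Lemma translates_L2 m : L2 leb (translates phi m).
Proof. exact: V_L2 (translates_V0 m). Qed.

Lemma dilated_V s : V (- s%:Z) (dilated s).
Proof.
elim: s => [|s IH].
  have -> : dilated 0 = translates phi 0; last exact: translates_V0.
  by apply/funext => x; rewrite /dilated /translates expr0 divr1 subr0.
case: VM => _ _ _ Vdil _; apply/Vdil.
have -> : - s.+1%:Z + 1 = - s%:Z by lia.
have -> // : (fun x => dilated s.+1 (2 * x)) = dilated s.
by apply/funext => x; rewrite /dilated exprS; congr phi; field; rewrite exp2_neq0.
Qed.

Lemma V_sub_V0 (s : nat) f : V (- s%:Z) f -> V 0 f.
Proof.
elim: s => [//|s IH] Vf; apply: IH; case: VM => _ Vsub _ _ _.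
by have := Vsub _ _ Vf; have -> : - s.+1%:Z + 1 = - s%:Z by lia.
Qed.

Lemma dilated_V0 s : V 0 (dilated s). Proof. exact: V_sub_V0 (dilated_V s). Qed.

Lemma dilated_L2 s : L2 leb (dilated s). Proof. exact: V_L2 (dilated_V0 s). Qed.

(** The expansion is finite, so that it holds pointwise almost everywhere and not only as
    an L2 limit. *)
Lemma V0_expansion v (W : nat) : V 0 v ->
  (forall k : int, (W < `|k|)%N -> L2inner leb v (translates phi k) = 0) ->
  {ae leb, forall x, v x =
    \sum_(k <- zwindow W) L2inner leb v (translates phi k) * translates phi k x}.
Proof.
move=> Vv vW; case: phiV => _ phiB.
pose J := [fset k in zwindow W]%fset.
have := @orthonormal_expansion _ _ _ leb _ _ _ J v (V_closed 0) phiB Vv.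
case: (pselect (forall i, i \notin J -> L2inner leb v (translates phi i) = 0)) => [h|h].
  move=> /(_ h); apply: ae_sub => x ->; apply: perm_big.
  by apply: uniq_perm; rewrite ?zwindow_uniq // => k; rewrite in_fset.
case: h => k; rewrite in_fset mem_zwindow -ltnNge; exact: vW.
Qed.

Definition dilated_coef s k := L2inner leb (dilated s) (translates phi k).

Lemma dilated_coef_supp s : exists W : nat, forall k : int, (W < `|k|)%N -> dilated_coef s k = 0.
Proof.
have [[B phiB] _ _] := phi_Cc.
exists (B * 2 ^ s + B)%N => k kW; apply: L2inner_disjoint; [exact: dilated_L2|exact: translates_L2|].
apply: aeW => x; rewrite /dilated /translates.
have [xB|xB] := ltP (B * 2 ^ s)%N%:R `|x|.
  left; apply: phiB; rewrite normrM normfV (gtr0_norm (exp2_gt0 s)) ltr_pdivlMr ?exp2_gt0 //.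
  by rewrite -natrX -natrM.
right; apply: phiB; have : (B * 2 ^ s + B)%N%:R < `|k%:~R| :> R.
  by rewrite -intr_norm -[_%:R]/((B * 2 ^ s + B)%N%:Z%:~R) ltr_int; lia.
have := ler_normD (k%:~R - x) x; rewrite subrK distrC natrD; lra.
Qed.

Lemma dilated_expansion s (W : nat) : (forall k : int, (W < `|k|)%N -> dilated_coef s k = 0) ->
  forall x, dilated s x = \sum_(k <- zwindow W) dilated_coef s k * phi (x - k%:~R).
Proof.
move=> sW; apply: Cc_ae_eq; last exact: V0_expansion (dilated_V0 s) sW.
  have : Cc (fun x => phi ((2 ^+ s)^-1 * x + 0)).
    by apply: Cc_affine; rewrite ?invr_eq0 ?exp2_neq0.
  by under [X in Cc X -> _]eq_fun do rewrite addr0 mulrC.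
apply: Cc_sum => k; apply: Cc_scale.
have : Cc (fun x => phi (1 * x + - k%:~R)) by apply: Cc_affine; rewrite ?oner_neq0.
by under [X in Cc X -> _]eq_fun do rewrite mul1r.
Qed.

(** If the integral were 0, the coefficients of phi(x / 2^s) in the translates of phi would
    tend to 0 uniformly as s grows, while only boundedly many translates contribute at a
    given point.  Evaluation at 2^s x0 would give phi(x0) = 0. *)
Lemma scaling_integral_neq0 : cint phi != 0.
Proof.
apply/eqP => I0; have [[B phiB] [M M0 phiM] _] := phi_Cc.
have [x0 px0] : exists x0, phi x0 != 0.
  apply: contrapT => h; have p0 x : phi x = 0.
    by apply: contrapT => /eqP px; apply: h; exists x.
  have := translates_orthonormal 0 0; rewrite L2inner_disjoint ?eqxx.
  - by move/esym/eqP; rewrite oner_eq0.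
  - exact: translates_L2.
  - exact: translates_L2.
  - by apply: aeW => x; left; apply: p0.
have nx0 : 0 < normc (phi x0) by rewrite normc_gt0.
pose K : R := (2 * B.+1).+1%:R * (M + 1).
have K0 : 0 < K by rewrite mulr_gt0 // ltr_wpDl.
pose eta := normc (phi x0) / (2 * K).
have eta0 : 0 < eta by rewrite divr_gt0 // mulr_gt0.
have [s sP] := translate_coef_small phi_Cc I0 eta0.
have {sP} := sP s (leqnn s) => sP.
have [W sW] := dilated_coef_supp s.
have := dilated_expansion sW (x0 * 2 ^+ s).
rewrite /dilated mulfK ?exp2_neq0 // -(@zsumE _ (fun k => dilated_coef s k * phi (x0 * 2 ^+ s - k%:~R))); last first.
  by move=> k /sW ->; rewrite mul0r.
move: (x0 * _) => x e.
have : normc (phi x0) <= (2 * B.+1).+1%:R * (eta * M).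
  (* The translates with |x - k| <= B contribute; they satisfy |k - floor x| <= B + 1. *)
  rewrite e; apply: (@zsum_bound _ (Num.floor x)) => k; last first.
    by rewrite normcM ler_pM ?normc_ge0 //; apply: sP.
  move=> kB; rewrite phiB ?mulr0 //.
  have := floor_le x; have := lt_succ_floor x.
  move: kB; move: (Num.floor x) => n kB; rewrite intrD mulr1z.
  have B0 : 0 <= B%:R :> R by [].
  have [kn|kn] := lerP 0 (k - n).
    have : (n + B.+1%:Z + 1)%:~R <= k%:~R :> R by rewrite ler_int; lia.
    rewrite !intrD mulr1z -[B.+1%:~R]/(B.+1%:R) -natr1 => h1 h2 h3.
    by rewrite distrC ger0_norm; lra.
  have : k%:~R <= (n - B.+1%:Z - 1)%:~R :> R by rewrite ler_int; lia.
  rewrite !intrD !intrN mulr1z -[B.+1%:~R]/(B.+1%:R) -natr1 => h1 h2 h3.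
  by rewrite ger0_norm; lra.
rewrite leNgt => /negP; apply.
have -> : normc (phi x0) = 2 * (K * eta) by rewrite /eta; field; rewrite lt0r_neq0.
have : (2 * B.+1).+1%:R * (eta * M) <= K * eta.
  rewrite /K [leLHS](_ : _ = (2 * B.+1).+1%:R * M * eta); last by ring.
  by rewrite ler_pM2r // ler_pM2l // lerDl.
have : 0 < K * eta by rewrite mulr_gt0.
lra.
Qed.

(** Level -1 is the finest one whose wavelets lie in V_0. *)
Definition coarse n : R -> C := wavelet_family psi (-1, n).

Lemma coarse_L2 n : L2 leb (coarse n).
Proof. by case: psiV => _ [+ _ _] _; apply. Qed.

Lemma coarse_orthonormal m n : L2inner leb (coarse m) (coarse n) = (m == n)%:R.
Proof. by case: psiV => _ [_ + _] _ => ->; rewrite xpair_eqE eqxx. Qed.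

(** For g a wavelet of level -1, the projection identity reads P_0 g - P_(-1) g = g, so g
    lies in V_0.  If v is in V_(-1), and hence in V_0, then both projections of g have the
    inner product <g, v> with v, and their difference has it as well. *)
Lemma coarse_V0 n : V 0 (coarse n) /\ forall v, V (-1) v -> L2inner leb (coarse n) v = 0.
Proof.
case: psiV => _ _ [P [Pproj Psum]].
have c2 := coarse_L2 n.
have [Vu0 u0P] := Pproj 0 _ c2; have [Vu1 u1P] := Pproj (-1) _ c2.
set u0 := P 0 (coarse n) in Vu0 u0P; set u1 := P (-1) (coarse n) in Vu1 u1P.
have Vu1' : V 0 u1 by exact: (@V_sub_V0 1).
have u02 := V_L2 Vu0; have u12 := V_L2 Vu1.
have d2 := L2_sub u02 u12.
have eqc : {ae leb, forall x, coarse n x = u0 x - u1 x}.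
  have : eq0_L2 leb (fun x => (u0 x - u1 x) - coarse n x).
    apply: small_mass_eq0; first exact: L2_sub.
    move=> eps eps0; apply: L2norm_lt_mass => //; first exact: L2_sub.
    have [J0 J0P] := Psum (-1) _ c2 eps eps0.
    have := J0P (n |` J0)%fset (fsubsetU1 _ _).
    have -> : (fun x => P (-1 + 1) (coarse n) x - P (-1) (coarse n) x -
        \sum_(i <- (n |` J0)%fset) L2inner leb (coarse n) (wavelet_family psi (-1, i)) *
          wavelet_family psi (-1, i) x) = (fun x => u0 x - u1 x - coarse n x) => //.
    apply/funext => x; congr (_ - _).
    rewrite (big_fsetD1 n) ?fset1U1 //= big_seq big1 ?addr0; last first.
      move=> i; rewrite in_fsetD1 => /andP[ni _].
      by rewrite coarse_orthonormal eq_sym (negbTE ni) mul0r.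
    by rewrite coarse_orthonormal eqxx mul1r.
  by apply: ae_sub => x /eqP; rewrite subr_eq0 => /eqP.
split.
  apply: closed_subspace_ae (V_closed 0) c2 _ eqc.
  case: (V_closed 0) => _ _ Vlin _.
  have -> : (fun x => u0 x - u1 x) = (fun x => -1 * u1 x + u0 x); last exact: Vlin.
  by apply/funext => x; rewrite mulN1r addrC.
move=> v Vv; have v2 := V_L2 Vv.
have := u0P v (@V_sub_V0 1 _ Vv); rewrite L2inner_subl // => /eqP; rewrite subr_eq0 => /eqP e0.
have := u1P v Vv; rewrite L2inner_subl // => /eqP; rewrite subr_eq0 => /eqP e1.
by rewrite (L2inner_ae _ _ _ eqc) // L2inner_subl // -e0 -e1 subrr.
Qed.

Definition detail_coef k := L2inner leb (coarse 0) (translates phi k).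

Lemma detail_coef_supp : exists W : nat, forall k : int, (W < `|k|)%N -> detail_coef k = 0.
Proof.
have [[B phiB] _ _] := phi_Cc; have [D psiD] := compactly_supported_bound psi_supp.
exists (2 * D + B)%N => k kW; apply: L2inner_disjoint; [exact: coarse_L2|exact: translates_L2|].
have half0 : 0 < (2 : R) ^ (-1) by rewrite exprz_gt0.
apply: ae_sub (ae_affine 0 half0 psiD) => x.
rewrite addr0 /coarse /wavelet_family /translates /= subr0 => xD.
have [xB|xB] := ltP B%:R `|x - k%:~R|; [by right; apply: phiB|left].
rewrite xD ?mulr0 // normrM gtr0_norm // mulrC -[_ ^ _]/(2^-1) ltr_pdivlMr //.
have : (2 * D + B)%N%:R < `|k%:~R| :> R.
  by rewrite -intr_norm -[_%:R]/((2 * D + B)%N%:Z%:~R) ltr_int; lia.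
have := ler_normD (k%:~R - x) x; rewrite subrK distrC natrD natrM.
move: xB; clear; move: `|x - _| `|x| `|k%:~R| D%:R B%:R => *; lra.
Qed.

Lemma coarse_expansion (W : nat) : (forall k : int, (W < `|k|)%N -> detail_coef k = 0) ->
  forall n, {ae leb, forall x, coarse n x =
    \sum_(k <- zwindow W) detail_coef k * translates phi (k + 2 * n) x}.
Proof.
move=> dW n; have := V0_expansion (coarse_V0 0).1 dW.
move/(ae_affine (- (2 * n)%:~R) ltr01); apply: ae_sub => x; rewrite mul1r.
rewrite /coarse /wavelet_family /= subr0 -[2 ^ (-1)]/(2^-1) => e; apply: etrans.
  apply: etrans _ e; congr (_ * psi _).
  by rewrite intrM; field.
apply: eq_bigr => k _; rewrite /translates; congr (_ * phi _).
by rewrite !intrD; ring.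
Qed.

(** The translate by 2n of the wavelet of level -1 is expanded in translates of phi; pairing
    with phi(x / 2) and with the wavelet itself gives the discrete orthogonality relations. *)
Lemma filter_orthogonality n :
  zsum (fun k => detail_coef k * (dilated_coef 1 (k + 2 * n))^*)%R = 0 /\
  zsum (fun k => detail_coef k * (detail_coef (k + 2 * n))^*)%R = (n == 0)%:R.
Proof.
have [W dW] := detail_coef_supp.
have cE g : L2 leb g -> L2inner leb (coarse n) g =
    zsum (fun k => detail_coef k * (L2inner leb g (translates phi (k + 2 * n)))^*)%R.
  move=> g2; rewrite (zsumE (W := W)); last by move=> k /dW ->; rewrite mul0r.
  rewrite (L2inner_ae _ _ _ (coarse_expansion dW n)) //; first last.
  - by apply: L2_sum => k; exact: translates_L2.
  - exact: coarse_L2.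
  rewrite L2inner_suml //; last by move=> k; exact: translates_L2.
  by apply: eq_bigr => k _; rewrite (L2innerC g2) //; exact: translates_L2.
split; last by rewrite -[LHS](cE _ (coarse_L2 0)) coarse_orthonormal.
by rewrite -[LHS](cE _ (dilated_L2 1)); apply: (coarse_V0 n).2; exact: (dilated_V 1).
Qed.

Lemma dilated_coef_bsupp s : bsupp (dilated_coef s). Proof. exact: dilated_coef_supp. Qed.
Lemma detail_coef_bsupp : bsupp detail_coef. Proof. exact: detail_coef_supp. Qed.

(** The mask at 1 and at -1. *)
Definition parity_value (a : int -> C) (b : bool) := zsum (fun k => a k * ((-1) ^+ b) ^ k).

Lemma conj_signz (k : int) : (((-1 : C) ^ k)^*)%R = (-1) ^ k.
Proof.
have conjX n : (((-1 : C) ^+ n)^*)%R = (-1) ^+ n by rewrite rmorphXn rmorphN1.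
by case: k => n; [exact: conjX|apply: etrans (fmorphV _ _) _; congr (_^-1); exact: conjX].
Qed.

Lemma parity_pairing (a b : int -> C) (e : int -> C) : bsupp a -> bsupp b ->
  (forall n, zsum (fun k => a k * (b (k + 2 * n))^*)%R = e n) ->
  (parity_value a false * (parity_value b false)^* +
   parity_value a true * (parity_value b true)^*)%R = 2 * zsum e.
Proof.
move=> aS bS abe.
have conjz F : bsupp F -> (zsum F)^*%R = zsum (fun k => (F k)^*%R).
  move=> [W FW]; rewrite !(zsumE (W := W)) ?rmorph_sum // => k /FW ->.
  exact: rmorph0.
have bS' : bsupp (fun k => (b k)^*%R) by case: bS => W bW; exists W => k /bW ->; exact: rmorph0.
have bSs c : bsupp (fun k => b k * ((-1) ^+ c) ^ k).
  by case: bS => W bW; exists W => k /bW ->; rewrite mul0r.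
have := parity_sum aS bS'; rewrite (eq_zsum abe) => <-.
have -> : parity_value a false = zsum a.
  by apply: eq_zsum => k; rewrite expr0 exp1rz mulr1.
have -> : parity_value b false = zsum b.
  by apply: eq_zsum => k; rewrite expr0 exp1rz mulr1.
have -> : (parity_value b true)^*%R = zsum (fun k => (b k)^*%R * (-1) ^ k).
  rewrite conjz //; apply: eq_zsum => k; rewrite rmorphM; congr (_ * _).
  by rewrite expr1; exact: conj_signz.
by rewrite conjz // /parity_value expr1.
Qed.

(** Both (g1, g2) and (h1, h2) are nonzero, and they are orthogonal; hence they are not
    proportional. *)
Lemma parity_det (h1 h2 g1 g2 r : C) : r != 0 -> h1 != 0 ->
  (g1 * h1^* + g2 * h2^*)%R = 0 -> (g1 * g1^* + g2 * g2^*)%R = 2 ->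
  h1 * (r * g2) - h2 * (r * g1) != 0.
Proof.
move=> r0 h10 gh gg; apply/eqP => det.
have det' : h1 * g2 = h2 * g1.
  apply: (mulfI r0); apply/eqP; rewrite -subr_eq0; apply/eqP; rewrite -[RHS]det; ring.
have H0 : (h1 * h1^* + h2 * h2^*)%R != 0.
  by apply: lt0r_neq0; rewrite ltr_pwDl ?mul_conjC_gt0 ?mul_conjC_ge0.
have g10 : g1 = 0.
  apply: (mulIf H0); rewrite mul0r mulrDr.
  transitivity (h1 * (g1 * h1^* + g2 * h2^*))%R; last by rewrite gh mulr0.
  rewrite mulrDr; congr (_ + _); first by rewrite mulrCA.
  by rewrite !mulrA det' [g1 * _]mulrC.
have g20 : g2 = 0 by apply: (mulfI h10); rewrite mulr0 det' g10 mulr0.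
by move/eqP: gg; rewrite g10 g20 !mul0r addr0 eq_sym pnatr_eq0.
Qed.

Definition coef_mask (r : C) (a : int -> C) (W : nat) := [seq (r * a k, k) | k <- zwindow W].

Lemma coef_maskE r (a : int -> C) W (b : bool) : (forall k : int, (W < `|k|)%N -> a k = 0) ->
  mask (coef_mask r a W) ((-1) ^+ b) = r * parity_value a b.
Proof.
move=> aW; rewrite /mask big_map /parity_value (zsumE (W := W)); last first.
  by move=> k /aW ->; rewrite mul0r.
by rewrite mulr_sumr; apply: eq_bigr => k _; rewrite mulrA.
Qed.

(** The function p is the finite expansion of the wavelet of level -1 in translates of
    phi, rescaled; it is continuous, and agrees with psi almost everywhere. *)
Lemma mra_masks : exists (p : R -> C) (hs gs : seq (C * int)),
  [/\ [/\ Cc p & {ae leb, forall x, psi x = p x}],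
      [/\ two_scale hs phi phi & two_scale gs p phi], cint phi != 0 &
      mask hs 1 * mask gs (-1) - mask hs (-1) * mask gs 1 != 0].
Proof.
have [W HW] := dilated_coef_supp 1; have [W' GW] := detail_coef_supp.
pose r : R := 2 `^ (2^-1).
have r0 : r%:C != 0 :> C.
  by rewrite -normc_eq0 normcR normr_eq0 lt0r_neq0 // powR_gt0.
pose hs := coef_mask 1 (dilated_coef 1) W; pose gs := coef_mask r%:C detail_coef W'.
pose p (x : R) := \sum_(u <- gs) u.1 * phi (2 * x - u.2%:~R).
have ff : two_scale hs phi phi.
  move=> x; have := dilated_expansion HW x; rewrite /dilated expr1 => ->.
  by rewrite /hs /coef_mask [RHS]big_map; apply: eq_bigr => k _; rewrite mul1r.
exists p, hs, gs; split; first split.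
- apply: Cc_sum => u; apply: Cc_scale; apply: Cc_affine => //.
- have two0 : 0 < 2 :> R by [].
  have := coarse_expansion GW 0; move/(ae_affine 0 two0).
  apply: ae_sub => x; rewrite addr0 /coarse /wavelet_family /= => e; rewrite /p /gs /coef_mask [RHS]big_map.
  (* The factor r undoes the normalisation 2^(-1/2) of the wavelets of level -1. *)
  have -> : psi x = r%:C * ((2 `^ (-1 / 2))%:C * psi (2 ^ (-1) * (2 * x) - 0)).
    rewrite subr0 -[2 ^ (-1)]/(2^-1) mulKf // mulrA -rmorphM /= /r mulN1r.
    by rewrite -powRD ?subrr ?powRr0 ?mul1r //; apply/implyP.
  rewrite e mulr_sumr; apply: eq_bigr => k _.
  by rewrite mulrA /translates mulr0 addr0.
- split=> // x; rewrite /p; apply: eq_bigr => u _; congr (_ * phi (_ - _)).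
  by rewrite mulrC divfK.
- exact: scaling_integral_neq0.
have := @sample_mass _ phi hs 1 _ phi_Cc ff scaling_integral_neq0.
have -> : (fun x => phi (x / 1%:R)) = phi by apply/funext => x; rewrite divr1.
case=> // c0 c00 mass; have := mask_one_neq0 phi_Cc ff c00 mass.
have h1E : mask hs 1 = parity_value (dilated_coef 1) false.
  exact: etrans (@coef_maskE 1 _ W false HW) (mul1r _).
have h2E : mask hs (-1) = parity_value (dilated_coef 1) true.
  exact: etrans (@coef_maskE 1 _ W true HW) (mul1r _).
have g1E : mask gs 1 = r%:C * parity_value detail_coef false.
  exact: (@coef_maskE _ _ W' false GW).
have g2E : mask gs (-1) = r%:C * parity_value detail_coef true.
  exact: (@coef_maskE _ _ W' true GW).
clearbody hs gs; rewrite h1E h2E g1E g2E => h1.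
apply: parity_det => //.
- rewrite (parity_pairing detail_coef_bsupp (dilated_coef_bsupp 1) (fun n => (filter_orthogonality n).1)).
  by rewrite (zsumE (W := 0)) ?big1 ?mulr0.
- rewrite (parity_pairing detail_coef_bsupp detail_coef_bsupp (fun n => (filter_orthogonality n).2)).
  rewrite (zsumE (W := 0)); first by rewrite big_cons big_nil addr0 mulr1.
  by move=> n; case: eqP => // ->.
Qed.

End Masks.

End MRAMasks.

(** * Almost everywhere identities in the plane *)

Section Plane.
Context {R : realType}.
Local Notation C := R[i].
Local Notation leb := (@lebesgue_measure R).
Local Notation leb2 := (leb \x leb)%E.

Lemma plane_affine_measurable (a b e : R) :
  measurable_fun setT (fun x : R * R => a * x.1 + b * x.2 + e).
Proof.
apply: measurable_funD => //; apply: measurable_funD; apply: measurable_funM => //.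
Qed.

(** Fubini: on each horizontal line the condition fails on a null set, as the preimage of
    a null set by an affine map of positive slope. *)
Lemma ae_plane1 (a b e : R) (P : R -> Prop) : 0 < a -> {ae leb, forall x, P x} ->
  {ae leb2, forall x, P (a * x.1 + b * x.2 + e)}.
Proof.
move=> a0 [A [mA A0 PA]]; pose L (x : R * R) := a * x.1 + b * x.2 + e.
have mLA : measurable (L @^-1` A).
  by rewrite -[X in measurable X]setTI; apply: plane_affine_measurable.
exists (L @^-1` A); split => //; last by move=> x /= nP; apply: PA.
apply: etrans (@product_measure_unique _ _ _ _ _ leb leb (leb \x^ leb)%E _ _ mLA) _.
  by move=> B D mB mD; rewrite /= product_measure2E.
rewrite /= /product_measure2 integral0_eq // => y _ /=.
rewrite (_ : ysection _ _ = (fun x => a * x + (b * y + e)) @^-1` A); first exact: affine_null.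
by apply/seteqP; split => x; rewrite /ysection /= /L inE /= addrA.
Qed.

Lemma ae_plane2 (a b e : R) (P : R -> Prop) : 0 < b -> {ae leb, forall x, P x} ->
  {ae leb2, forall x, P (a * x.1 + b * x.2 + e)}.
Proof.
move=> b0 [A [mA A0 PA]]; pose L (x : R * R) := a * x.1 + b * x.2 + e.
have mLA : measurable (L @^-1` A).
  by rewrite -[X in measurable X]setTI; apply: plane_affine_measurable.
exists (L @^-1` A); split => //; last by move=> x /= nP; apply: PA.
rewrite /= /product_measure1 integral0_eq // => y _ /=.
rewrite (_ : xsection _ _ = (fun x => b * x + (a * y + e)) @^-1` A); first exact: affine_null.
by apply/seteqP; split => x; rewrite /xsection /= /L inE /= addrA [b * x + _]addrC.
Qed.

(** A null set of the plane contains no square. *)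
Lemma ae_plane_dense (P : R * R -> Prop) (x : R * R) (del : R) :
  {ae leb2, forall x, P x} -> 0 < del -> exists2 y, ball x del y & P y.
Proof.
move=> [A [mA A0 PA]] del0; apply: contrapT => nP.
pose I (t : R) := `]t - del, t + del[%classic : set R.
have sub : I x.1 `*` I x.2 `<=` A.
  move=> y; rewrite /I /= !in_itv /= => -[/andP[y1 y2] /andP[y3 y4]]; apply: PA => /= Py.
  apply: nP; exists y => //; split; rewrite /= -ball_normE /= ltr_norml; lra.
have mI t : measurable (I t) by exact: measurable_itv.
have Ilen t : leb (I t) = (2 * del)%:E.
  rewrite /I lebesgue_measure_itv /= lte_fin (_ : t - del < t + del); last by lra.
  by rewrite -EFinB; congr (_%:E); ring.
have : (leb2 (I x.1 `*` I x.2) <= leb2 A)%E.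
  by apply: le_measure => //; apply/mem_set => //; apply: measurableX; exact: mI.
have := @product_measure1E _ _ _ _ _ leb leb _ _ (mI x.1) (mI x.2).
rewrite A0 /= => -> ; rewrite !Ilen -EFinM lee_fin leNgt => /negP; apply.
by rewrite !mulr_gt0.
Qed.

Lemma Cc_continuous (f : R -> C) : Cc f -> continuous (f : R -> C^o).
Proof.
move=> [_ _ fU] x; apply/cvgrPdist_le => /= eps; rewrite ltcE => /= /andP[/eqP i0 r0].
have [del del0 fdel] := fU _ r0.
apply/nbhs_ballP; exists del => //= y xy.
by rewrite normc_norm lecE /= i0 eqxx; apply: fdel.
Qed.

Lemma affine_continuous2 (f : R -> C) (a b e : R) : Cc f ->
  continuous (fun x : R * R => f (a * x.1 + b * x.2 + e) : C^o).
Proof.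
move=> /Cc_continuous fC x.
apply: (@continuous_comp _ _ _ (fun x : R * R => a * x.1 + b * x.2 + e) (f : R -> C^o)); last exact: fC.
apply: cvgD; last exact: cvg_cst.
by apply: cvgD; apply: cvgMr; [exact: cvg_fst|exact: cvg_snd].
Qed.

Lemma continuous_suml (I : Type) (s : seq I) (c : I -> C) (e : I -> R * R -> C) :
  (forall i, continuous (e i : R * R -> C^o)) ->
  continuous (fun x => \sum_(i <- s) c i * e i x : C^o).
Proof.
move=> eC x; elim: s => [|i s IH].
  by under eq_fun do rewrite big_nil; exact: cvg_cst.
under eq_fun do rewrite big_cons.
apply: cvgD; last exact: IH.
by apply: cvgMr; exact: eC.
Qed.

Lemma continuous_ae_eq0 (F : R * R -> C) : continuous (F : R * R -> C^o) ->
  {ae leb2, forall x, F x = 0} -> forall x, F x = 0.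
Proof.
move=> FC F0 x; have [//|Fx] := eqVneq (F x) 0.
have nFx : 0 < `|F x| by rewrite normr_gt0.
have /cvgrPdist_lt/(_ _ nFx)/nbhs_ballP[del /= del0 h] := FC x.
have [y xy Fy] := ae_plane_dense x F0 del0.
by have := h y xy; rewrite /= Fy subr0 ltxx.
Qed.

End Plane.

(** * Shearlets of a multiresolution analysis *)

Section ShearletSystem.
Context {R : realType}.
Local Notation C := R[i].
Local Notation leb := (@lebesgue_measure R).
Local Notation leb2 := (leb \x leb)%E.

Lemma ae_eq_sum d (T : measurableType d) (mu : {measure set T -> \bar R}) (I : Type)
    (s : seq I) (w : I -> C) (e e' : I -> T -> C) :
  (forall i, {ae mu, forall x, e i x = e' i x}) ->
  {ae mu, forall x, \sum_(i <- s) w i * e i x = \sum_(i <- s) w i * e' i x}.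
Proof.
move=> ee; elim: s => [|i s IH]; first by apply: aeW => x; rewrite !big_nil.
by apply: ae_sub (ae_and (ee i) IH) => x [eE sE]; rewrite !big_cons eE sE.
Qed.

(** The separable generators, with p free to be psi or its continuous representative. *)
Definition separable_system (f p : R -> C) (c : R * R) :=
  shearlet_system (fun x => f x.1 * f x.2) (fun x => p x.1 * f x.2)
    (fun x => p x.2 * f x.1) c.

Lemma separable_system_ae (f p q : R -> C) c i : {ae leb, forall x, p x = q x} ->
  {ae leb2, forall x, separable_system f p c i x = separable_system f q c i x}.
Proof.
move=> pq; case: i => [[m|[[j k] m]]|[[j k] m]] /=; first exact: aeW.
- have := ae_plane1 (k%:~R * 2 ^+ j./2) (- (c.1 * m.1%:~R)) (exp2_gt0 j) pq.
  apply: ae_sub => x; rewrite -(mulrA k%:~R) => e.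
  by rewrite [p _]e.
- have := ae_plane2 (k%:~R * 2 ^+ j./2) (- (c.1 * m.2%:~R)) (exp2_gt0 j) pq.
  apply: ae_sub => x; rewrite -(mulrA k%:~R) => e.
  by rewrite [p _]e.
Qed.

Lemma separable_system_continuous (f p : R -> C) c i : Cc f -> Cc p ->
  continuous (separable_system f p c i : R * R -> C^o).
Proof.
move=> fn pn.
have aff (g : R -> C) (L : R * R -> R) a b e : Cc g ->
    (forall x, L x = a * x.1 + b * x.2 + e) -> continuous (fun x => g (L x) : C^o).
  move=> gn LE; under eq_fun do rewrite LE; exact: affine_continuous2.
case: i => [[m|[[j k] m]]|[[j k] m]] x; rewrite /separable_system /=.
- by apply: cvgM; [apply: (aff f (fun y => y.1 - c.1 * m.1%:~R) 1 0 (- (c.1 * m.1%:~R)))|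
    apply: (aff f (fun y => y.2 - c.1 * m.2%:~R) 0 1 (- (c.1 * m.2%:~R)))] => // z; ring.
- apply: cvgMr; apply: cvgM.
    by apply: (aff p (fun y => 2 ^+ j * y.1 + k%:~R * (2 ^+ j./2 * y.2) - c.1 * m.1%:~R)
      (2 ^+ j) (k%:~R * 2 ^+ j./2) (- (c.1 * m.1%:~R))) => // z; ring.
  by apply: (aff f (fun y => 2 ^+ j./2 * y.2 - c.2 * m.2%:~R)
    0 (2 ^+ j./2) (- (c.2 * m.2%:~R))) => // z; ring.
- apply: cvgMr; apply: cvgM.
    by apply: (aff p (fun y => k%:~R * (2 ^+ j./2 * y.1) + 2 ^+ j * y.2 - c.1 * m.2%:~R)
      (k%:~R * 2 ^+ j./2) (2 ^+ j) (- (c.1 * m.2%:~R))) => // z; ring.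
  by apply: (aff f (fun y => 2 ^+ j./2 * y.1 - c.2 * m.1%:~R)
    (2 ^+ j./2) 0 (- (c.2 * m.1%:~R))) => // z; ring.
Qed.

Definition weight (i : shearlet_parameter) : C :=
  match i with
  | inl (inl _) => 1
  | inl (inr (j, _, _)) | inr (j, _, _) => (2 `^ (3 * j%:R / 4))%:C
  end.

Lemma weight_neq0 i : weight i != 0.
Proof.
have w0 (x : R) : (2 `^ x)%:C != 0 :> C.
  by rewrite -normc_eq0 normcR normr_eq0 lt0r_neq0 // powR_gt0.
by case: i => [[m|[[j k] m]]|[[j k] m]] /=; rewrite ?oner_neq0.
Qed.

(** Stretching the plane by b1 b2 turns the rational lattice constants into the integers
    a1 b2 and a2 b1. *)
Lemma separable_system_atom (f p : R -> C) (a1 b1 a2 b2 : nat) i y :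
  (0 < b1)%N -> (0 < b2)%N -> let b := (b1 * b2)%N%:R : R in
  separable_system f p (a1%:R / b1%:R, a2%:R / b2%:R) i (y.1 / b, y.2 / b) =
  weight i * shearlet_atom (fun x => f (x / b)) (fun x => p (x / b))
    (a1 * b2)%N%:Z (a2 * b1)%N%:Z i y.
Proof.
move=> b10 b20 b.
have n1 : b1%:R != 0 :> R by rewrite pnatr_eq0 -lt0n.
have n2 : b2%:R != 0 :> R by rewrite pnatr_eq0 -lt0n.
have s1 (m : int) : a1%:R / b1%:R * m%:~R = ((a1 * b2)%N%:Z * m)%:~R / b :> R.
  by rewrite intrM -[((a1 * b2)%N%:Z)%:~R]/((a1 * b2)%N%:R) /b !natrM; field; rewrite n1 n2.
have s2 (m : int) : a2%:R / b2%:R * m%:~R = ((a2 * b1)%N%:Z * m)%:~R / b :> R.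
  by rewrite intrM -[((a2 * b1)%N%:Z)%:~R]/((a2 * b1)%N%:R) /b !natrM; field; rewrite n1 n2.
case: i => [[m|[[j k] m]]|[[j k] m]]; rewrite /separable_system /=.
- by rewrite !s1 -!mulrBl mul1r.
- by rewrite s1 s2; congr (_ * (p _ * f _)); ring.
- by rewrite s1 s2; congr (_ * (p _ * f _)); ring.
Qed.

End ShearletSystem.

Theorem theorem4p3 (R : realType) (phi psi psit : R * R -> R[i]%C) (c : R * R) :
  admissible phi psi psit c ->
  linearly_independent (@lebesgue_measure R \x @lebesgue_measure R)%E shearlet_range
    (shearlet_system phi psi psit c).
Proof.
move=> [V [f [p1 [a1 [b1 [a2 [b2 [[VM fV pV] [fC fS pS] [-> -> ->] [[a10 a20] [b1o b2o] ->] _]]]]]]]].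
move=> J JD w; split; last first.
  by move=> w0; apply: aeW => x; rewrite /lincomb big_seq big1 // => i iJ; rewrite w0 ?mul0r.
move=> ae0 i iJ.
have fn := continuous_supported_Cc fC fS.
have [p [hs [gs [[pn pae] [ff pf] I0 det]]]] := mra_masks VM fV pV fn pS.
have b10 := odd_gt0 b1o; have b20 := odd_gt0 b2o.
have b0 : (0 < b1 * b2)%N by rewrite muln_gt0 b10.
have [c0 c00 mass] := sample_mass b0 fn ff I0.
pose sys := separable_system f p (a1%:R / b1%:R, a2%:R / b2%:R).
have sum0 x : \sum_(i <- J) w i * sys i x = 0.
  move: x; apply: continuous_ae_eq0; first by apply: continuous_suml => i'; exact: separable_system_continuous.
  have sE := ae_eq_sum J w (fun i => separable_system_ae f (a1%:R / b1%:R, a2%:R / b2%:R) i pae).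
  by apply: ae_sub (ae_and sE ae0) => x [<- ].
have mask1 l : mask (rescale (b1 * b2) l) 1 = mask l 1 :> R[i].
  by rewrite /mask big_map; apply: eq_bigr => u _; rewrite !exp1rz.
(* Here the denominators must be odd: (-1)^(b k) = (-1)^k. *)
have maskN1 l : mask (rescale (b1 * b2) l) (-1) = mask l (-1) :> R[i].
  rewrite /mask big_map; apply: eq_bigr => u _ /=; congr (_ * _).
  rewrite -exprz_exp; congr (_ ^ _).
  by rewrite -exprnP -signr_odd oddM b1o b2o.
have A10 : (a1 * b2)%N%:Z != 0 by lia.
have A20 : (a2 * b1)%N%:Z != 0 by lia.
have det' : mask (rescale (b1 * b2) hs) 1 * mask (rescale (b1 * b2) gs) (-1) -
    mask (rescale (b1 * b2) hs) (-1) * mask (rescale (b1 * b2) gs) 1 != 0.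
  by rewrite !mask1 !maskN1.
have free := shearlet_atoms_free (Cc_rescale b0 fn) (Cc_rescale b0 pn)
  (two_scale_rescale b0 ff) (two_scale_rescale b0 pf) c00 mass det' A10 A20.
have : w i * weight i = 0.
  apply: (free J (fun i => w i * weight i) JD _ i iJ) => y.
  rewrite -[RHS](sum0 (y.1 / (b1 * b2)%N%:R, y.2 / (b1 * b2)%N%:R)).
  by apply: eq_bigr => j _; rewrite /sys separable_system_atom // mulrA.
by move/eqP; rewrite mulf_eq0 (negbTE (weight_neq0 i)) orbF => /eqP.
Qed.
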